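(* Let $T$ be a regular tree and let $H$ be a bounded and spherically symmetric (around the vertex $v_0$) Schrödinger operator on $\ell^2(T)$. Let $J_H$ be the Jacobi matrix associated with $H$, let $\{J^{(r)}\}$ be the set of right limits of $J_H$, and let $\{J_{(s)}\}$ be the set of strong limits of the sequence $\{J_n\}_{n=1}^\infty$ of tails of $J_H$. Then $$\sigma_{\mathrm{ess}}(H)=\left(\bigcup_{r}\sigma\left(J^{(r)}\right)\right)\cup\left(\bigcup_{s}\sigma\left(J_{(s)}\right)\right).$$
   Context: A regular tree is the infinite $d$-regular tree with $d>2$; $u\sim v$ means that $u,v$ are adjacent and $|v|=\mathrm{dist}(v,v_0)$. A Schrödinger operator on $T$ is an operator $H$ on $\ell^2(T)$ acting by $(H\psi)(v)=\sum_{u\sim v}(\psi(u)-\psi(v))+Q(v)\psi(v)$ with $Q:T\to\mathbb{R}$ bounded; it is spherically symmetric around $v_0\in T$ if $Q(v)=q(|v|+1)$ for some $q:\mathbb{N}\to\mathbb{R}$. $\sigma(\cdot)$ is the spectrum and $\sigma_{\mathrm{ess}}(\cdot)$ the essential spectrum (the spectrum minus the isolated eigenvalues of finite multiplicity). Let $V_0\subset\ell^2(T)$ be the closed span of $\{H^n\delta_{v_0}:n\ge0\}$. Applying the Gram–Schmidt process to $\delta_{v_0},H\delta_{v_0},H^2\delta_{v_0},\dots$ gives an orthonormal basis of $V_0$, and $J_H$ is the matrix of $H|_{V_0}$ in this basis; it is a bounded Jacobi matrix on $\ell^2(\mathbb{N})$. Here a Jacobi matrix with parameters $\{a_k\}_{k\ge1}$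 (nonnegative) and $\{b_k\}_{k\ge1}$ (real) is the tridiagonal matrix with diagonal entries $b_k$ and off-diagonal entries $J_{k,k+1}=J_{k+1,k}=a_k$; Jacobi matrices on $\ell^2(\mathbb{Z})$ are defined analogously. A Jacobi matrix $J^{(r)}$ on $\ell^2(\mathbb{Z})$ with parameters $a^{(r)},b^{(r)}$ is a right limit of a bounded Jacobi matrix $J$ on $\ell^2(\mathbb{N})$ if there is a sequence of indices $n_j\to\infty$ with $a_{l+n_j}\to a^{(r)}_l$ and $b_{l+n_j}\to b^{(r)}_l$ as $j\to\infty$ for every fixed $l\in\mathbb{Z}$. The $k$-th tail of a semi-infinite matrix $A$ is the semi-infinite matrix $A^{[k]}$ with $(A^{[k]})_{i,j}=A_{i+k,j+k}$, $i,j\in\mathbb{N}$; here $J_n=J_H^{[n]}$. A strong limit of a sequence $\{J_n\}$ means a strong operator limit of a subsequence of it. *)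

(* Defs.v *)
From HB Require Import structures.
From mathcomp Require Import all_boot all_order all_algebra.
From mathcomp Require Import all_classical all_reals all_analysis.
From mathcomp Require Import complex.

Set Implicit Arguments.
Unset Strict Implicit.
Unset Printing Implicit Defensive.

Import Order.TTheory GRing.Theory Num.Theory.
Import numFieldNormedType.Exports.
Import ComplexField.Normc.

Local Open Scope classical_set_scope.
Local Open Scope ring_scope.
Local Open Scope complex_scope.

Section Trees.
Variables (V : choiceType) (adj : rel V).

Definition walk (u : V) (p : seq V) (v : V) : Prop :=
  path adj u p /\ last u p = v.

Definition regular_tree (d : nat) : Prop :=
  [/\ symmetric adj,
      irreflexive adj,
      forall u v : V, exists p, walk u p v,
      forall c : seq V, (2 < size c)%N -> ~ ucycle adj c
    & forall v : V, ([set u | adj v u] #= `I_d)%card].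

(* Least length of a walk from [u] to [v]; [0] if there is none. *)
Definition gdist (u v : V) : nat :=
  xget 0%N [set n | (exists2 p, walk u p v & size p = n) /\
                    (forall p, walk u p v -> (n <= size p)%N)].

End Trees.

(* A vector of l^2(X) is a function X -> R[i] satisfying [l2], and an operator
   on l^2(X) is a map on all functions of which only the values on [l2]
   matter. *)
Section HilbertSpace.
Variables (R : realType) (X : choiceType).
Implicit Types (u v psi phi : X -> R[i]) (A B : (X -> R[i]) -> (X -> R[i])).

Definition sqsum psi : \bar R :=
  (\esum_(x in [set: X]) (normc (psi x) ^+ 2)%:E)%E.

Definition l2 : set (X -> R[i]) := [set psi | (sqsum psi < +oo)%E].

Definition l2norm psi : R := Num.sqrt (fine (sqsum psi)).

(* The unconditional sum of an absolutely summable family, as the difference of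
   the sums of the positive and negative parts. *)
Definition rsum (f : X -> R) : R :=
  fine (\esum_(x in [set: X]) (Num.max (f x) 0)%:E)%E -
  fine (\esum_(x in [set: X]) (Num.max (- f x) 0)%:E)%E.

Definition csum (f : X -> R[i]) : R[i] :=
  rsum (fun x => complex.Re (f x)) +i* rsum (fun x => complex.Im (f x)).

Definition l2dot u v : R[i] := csum (fun x => u x * (v x)^*).

Definition bounded_operator A : Prop :=
  [/\ forall psi, l2 psi -> l2 (A psi),
      forall (c : R[i]) psi phi, l2 psi -> l2 phi ->
        A (fun x => c * psi x + phi x) = (fun x => c * A psi x + A phi x)
    & exists M : R, forall psi, l2 psi -> l2norm (A psi) <= M * l2norm psi].

Definition resolvent_set A : set R[i] :=
  [set z | exists2 B, bounded_operator B &
    forall psi, l2 psi ->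
      (fun x => A (B psi) x - z * B psi x) = psi /\
      B (fun x => A psi x - z * psi x) = psi].

Definition spectrum A : set R[i] := ~` resolvent_set A.

Definition eigenvector A (z : R[i]) psi : Prop :=
  l2 psi /\ A psi = (fun x => z * psi x).

Definition is_eigenvalue A (z : R[i]) : Prop :=
  exists2 psi, eigenvector A z psi & exists x, psi x != 0.

Definition finite_multiplicity A (z : R[i]) : Prop :=
  exists n (e : 'I_n -> X -> R[i]), forall psi, eigenvector A z psi ->
    exists c : 'I_n -> R[i], psi = (fun x => \sum_(k < n) c k * e k x).

Definition isolated_in (S : set R[i]) (z : R[i]) : Prop :=
  exists2 e : R, 0 < e & forall w, S w -> normc (w - z) < e -> w = z.

Definition ess_spectrum A : set R[i] :=
  spectrum A `\` [set z | [/\ isolated_in (spectrum A) z,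
                              is_eigenvalue A z & finite_multiplicity A z]].

Definition normalize psi : X -> R[i] := fun x => ((l2norm psi)^-1)%:C * psi x.

Fixpoint gram_schmidt_seq (f : nat -> X -> R[i]) (n : nat) : seq (X -> R[i]) :=
  if n is m.+1 then
    let s := gram_schmidt_seq f m in
    rcons s (normalize
      (fun x => f m x - \sum_(e <- s) l2dot (f m) e * e x))
  else [::].

Definition gram_schmidt (f : nat -> X -> R[i]) (n : nat) : X -> R[i] :=
  last (fun=> 0) (gram_schmidt_seq f n.+1).

Definition matrix_operator (M : X -> X -> R[i]) psi : X -> R[i] :=
  fun x => csum (fun y => M x y * psi y).

Definition delta (x0 : X) : X -> R[i] := fun x => (x == x0)%:R.

End HilbertSpace.

Arguments delta R {X} x0.

Section Operators.
Variable R : realType.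

Definition schrodinger (V : choiceType) (adj : rel V) (Q : V -> R)
    (psi : V -> R[i]) : V -> R[i] :=
  fun v => \sum_(u \in [set u | adj v u]) (psi u - psi v) + (Q v)%:C * psi v.

(* Semi-infinite matrices are indexed from 0: the parameters a_k, b_k (k >= 1)
   of a Jacobi matrix [M] are [M k.-1 k] and [M k.-1 k.-1]. *)
Definition jacobi_of (V : choiceType) (H : (V -> R[i]) -> (V -> R[i])) (v0 : V)
    : nat -> nat -> R[i] :=
  let e := gram_schmidt (fun n => iter n H (delta R v0)) in
  fun i j => l2dot (H (e j)) (e i).

Definition tail (M : nat -> nat -> R[i]) (k : nat) : nat -> nat -> R[i] :=
  fun i j => M (i + k)%N (j + k)%N.

Definition jacobiZ (a b : int -> R) : int -> int -> R[i] := fun k l =>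
  if l == k then (b k)%:C
  else if l == k + 1 then (a k)%:C
  else if k == l + 1 then (a l)%:C
  else 0.

(* For each [l] the index [l + n j] is nonnegative for large [j], so the
   absolute value does not affect the limits; indexing from 0 instead of 1
   only shifts the sequence [n] by one. *)
Definition right_limit (M : nat -> nat -> R[i]) : set ((int -> R) * (int -> R)) :=
  [set ab : (int -> R) * (int -> R) | (forall l, 0 <= ab.1 l) /\
    exists2 n : nat -> nat, n j @[j --> \oo] --> \oo &
      forall l : int,
        let k j := absz (l + (n j)%:Z) in
        (normc (M (k j) (k j).+1 - (ab.1 l)%:C) @[j --> \oo] --> (0 : R)) /\
        (normc (M (k j) (k j) - (ab.2 l)%:C) @[j --> \oo] --> (0 : R))].

Definition strong_limit_of_tails (M : nat -> nat -> R[i])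
    : set ((nat -> R[i]) -> (nat -> R[i])) :=
  [set S | bounded_operator S /\
    exists2 n : nat -> nat,
      (forall j, 1 <= n j)%N /\ {homo n : i j / (i < j)%N} &
      forall psi, l2 psi ->
        l2norm (fun i => matrix_operator (tail M (n j)) psi i - S psi i)
          @[j --> \oo] --> (0 : R)].

End Operators.

(* Main.v *)
(* Functions on the tree split into their averages over the generations below each
   vertex and the deviations of these averages between siblings; this turns H into an
   orthogonal sum of J_H and of tails J_n, each repeated finitely often.  For a bounded
   symmetric operator A on l^2(X), a point z lies in the essential spectrum iff A - z is
   not bounded below on the functions vanishing on any given finite set.  Hence z lies in
   the essential spectrum of H iff the tails J_n - z are not uniformly bounded below as n
   tends to infinity.  If they are not, then for every j there are n >= j, a position p
   and a vector f such that |f| grows at most linearly away from p while (J_n - z) f is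
   small near p, relative to |f(p)|.  Along an ultrafilter these converge to a linearly
   bounded solution of J u = z u, where J is a right limit if p tends to infinity and a
   strong limit of tails if p stays bounded; such a solution puts z into the spectrum
   of J.  Conversely, truncated approximate eigenvectors of the limit operators are
   approximate eigenvectors of the tails. *)
Require Import Defs.
From HB Require Import structures.
From mathcomp Require Import all_boot all_order all_algebra.
From mathcomp Require Import all_classical all_reals all_analysis.
From mathcomp Require Import complex.
From mathcomp Require Import ring lra zify.

Set Implicit Arguments.
Unset Strict Implicit.
Unset Printing Implicit Defensive.

Import Order.TTheory GRing.Theory Num.Theory.
Import numFieldNormedType.Exports.
Import ComplexField.Normc.

Local Open Scope classical_set_scope.
Local Open Scope ring_scope.
Local Open Scope complex_scope.

(** * Square sums over a discrete set *)

(** Operator theory is done with squared norms only: pointwise inequalities are summed, preimages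
    come from a convergent iteration, and an isolated spectral point is exploited through a lower
    bound on the range of [A - z] instead of a spectral projection. Ideally [|f|] would be largest
    at [p] with a small residual around [p], but both cannot be demanded at once. A weighted
    pigeonhole over all positions gives both at the price of linear growth. This is harmless: a
    lower bound for [J - z] would force exponential growth. Two families of limits occur because a
    bounded [p] keeps the left end of the tail in sight, while an unbounded [p] loses it. After the
    first one, all off-diagonal entries of [J_H] equal sqrt(d-1), so only diagonals have to
    converge. A finite set of vertices meets finitely many generations, and [d > 2] provides
    siblings in every generation from the first on; hence every tail [J_n] with [n >= 1] sits inside
    [H], and far out if [n] is large. Conversely [J_H] and the early tails, restricted to functions
    vanishing on a large ball, are compared with a single late tail. *)

Section ComplexParts.
Variable R : realType.
Implicit Types (z w : R[i]) (a : R).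

Lemma ReD z w : complex.Re (z + w) = complex.Re z + complex.Re w.
Proof. by case: z w => [? ?] []. Qed.
Lemma ImD z w : complex.Im (z + w) = complex.Im z + complex.Im w.
Proof. by case: z w => [? ?] []. Qed.
Lemma ReN z : complex.Re (- z) = - complex.Re z.
Proof. by case: z. Qed.
Lemma ImN z : complex.Im (- z) = - complex.Im z.
Proof. by case: z. Qed.
Lemma ReM z w : complex.Re (z * w) =
  complex.Re z * complex.Re w - complex.Im z * complex.Im w.
Proof. by case: z w => [? ?] []. Qed.
Lemma ImM z w : complex.Im (z * w) =
  complex.Re z * complex.Im w + complex.Im z * complex.Re w.
Proof. by case: z w => [? ?] []. Qed.
Lemma Re0 : complex.Re (0 : R[i]) = 0. Proof. by []. Qed.
Lemma Im0 : complex.Im (0 : R[i]) = 0. Proof. by []. Qed.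
Lemma Re1 : complex.Re (1 : R[i]) = 1. Proof. by []. Qed.
Lemma Im1 : complex.Im (1 : R[i]) = 0. Proof. by []. Qed.
Lemma ReC a : complex.Re a%:C = a. Proof. by []. Qed.
Lemma ImC a : complex.Im a%:C = 0. Proof. by []. Qed.
Lemma Re_conj z : complex.Re (conjc z) = complex.Re z.
Proof. by case: z. Qed.
Lemma Im_conj z : complex.Im (conjc z) = - complex.Im z.
Proof. by case: z. Qed.

Definition cE := (ReD, ImD, ReN, ImN, ReM, ImM, Re0, Im0, Re1, Im1, ReC, ImC,
  Re_conj, Im_conj).

Lemma eq_complexP z w :
  complex.Re z = complex.Re w -> complex.Im z = complex.Im w -> z = w.
Proof. by case: z w => [? ?] [? ?] /= -> ->. Qed.

Lemma Re_sum (I : Type) (s : seq I) (P : pred I) (f : I -> R[i]) :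
  complex.Re (\sum_(i <- s | P i) f i) = \sum_(i <- s | P i) complex.Re (f i).
Proof. exact: (big_morph (@complex.Re R) ReD Re0). Qed.

Lemma Im_sum (I : Type) (s : seq I) (P : pred I) (f : I -> R[i]) :
  complex.Im (\sum_(i <- s | P i) f i) = \sum_(i <- s | P i) complex.Im (f i).
Proof. exact: (big_morph (@complex.Im R) ImD Im0). Qed.

Definition sqn z : R := normc z ^+ 2.

Lemma sqnE z : sqn z = complex.Re z ^+ 2 + complex.Im z ^+ 2.
Proof.
by case: z => a b; rewrite /sqn /= sqr_sqrtr// addr_ge0 ?sqr_ge0.
Qed.

Lemma sqn_ge0 z : 0 <= sqn z. Proof. exact: sqr_ge0. Qed.

Lemma sqn0 : sqn 0 = 0. Proof. by rewrite /sqn normc0 expr0n. Qed.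

Lemma sqnM z w : sqn (z * w) = sqn z * sqn w.
Proof. by rewrite /sqn normcM exprMn. Qed.

Lemma sqnN z : sqn (- z) = sqn z.
Proof. by rewrite !sqnE !cE; ring. Qed.

Lemma sqnC a : sqn a%:C = a ^+ 2.
Proof. by rewrite !sqnE !cE; ring. Qed.

Lemma sqn_conj z : sqn (conjc z) = sqn z.
Proof. by rewrite !sqnE !cE; ring. Qed.

Lemma sqn_eq0 z : sqn z = 0 -> z = 0.
Proof. by move/eqP; rewrite sqrf_eq0 => /eqP/eq0_normc. Qed.

Lemma sqn_gt0 z : z != 0 -> 0 < sqn z.
Proof.
by move=> z0; rewrite lt_def sqn_ge0 andbT; apply: contra z0 => /eqP/sqn_eq0 ->.
Qed.

Lemma sqnD z w : sqn (z + w) <= 2 * sqn z + 2 * sqn w.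
Proof.
rewrite -subr_ge0 (_ : _ - _ = sqn (z - w)) ?sqn_ge0//.
by rewrite !sqnE !cE; ring.
Qed.

Lemma sqn_sum (I : Type) (s : seq I) (f : I -> R[i]) :
  sqn (\sum_(i <- s) f i) <= (size s)%:R * \sum_(i <- s) sqn (f i).
Proof.
elim: s => [|i s IH]; first by rewrite !big_nil sqn0 mulr0.
have [/size0nil s0|s0] := posnP (size s).
  by rewrite s0 !big_cons !big_nil !addr0 mul1r.
rewrite !big_cons /=; set a := f i; set b := \sum_(_ <- _) _ in IH *.
set t := \sum_(_ <- _) _ in IH *.
have k0 : 0 < (size s)%:R :> R by rewrite ltr0n.
rewrite -natr1; set k := (size s)%:R in IH k0 *.
(* Young's inequality with parameter [k], the length of the remaining list: then
   [(1 + 1/k) * k = k + 1] closes the induction. *)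
have h : sqn (a + b) <= (1 + k) * sqn a + (1 + k^-1) * sqn b.
  rewrite -subr_ge0.
  have -> : (1 + k) * sqn a + (1 + k^-1) * sqn b - sqn (a + b) =
     k^-1 * sqn (k%:C * a - b).
    by rewrite !sqnE !cE; field; rewrite gt_eqF.
  by rewrite mulr_ge0 ?invr_ge0 ?sqn_ge0// ltW.
apply: (le_trans h); rewrite [_ * (sqn a + t)]mulrDr addrC [_ + k]addrC.
rewrite [leRHS]addrC lerD2r.
have -> : (k + 1) * t = (1 + k^-1) * (k * t) by field; rewrite gt_eqF.
by rewrite ler_pM2l// addr_gt0// invr_gt0.
Qed.

End ComplexParts.

Section SquareSums.
Variables (R : realType) (X : choiceType).
Implicit Types (u v w psi phi : X -> R[i]) (s : seq X).

Definition sqnorm psi : R := fine (sqsum psi).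

Lemma sqsum_ge0 psi : (0 <= sqsum psi)%E.
Proof. by apply: esum_ge0 => x _; rewrite lee_fin sqr_ge0. Qed.

Lemma sqnorm_ge0 psi : 0 <= sqnorm psi.
Proof. exact/fine_ge0/sqsum_ge0. Qed.

Lemma l2_fin psi : l2 psi -> (sqnorm psi)%:E = sqsum psi.
Proof. by move=> h; rewrite fineK// ge0_fin_numE// sqsum_ge0. Qed.

Lemma sqsum_seq psi s : uniq s -> ((\sum_(x <- s) sqn (psi x))%:E <= sqsum psi)%E.
Proof.
move=> us; apply: ereal_sup_ubound; exists [set` s].
  by split => //; exact: finite_seq.
by rewrite -fsbig_seq// -sumEFin.
Qed.

Lemma sqsum_lub psi (M : \bar R) :
  (forall s, uniq s -> ((\sum_(x <- s) sqn (psi x))%:E <= M)%E) ->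
  (sqsum psi <= M)%E.
Proof.
move=> h; apply: ge_ereal_sup => _ [A [finA _] <-].
by rewrite fsbig_finite//= sumEFin h.
Qed.

(** The passage from bounds on finite duplicate-free lists to the extended-real supremum behind
    [l2]; later membership proofs go through it and never touch [\bar R]. *)
Lemma l2_bound psi (M : R) :
  (forall s, uniq s -> \sum_(x <- s) sqn (psi x) <= M) -> l2 psi /\ sqnorm psi <= M.
Proof.
move=> h.
have hM : (sqsum psi <= M%:E)%E.
  by apply: sqsum_lub => s us; rewrite lee_fin h.
have l : l2 psi by apply: le_lt_trans hM _; rewrite ltry.
by split => //; rewrite -lee_fin l2_fin.
Qed.

Lemma sqnorm_seq psi s : l2 psi -> uniq s -> \sum_(x <- s) sqn (psi x) <= sqnorm psi.
Proof. by move=> h us; rewrite -lee_fin l2_fin// sqsum_seq. Qed.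

Lemma sqnorm_point psi x : l2 psi -> sqn (psi x) <= sqnorm psi.
Proof. by move=> h; have := @sqnorm_seq psi [:: x] h isT; rewrite big_seq1. Qed.

Lemma sum_sub_le (f : X -> R) s s' : (forall x, 0 <= f x) -> uniq s -> uniq s' ->
  {subset s <= s'} -> \sum_(x <- s) f x <= \sum_(x <- s') f x.
Proof.
move=> f0 us us' ss; rewrite [leRHS](bigID (mem s))/=.
have -> : \sum_(x <- s' | x \in s) f x = \sum_(x <- s) f x.
  rewrite -big_filter; apply: perm_big; apply: uniq_perm; rewrite ?filter_uniq//.
  by move=> x; rewrite mem_filter; case: (boolP (x \in s)) => //= /ss.
by rewrite lerDl sumr_ge0.
Qed.

Lemma sqnorm_approx psi (e : R) : l2 psi -> 0 < e ->
  exists2 s0, uniq s0 & forall s, uniq s -> {subset s0 <= s} ->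
    sqnorm psi - e <= \sum_(x <- s) sqn (psi x).
Proof.
move=> h e0.
have [s0 us0 hs0] : exists2 s, uniq s & sqnorm psi - e <= \sum_(x <- s) sqn (psi x).
  apply: contrapT => /forall2NP H.
  have [_] : l2 psi /\ sqnorm psi <= sqnorm psi - e.
    apply: l2_bound => s us; have [//|/negP] := H s.
    by rewrite -ltNge => /ltW.
  by rewrite lerBrDr gerDl leNgt e0.
exists s0 => // s us ss; apply: le_trans hs0 _; apply: sum_sub_le => // x.
exact: sqn_ge0.
Qed.

Fixpoint all_l2 (l : seq (R * (X -> R[i]))) : Prop :=
  if l is p :: l' then l2 p.2 /\ all_l2 l' else True.

(** The estimate is two-sided because the coefficients may be negative; one finite set serves all
    the vectors of the list at once. *)
Lemma comb_approx l (e : R) : all_l2 l -> 0 < e ->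
  exists2 s0, uniq s0 & forall s, uniq s -> {subset s0 <= s} ->
    `|\sum_(p <- l) p.1 * sqnorm p.2 -
      \sum_(x <- s) \sum_(p <- l) p.1 * sqn (p.2 x)| <= e.
Proof.
elim: l e => [|[c psi] l IH] e /=.
  move=> _ e0; exists [::] => // s _ _; rewrite big_nil big1 ?subr0 ?normr0 ?ltW//.
  by move=> x _; rewrite big_nil.
move=> [hpsi hl] e0.
have e1 : 0 < e / 2 by rewrite divr_gt0.
have [s1 us1 h1] := IH _ hl e1.
have e2 : 0 < e / 2 / (`|c| + 1) by rewrite divr_gt0// ltr_wpDl.
have [s2 us2 h2] := sqnorm_approx hpsi e2.
exists (undup (s1 ++ s2)) => [|s us ss]; first exact: undup_uniq.
have ss1 : {subset s1 <= s} by move=> x xs; apply: ss; rewrite mem_undup mem_cat xs.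
have ss2 : {subset s2 <= s} by move=> x xs; apply: ss; rewrite mem_undup mem_cat xs orbT.
rewrite big_cons /=.
have -> : \sum_(x <- s) \sum_(p <- (c, psi) :: l) p.1 * sqn (p.2 x) =
    \sum_(x <- s) (c * sqn (psi x) + \sum_(p <- l) p.1 * sqn (p.2 x)).
  by apply: eq_bigr => x _; rewrite big_cons.
rewrite big_split /= -mulr_sumr.
rewrite opprD addrACA -mulrBr (le_trans (ler_normD _ _))//.
rewrite [leRHS](_ : e = e / 2 + e / 2); last by field.
apply: lerD; last exact: h1.
rewrite normrM [X in _ * X]ger0_norm; last by rewrite subr_ge0 sqnorm_seq.
have h : sqnorm psi - \sum_(x <- s) sqn (psi x) <= e / 2 / (`|c| + 1).
  by rewrite lerBlDr -lerBlDl; exact: h2.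
have c0 : 0 <= `|c| by [].
have h0 : 0 <= sqnorm psi - \sum_(x <- s) sqn (psi x) by rewrite subr_ge0 sqnorm_seq.
apply: le_trans (_ : (`|c| + 1) * (e / 2 / (`|c| + 1)) <= _).
  by apply: ler_pM => //; lra.
by rewrite mulrC divfK// gt_eqF// ltr_wpDl.
Qed.

(* Transfers every linear inequality between squared moduli that holds
   pointwise to the squared norms, with signs allowed in the combination. *)
Lemma sqnorm_comb l : all_l2 l -> (forall x, 0 <= \sum_(p <- l) p.1 * sqn (p.2 x)) ->
  0 <= \sum_(p <- l) p.1 * sqnorm p.2.
Proof.
move=> hl h; rewrite leNgt; apply/negP => h0.
have e0 : 0 < - (\sum_(p <- l) p.1 * sqnorm p.2) / 2 by rewrite divr_gt0// oppr_gt0.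
have [s us hs] := comb_approx hl e0.
have := hs s us (fun x xs => xs).
have : 0 <= \sum_(x <- s) \sum_(p <- l) p.1 * sqn (p.2 x) by exact: sumr_ge0.
by rewrite ler_norml; lra.
Qed.

Lemma sqnorm_comb0 l : all_l2 l -> (forall x, \sum_(p <- l) p.1 * sqn (p.2 x) = 0) ->
  \sum_(p <- l) p.1 * sqnorm p.2 = 0.
Proof.
move=> hl h; apply/eqP; rewrite eq_le sqnorm_comb ?andbT//; last by move=> x; rewrite h.
pose l' := [seq (- p.1, p.2) | p <- l].
have hl' : all_l2 l' by rewrite /l'; elim: (l) hl => //= p l0 IH [? /IH].
have E (f : (X -> R[i]) -> R) : \sum_(p <- l') p.1 * f p.2 = - \sum_(p <- l) p.1 * f p.2.
  by rewrite big_map -sumrN; apply: eq_bigr => p _; rewrite mulNr.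
rewrite -oppr_ge0 -E; apply: sqnorm_comb => // x.
by rewrite (E (fun f => sqn (f x))) h oppr0.
Qed.

Lemma l2_le psi phi (c : R) : l2 psi -> 0 <= c ->
  (forall x, sqn (phi x) <= c * sqn (psi x)) -> l2 phi /\ sqnorm phi <= c * sqnorm psi.
Proof.
move=> h c0 hle; apply: l2_bound => s us.
apply: le_trans (_ : \sum_(x <- s) c * sqn (psi x) <= _); first exact: ler_sum.
by rewrite -mulr_sumr ler_wpM2l// sqnorm_seq.
Qed.

Lemma l2_le2 psi psi' phi (c c' : R) : l2 psi -> l2 psi' -> 0 <= c -> 0 <= c' ->
  (forall x, sqn (phi x) <= c * sqn (psi x) + c' * sqn (psi' x)) ->
  l2 phi /\ sqnorm phi <= c * sqnorm psi + c' * sqnorm psi'.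
Proof.
move=> h h' c0 c'0 hle; apply: l2_bound => s us.
apply: le_trans (_ : \sum_(x <- s) (c * sqn (psi x) + c' * sqn (psi' x)) <= _).
  exact: ler_sum.
by rewrite big_split/= -!mulr_sumr lerD// ler_wpM2l// sqnorm_seq.
Qed.

Lemma l2D u v : l2 u -> l2 v -> l2 (fun x => u x + v x).
Proof.
move=> hu hv; have /(_ _ _)[]// := @l2_le2 u v (fun x => u x + v x) 2 2 hu hv.
by move=> x; exact: sqnD.
Qed.

Lemma sqnorm_D u v : l2 u -> l2 v -> sqnorm (fun x => u x + v x) <= 2 * sqnorm u + 2 * sqnorm v.
Proof.
move=> hu hv; have /(_ _ _)[]// := @l2_le2 u v (fun x => u x + v x) 2 2 hu hv.
by move=> x; exact: sqnD.
Qed.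

Lemma l2Z (c : R[i]) u : l2 u -> l2 (fun x => c * u x).
Proof.
move=> hu; have /(_ _ _)[]// := @l2_le u (fun x => c * u x) (sqn c) hu.
  exact: sqn_ge0.
by move=> x; rewrite sqnM.
Qed.

Lemma sqnorm_Z (c : R[i]) u : l2 u -> sqnorm (fun x => c * u x) = sqn c * sqnorm u.
Proof.
move=> hu; have := @sqnorm_comb0 [:: (1, fun x => c * u x); (- sqn c, u)].
rewrite !big_cons big_nil /= mul1r addr0 mulNr => h.
apply/eqP; rewrite -subr_eq0; apply/eqP; apply: h.
  by split; [exact: l2Z|].
by move=> x; rewrite !big_cons big_nil /= sqnM; ring.
Qed.

Lemma l2N u : l2 u -> l2 (fun x => - u x).
Proof.
move=> hu; have -> : (fun x => - u x) = (fun x => -1 * u x); last exact: l2Z.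
by apply/funext => x; rewrite mulN1r.
Qed.

Lemma l2B u v : l2 u -> l2 v -> l2 (fun x => u x - v x).
Proof. by move=> hu hv; apply: l2D => //; exact: l2N. Qed.

Lemma sqnorm_N u : l2 u -> sqnorm (fun x => - u x) = sqnorm u.
Proof.
move=> hu; have -> : (fun x => - u x) = (fun x => -1 * u x).
  by apply/funext => x; rewrite mulN1r.
by rewrite sqnorm_Z// sqnE !cE; ring.
Qed.

Lemma sqnorm_B u v : l2 u -> l2 v -> sqnorm (fun x => u x - v x) <= 2 * sqnorm u + 2 * sqnorm v.
Proof. by move=> hu hv; rewrite -(sqnorm_N hv); apply: sqnorm_D => //; exact: l2N. Qed.

Lemma sqnorm_sym u v : l2 u -> l2 v -> sqnorm (fun x => u x - v x) = sqnorm (fun x => v x - u x).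
Proof.
move=> hu hv; rewrite -[RHS]sqnorm_N; last exact: l2B.
by congr sqnorm; apply/funext => x; rewrite opprB.
Qed.

Lemma l2_0 : l2 (fun _ : X => 0 : R[i]).
Proof.
by have [] := @l2_bound (fun _ : X => 0 : R[i]) 0 => // s _; rewrite big1// => x _; exact: sqn0.
Qed.

Lemma sqnorm_0 : sqnorm (fun _ : X => 0 : R[i]) = 0.
Proof.
apply/eqP; rewrite eq_le sqnorm_ge0 andbT.
by have [] := @l2_bound (fun _ : X => 0 : R[i]) 0 => // s _; rewrite big1// => x _; exact: sqn0.
Qed.

Lemma sqnorm_eq0 u : l2 u -> sqnorm u <= 0 -> u = (fun=> 0).
Proof.
move=> hu h; apply/funext => x; apply/sqn_eq0/eqP.
by rewrite eq_le sqn_ge0 andbT (le_trans (sqnorm_point x hu)).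
Qed.

Lemma sqnorm_gt0 u x : l2 u -> u x != 0 -> 0 < sqnorm u.
Proof. by move=> hu ux; apply: lt_le_trans (sqnorm_point x hu); exact: sqn_gt0. Qed.

Lemma l2_sum (I : Type) (r : seq I) (f : I -> X -> R[i]) :
  (forall i, l2 (f i)) -> l2 (fun x => \sum_(i <- r) f i x).
Proof.
move=> h; elim: r => [|i r IH].
  by under eq_fun do rewrite big_nil; exact: l2_0.
by under eq_fun do rewrite big_cons; exact: l2D.
Qed.

Lemma fs_bound u s : uniq s -> (forall x, x \notin s -> u x = 0) ->
  l2 u /\ sqnorm u = \sum_(x <- s) sqn (u x).
Proof.
move=> us hs.
have [l le] : l2 u /\ sqnorm u <= \sum_(x <- s) sqn (u x).
  apply: l2_bound => s' us'; rewrite [leLHS](bigID (mem s))/=.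
  rewrite [X in _ + X <= _]big1 ?addr0; last by move=> x /hs ->; rewrite sqn0.
  rewrite -big_filter; apply: sum_sub_le; rewrite ?filter_uniq//.
    by move=> x; exact: sqn_ge0.
  by move=> x; rewrite mem_filter => /andP[].
by split=> //; apply/eqP; rewrite eq_le le sqnorm_seq.
Qed.

Definition cut s u : X -> R[i] := fun x => if x \in s then u x else 0.

Lemma l2_cut s u : l2 (cut s u).
Proof.
have [] := @fs_bound (cut s u) (undup s) (undup_uniq _) => // x.
by rewrite mem_undup /cut => /negbTE ->.
Qed.

Lemma cut_approx u (e : R) : l2 u -> 0 < e ->
  exists s, forall s', {subset s <= s'} -> sqnorm (fun x => u x - cut s' u x) <= e.
Proof.
move=> hu e0; have [s us hs] := sqnorm_approx hu e0; exists s => s' ss.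
have := hs (undup s') (undup_uniq _).
have hc x : x \notin undup s' -> cut s' u x = 0.
  by rewrite mem_undup /cut => /negbTE ->.
have [l2c Nc] := fs_bound (undup_uniq _) hc.
have sub : {subset s <= undup s'} by move=> x /ss; rewrite mem_undup.
move=> /(_ sub).
have -> : \sum_(x <- undup s') sqn (u x) = sqnorm (cut s' u).
  rewrite Nc; apply: eq_big_seq => x; rewrite mem_undup /cut => -> //.
have := @sqnorm_comb0 [:: (1, fun x => u x - cut s' u x); (-1, u); (1, cut s' u)].
rewrite !big_cons big_nil /= => h h'.
suff : sqnorm (fun x => u x - cut s' u x) = sqnorm u - sqnorm (cut s' u) by lra.
suff : 1 * sqnorm (fun x => u x - cut s' u x) + (-1 * sqnorm u + (1 * sqnorm (cut s' u) + 0)) = 0.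
  lra.
apply: h => [|x]; first by split; [exact: l2B|].
rewrite !big_cons big_nil /= /cut.
by case: ifP => _; rewrite ?subr0 ?subrr ?sqn0; ring.
Qed.

End SquareSums.

(** * The real inner product and completeness *)

#[local] Hint Resolve l2D l2B l2N l2Z : core.

(* Produces a linear identity between squared norms from a list of pairs (coefficient, vector): the
   pointwise identity is expanded into real and imaginary parts and left to [ring]. *)
Tactic Notation "ncomb0" uconstr(l) :=
  let h := fresh "h" in
  pose proof (@sqnorm_comb0 _ _ l) as h;
  rewrite !big_cons !big_nil /= in h;
  match type of h with ?P -> ?Q -> _ =>
    let p := fresh "p" in
    have p : P by [do !split; auto 10];
    let q := fresh "q" in
    have q : Q by [let x := fresh "x" in intro x; rewrite !big_cons !big_nil /= !sqnE !cE; ring];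
    move: {h p q}(h p q)
  end.

Section InnerProduct.
Variables (R : realType) (X : choiceType).
Implicit Types (u v w psi phi : X -> R[i]).

(* Polarization: this is the real part of the inner product, which suffices
   because conjc carries the complex scalars across it (dotZl). *)
Definition dot u v : R := (sqnorm (fun x => u x + v x) - sqnorm (fun x => u x - v x)) / 4.

Lemma dotC u v : l2 u -> l2 v -> dot u v = dot v u.
Proof.
move=> hu hv; rewrite /dot (sqnorm_sym hu hv); congr ((sqnorm _ - _) / _).
by apply/funext => x; rewrite addrC.
Qed.

Lemma dot_uu u : l2 u -> dot u u = sqnorm u.
Proof.
move=> hu; rewrite /dot.
ncomb0 [:: (1, fun x => u x + u x); (-1, fun x => u x - u x); (-4, u)].
lra.
Qed.

Lemma dotDl u u' v : l2 u -> l2 u' -> l2 v ->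
  dot (fun x => u x + u' x) v = dot u v + dot u' v.
Proof.
move=> hu hu' hv; rewrite /dot.
ncomb0 [:: (1, fun x => u x + u' x + v x); (-1, fun x => u x + u' x - v x);
  (-1, fun x => u x + v x); (1, fun x => u x - v x);
  (-1, fun x => u' x + v x); (1, fun x => u' x - v x)].
lra.
Qed.

Lemma dotBl u u' v : l2 u -> l2 u' -> l2 v ->
  dot (fun x => u x - u' x) v = dot u v - dot u' v.
Proof.
move=> hu hu' hv; rewrite /dot.
ncomb0 [:: (1, fun x => u x - u' x + v x); (-1, fun x => u x - u' x - v x);
  (-1, fun x => u x + v x); (1, fun x => u x - v x);
  (1, fun x => u' x + v x); (-1, fun x => u' x - v x)].
lra.
Qed.

Lemma dotZl (c : R[i]) u v : l2 u -> l2 v ->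
  dot (fun x => c * u x) v = dot u (fun x => (conjc c) * v x).
Proof.
move=> hu hv; rewrite /dot.
ncomb0 [:: (1, fun x => c * u x + v x); (-1, fun x => c * u x - v x);
  (-1, fun x => u x + (conjc c) * v x); (1, fun x => u x - (conjc c) * v x)].
lra.
Qed.

Lemma dotZr (a : R) u v : l2 u -> l2 v ->
  dot u (fun x => a%:C * v x) = a * dot u v.
Proof.
move=> hu hv; rewrite /dot.
ncomb0 [:: (1, fun x => u x + a%:C * v x); (-1, fun x => u x - a%:C * v x);
  (- a, fun x => u x + v x); (a, fun x => u x - v x)].
lra.
Qed.

Lemma sqnorm_subE u v : l2 u -> l2 v ->
  sqnorm (fun x => u x - v x) = sqnorm u + sqnorm v - 2 * dot u v.
Proof.
move=> hu hv; rewrite /dot.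
ncomb0 [:: (1, fun x => u x - v x); (1, fun x => u x + v x); (-2, u); (-2, v)].
lra.
Qed.

Lemma sqnorm_addE u v : l2 u -> l2 v ->
  sqnorm (fun x => u x + v x) = sqnorm u + sqnorm v + 2 * dot u v.
Proof.
move=> hu hv; rewrite /dot.
ncomb0 [:: (1, fun x => u x - v x); (1, fun x => u x + v x); (-2, u); (-2, v)].
lra.
Qed.

(** Both [t u + v] and [t u - v] have nonnegative squared norm. This weighted form takes the place
    of the Cauchy-Schwarz inequality and avoids square roots. *)
Lemma dot_le (t : R) u v : 0 < t -> l2 u -> l2 v ->
  2 * `|dot u v| <= t * sqnorm u + t^-1 * sqnorm v.
Proof.
move=> t0 hu hv.
have h1 := sqnorm_ge0 (fun x => t%:C * u x - v x).
have h2 := sqnorm_ge0 (fun x => t%:C * u x + v x).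
rewrite sqnorm_subE ?sqnorm_addE in h1 h2; auto.
have e : dot (fun x => t%:C * u x) v = t * dot u v.
  by rewrite dotC; auto; rewrite dotZr// dotC.
rewrite !e !sqnorm_Z// !sqnC in h1 h2.
have E : t * sqnorm u + t^-1 * sqnorm v = t^-1 * (t ^+ 2 * sqnorm u + sqnorm v).
  by field; rewrite gt_eqF.
rewrite E -(ler_pM2l t0) [leRHS]mulrA mulfV ?gt_eqF// mul1r.
by case: (ger0P (dot u v)) => d0; lra.
Qed.

End InnerProduct.

Section Limits.
Variables (R : realType) (X : choiceType).
Implicit Types (u v w psi phi : X -> R[i]).

Definition ccvg T (F : set_system T) (f : T -> R[i]) (l : R[i]) :=
  (complex.Re (f t) @[t --> F] --> complex.Re l) /\
  (complex.Im (f t) @[t --> F] --> complex.Im l).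

Lemma ccvg_sqn T (F : set_system T) {PF : ProperFilter F} (f : T -> R[i]) l z :
  ccvg F f l -> sqn (z - f t) @[t --> F] --> sqn (z - l).
Proof.
move=> [h1 h2]; under eq_fun do rewrite sqnE !cE !expr2.
rewrite sqnE !cE !expr2.
by apply: cvgD; apply: cvgM; apply: cvgB => //; exact: cvg_cst.
Qed.

(** Fatou's lemma for square sums: the bound holds on each finite list and passes to the pointwise
    limit there. *)
Lemma sqnorm_lim T (F : set_system T) {PF : ProperFilter F} (f : T -> X -> R[i]) g h
    (e : R) :
  (forall x, ccvg F (fun t => f t x) (g x)) -> (forall t, l2 (f t)) -> l2 h ->
  (\forall t \near F, sqnorm (fun x => h x - f t x) <= e) ->
  l2 (fun x => h x - g x) /\ sqnorm (fun x => h x - g x) <= e.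
Proof.
move=> hg hf hh hN; apply: l2_bound => s us.
have hc : (\sum_(x <- s) sqn (h x - f t x)) @[t --> F]
    --> \sum_(x <- s) sqn (h x - g x).
  apply: cvg_big => [|x _]; [exact: add_continuous|exact: ccvg_sqn].
apply: (cvgr_to_le hc); apply: filterS hN => t; apply: le_trans.
by apply: sqnorm_seq => //; auto.
Qed.

Lemma real_cauchy (a : nat -> R) :
  (forall e : R, 0 < e -> exists n0, forall m n, (n0 <= m)%N -> (n0 <= n)%N ->
    `|a m - a n| <= e) -> exists l : R, a n @[n --> \oo] --> l.
Proof.
move=> h; apply/cvg_ex; apply: cauchy_cvg; apply: cauchy_exP => e e0.
have [n0 hn0] := h _ (divr_gt0 e0 (ltr0n _ 2)); exists (a n0).
exists n0 => // n /= n0n; rewrite -ball_normE /ball_ /=.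
by apply: le_lt_trans (hn0 _ _ _ _) _ => //; rewrite ltr_pdivrMr// ltr_pMr ?ltr1n.
Qed.

Lemma l2_complete (f : nat -> X -> R[i]) : (forall n, l2 (f n)) ->
  (forall e : R, 0 < e -> exists n0, forall m n, (n0 <= m)%N -> (n0 <= n)%N ->
    sqnorm (fun x => f m x - f n x) <= e) ->
  exists2 g, l2 g & forall e : R, 0 < e -> exists n0, forall n, (n0 <= n)%N ->
    sqnorm (fun x => f n x - g x) <= e.
Proof.
move=> hf hC.
have hpt x (e : R) : 0 < e -> exists n0, forall m n, (n0 <= m)%N -> (n0 <= n)%N ->
    sqn (f m x - f n x) <= e ^+ 2.
  move=> e0; have [n0 h] := hC (e ^+ 2) (exprn_gt0 _ e0); exists n0 => m n hm hn.
  by apply: le_trans (h m n hm hn); apply: (@sqnorm_point _ _ (fun x => f m x - f n x)); auto.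
have hRe x : exists l : R, complex.Re (f n x) @[n --> \oo] --> l.
  apply: real_cauchy => e e0; have [n0 h] := hpt x e e0; exists n0 => m n hm hn.
  have := h m n hm hn; rewrite sqnE !cE => h'.
  have e1 := ltW e0; rewrite -(ler_pXn2r (n := 2)) ?nnegrE//.
    by rewrite real_normK ?num_real// (le_trans _ h')// lerDl sqr_ge0.
have hIm x : exists l : R, complex.Im (f n x) @[n --> \oo] --> l.
  apply: real_cauchy => e e0; have [n0 h] := hpt x e e0; exists n0 => m n hm hn.
  have := h m n hm hn; rewrite sqnE !cE => h'.
  have e1 := ltW e0; rewrite -(ler_pXn2r (n := 2)) ?nnegrE//.
  by rewrite real_normK ?num_real// (le_trans _ h')// lerDr sqr_ge0.
have {}hRe := choice hRe; have [gr hgr] := hRe.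
have {}hIm := choice hIm; have [gi hgi] := hIm.
pose g x := gr x +i* gi x.
(* Keep [n] fixed in the Cauchy condition and let the other index tend to infinity. *)
have key (e : R) : 0 < e -> exists n0, forall n, (n0 <= n)%N ->
    l2 (fun x => f n x - g x) /\ sqnorm (fun x => f n x - g x) <= e.
  move=> e0; have [n0 h] := hC e e0; exists n0 => n hn.
  apply: (@sqnorm_lim _ \oo _ f) => //.
  by exists n0 => // m /= hm; exact: h.
exists g; last by move=> e /key[n0 h]; exists n0 => n /h[].
have [n0 /(_ n0 (leqnn _))[h _]] := key 1 ltr01.
have -> : g = (fun x => f n0 x - (f n0 x - g x)).
  by apply/funext => x; rewrite opprB addrC subrK.
by auto.
Qed.

End Limits.

(** * Bounded symmetric operators *)

Section Operators.
Variables (R : realType) (X : choiceType).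
Implicit Types (u v w psi phi : X -> R[i]) (A B : (X -> R[i]) -> (X -> R[i])).

Lemma bop_l2 A u : bounded_operator A -> l2 u -> l2 (A u).
Proof. by case=> h _ _; exact: h. Qed.
Hint Resolve bop_l2 : core.

Lemma bop_lin A (c : R[i]) u v : bounded_operator A -> l2 u -> l2 v ->
  A (fun x => c * u x + v x) = (fun x => c * A u x + A v x).
Proof. by case=> _ h _; exact: h. Qed.

Lemma bop0 A : bounded_operator A -> A (fun=> 0) = (fun=> 0).
Proof.
case=> _ h _; have := h (-1) (fun=> 0) (fun=> 0) (@l2_0 R X) (@l2_0 R X).
rewrite (_ : (fun x : X => -1 * 0 + 0 : R[i]) = (fun=> 0)); last first.
  by apply/funext => x; rewrite mulr0 addr0.
by move=> ->; apply/funext => x; rewrite mulN1r addNr.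
Qed.

Lemma bopZ A (c : R[i]) u : bounded_operator A -> l2 u ->
  A (fun x => c * u x) = (fun x => c * A u x).
Proof.
move=> hA hu; have := bop_lin c hA hu (@l2_0 R X).
rewrite (bop0 hA) (_ : (fun x => c * u x + 0) = (fun x => c * u x)); last first.
  by apply/funext => x; rewrite addr0.
by move=> ->; apply/funext => x; rewrite addr0.
Qed.

Lemma bopB A u v : bounded_operator A -> l2 u -> l2 v ->
  A (fun x => u x - v x) = (fun x => A u x - A v x).
Proof.
move=> hA hu hv; have := bop_lin (-1) hA hv hu.
rewrite (_ : (fun x => -1 * v x + u x) = (fun x => u x - v x)); last first.
  by apply/funext => x; rewrite mulN1r addrC.
by move=> ->; apply/funext => x; rewrite mulN1r addrC.
Qed.

Lemma bop_sum A (I : Type) (r : seq I) (c : I -> R[i]) (f : I -> X -> R[i]) :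
  bounded_operator A -> (forall i, l2 (f i)) ->
  A (fun x => \sum_(i <- r) c i * f i x) = (fun x => \sum_(i <- r) c i * A (f i) x).
Proof.
move=> hA hf; elim: r => [|i r IH].
  under eq_fun do rewrite big_nil; rewrite bop0//.
  by apply/funext => x; rewrite big_nil.
under eq_fun do rewrite big_cons.
rewrite bop_lin//; last by apply: l2_sum => j; exact: l2Z.
by rewrite IH; apply/funext => x; rewrite big_cons.
Qed.

Lemma bop_bound A : bounded_operator A ->
  exists2 M : R, 0 < M & forall u, l2 u -> sqnorm (A u) <= M * sqnorm u.
Proof.
case=> h1 _ [M hM]; exists (M ^+ 2 + 1) => [|u hu].
  by rewrite ltr_wpDl// sqr_ge0.
have := hM u hu; rewrite /l2norm -/(sqnorm _) -/(sqnorm _) => h.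
apply: le_trans (_ : M ^+ 2 * sqnorm u <= _); last first.
  by rewrite ler_wpM2r ?sqnorm_ge0// lerDl.
have h' : Num.sqrt (sqnorm (A u)) ^+ 2 <= (M * Num.sqrt (sqnorm u)) ^+ 2.
  by rewrite ler_sqr// nnegrE ?sqrtr_ge0// (le_trans _ h)// sqrtr_ge0.
by rewrite exprMn !sqr_sqrtr ?sqnorm_ge0 in h'.
Qed.

Lemma bop_intro A (M : R) : 0 <= M ->
  (forall (c : R[i]) u v, A (fun x => c * u x + v x) = (fun x => c * A u x + A v x)) ->
  (forall u, l2 u -> l2 (A u) /\ sqnorm (A u) <= M * sqnorm u) -> bounded_operator A.
Proof.
move=> M0 hlin h; split; [by move=> u /h[]|by move=> *; exact: hlin|].
exists (Num.sqrt M) => u hu; rewrite /l2norm -/(sqnorm _) -/(sqnorm _) -sqrtrM//.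
by rewrite ler_wsqrtr//; have [] := h u hu.
Qed.

Definition shiftop A (z : R[i]) : (X -> R[i]) -> X -> R[i] :=
  fun u x => A u x - z * u x.

Lemma bop_shift A z : bounded_operator A -> bounded_operator (shiftop A z).
Proof.
move=> hA; have [M M0 hM] := bop_bound hA; split.
- by move=> u hu; rewrite /shiftop; auto.
- move=> c u v hu hv; rewrite /shiftop bop_lin//; apply/funext => x; ring.
exists (Num.sqrt (2 * M + 2 * sqn z)) => u hu.
have [M1 s0] := (ltW M0, sqn_ge0 z).
rewrite /l2norm -/(sqnorm _) -/(sqnorm _) -sqrtrM ?(addr_ge0 (mulr_ge0 _ M1) (mulr_ge0 _ s0))//.
rewrite ler_wsqrtr//; apply: (le_trans (sqnorm_B (bop_l2 hA hu) (l2Z z hu))).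
by rewrite sqnorm_Z//; have := hM u hu; lra.
Qed.
Hint Resolve bop_shift : core.

(** [dot] is only the real part of the inner product. For a complex-linear [A], replacing [u] by
    [i u] recovers the imaginary part, so this is full symmetry. *)
Definition symmetric_op A := forall u v, l2 u -> l2 v -> dot (A u) v = dot u (A v).

Lemma shift_adj A z : bounded_operator A -> symmetric_op A -> forall u v, l2 u -> l2 v ->
  dot (shiftop A z u) v = dot u (shiftop A (conjc z) v).
Proof.
move=> hA sA u v hu hv; rewrite /shiftop dotBl; auto.
rewrite sA// dotZl// [RHS]dotC; auto.
by rewrite dotBl; auto; rewrite [dot u (A v)]dotC; auto; congr (_ - _); rewrite dotC; auto.
Qed.

(** The cross terms agree because the quadratic form of a symmetric operator is real. A lower bound
    for [A - z] therefore holds for its adjoint too, which is what makes [A - z] onto. *)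
Lemma shift_normal A z : bounded_operator A -> symmetric_op A -> forall u, l2 u ->
  sqnorm (shiftop A z u) = sqnorm (shiftop A (conjc z) u).
Proof.
move=> hA sA u hu; rewrite /shiftop !sqnorm_subE; auto; rewrite !sqnorm_Z// sqn_conj.
suff -> : dot (A u) (fun x => z * u x) = dot (A u) (fun x => (conjc z) * u x) by [].
have lA := bop_l2 hA hu.
rewrite [RHS](dotC lA (l2Z (conjc z) hu)) (dotZl (conjc z) hu lA).
rewrite (_ : conjc (conjc z) = z); last by apply: eq_complexP; rewrite !cE ?opprK.
by rewrite -(bopZ z hA hu) (sA _ _ hu (l2Z z hu)).
Qed.

Lemma geometric_small (theta K e : R) : 0 <= theta < 1 -> 0 < e ->
  exists n0, forall n, (n0 <= n)%N -> theta ^+ n * K <= e.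
Proof.
move=> /andP[t0 t1] e0.
have h : `|theta| < 1 by rewrite ger0_norm.
have /cvgrPdist_le/(_ e e0)[n0 _ hn] := @cvg_geometric R K theta h.
exists n0 => n nn; have := hn n nn; rewrite /= sub0r normrN mulrC; apply: le_trans.
exact: ler_norm.
Qed.

(* By the iteration u' = u + t A' (r0 - A u) with t small: the residual r0 - A u
   contracts geometrically as long as A' is bounded below on W. *)
Lemma richardson A A' (W : set (X -> R[i])) (c : R) (r0 : X -> R[i]) :
  bounded_operator A -> bounded_operator A' ->
  (forall u v, l2 u -> l2 v -> dot (A u) v = dot u (A' v)) ->
  W `<=` @l2 R X -> (forall a u v, W u -> W v -> W (fun x => a * u x + v x)) ->
  (forall u, W u -> W (A u)) -> (forall u, W u -> W (A' u)) ->
  0 < c -> (forall u, W u -> c * sqnorm u <= sqnorm (A u)) ->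
  (forall u, W u -> c * sqnorm u <= sqnorm (A' u)) -> W (fun=> 0) -> W r0 ->
  exists u, [/\ l2 u, A u = r0 & sqnorm u <= 8 / c * sqnorm r0].
Proof.
move=> bA bA' adj Wl2 Wlin WA WA' c0 lA lA' W0 Wr0.
have [M0 M00 hM0] := bop_bound bA.
(* Adding [c] to the bound [M0] keeps [c / M] below 1, so that the contraction factor [theta] is
   nonnegative. *)
pose M := M0 + c; pose t := M^-1.
have M_gt0 : 0 < M by rewrite addr_gt0.
have t_gt0 : 0 < t by rewrite invr_gt0.
pose theta := 1 - c / M.
have th : 0 <= theta < 1.
  rewrite /theta subr_ge0 ler_pdivrMr// mul1r lerDr (ltW M00) /=.
  by rewrite gtrBl divr_gt0.
pose f := fix f n := if n is m.+1 then
   (fun x => t%:C * A' (fun x => -1 * A (f m) x + r0 x) x + f m x) else (fun=> 0).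
pose r n := (fun x => -1 * A (f n) x + r0 x).
(* The iterates stay in [W], where the lower bounds hold; their limit may leave it, since [W] is not
   assumed closed. *)
have Wf n : W (f n).
  elim: n => [|n IH] //=; apply: (Wlin _ _ _ _ IH); apply: WA'; apply: Wlin => //.
  exact: WA.
have Wr n : W (r n) by apply: Wlin => //; apply: WA.
have lf n : l2 (f n) by apply: Wl2.
have lr n : l2 (r n) by apply: Wl2.
have rS n : r n.+1 = (fun x => r n x - t%:C * A (A' (r n)) x).
  rewrite {1}/r /= -/(r n) bop_lin; auto.
  by apply/funext => x; rewrite /r; ring.
(* By adjointness the cross term is [2 t |A' r|^2]; with [t = 1 / M] the quadratic term
   [t^2 |A A' r|^2] consumes at most half of it. *)
have Nr n : sqnorm (r n.+1) <= theta * sqnorm (r n).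
  rewrite rS sqnorm_subE; auto; rewrite sqnorm_Z; auto; rewrite sqnC dotZr; auto.
  rewrite [dot _ _]dotC; auto; rewrite adj; auto; rewrite dot_uu; auto.
  have h1 := hM0 (A' (r n)) (bop_l2 bA' (lr n)).
  have h2 := lA' _ (Wr n).
  have h3 : t ^+ 2 * sqnorm (A (A' (r n))) <= t * sqnorm (A' (r n)).
    rewrite expr2 -mulrA ler_pM2l// mulrC ler_pdivrMr// mulrC.
    by apply: le_trans h1 _; rewrite ler_wpM2r ?sqnorm_ge0// lerDl ltW.
  have h4 : t * (c * sqnorm (r n)) <= t * sqnorm (A' (r n)) by rewrite ler_pM2l.
  have -> : theta * sqnorm (r n) = sqnorm (r n) - t * (c * sqnorm (r n)).
    by rewrite /theta /t; ring.
  lra.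
have Nrn n : sqnorm (r n) <= theta ^+ n * sqnorm r0.
  elim: n => [|n IH].
    rewrite expr0 mul1r (_ : r 0%N = r0)//; apply/funext => x.
    by rewrite /r /= bop0// mulr0 add0r.
  rewrite exprS -mulrA; apply: le_trans (Nr n) _.
  by apply: ler_wpM2l => //; case/andP: th.
have Af n : A (f n) = (fun x => r0 x - r n x).
  by apply/funext => x; rewrite /r; ring.
have lr0 : l2 r0 by apply: Wl2.
have [g lg hg] : exists2 g, l2 g & forall e : R, 0 < e -> exists n0, forall n, (n0 <= n)%N ->
    sqnorm (fun x => f n x - g x) <= e.
  apply: l2_complete => // e e0.
  have [n0 hn0] := geometric_small (sqnorm r0) th (mulr_gt0 c0 (divr_gt0 e0 (ltr0n _ 4))).
  exists n0 => m n hm hn.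
  have Wd : W (fun x => f m x - f n x).
    rewrite (_ : (fun x => f m x - f n x) = (fun x => -1 * f n x + f m x)).
      exact: Wlin.
    by apply/funext => x; ring.
  have := lA _ Wd; rewrite bopB//.
  have -> : (fun x => A (f m) x - A (f n) x) = (fun x => r n x - r m x).
    by apply/funext => x; rewrite !Af; ring.
  move=> h; have := sqnorm_B (lr n) (lr m); have := hn0 m hm; have := hn0 n hn.
  have := Nrn m; have := Nrn n; move=> a1 a2 a3 a4 a5.
  rewrite -(ler_pM2l c0); lra.
exists g; split => //.
  have Ad : A g = (fun x => A g x - A (f 0%N) x + A (f 0%N) x).
    by apply/funext => x; rewrite subrK.
  suff : (fun x => A g x - r0 x) = (fun=> 0).
    by move=> e; apply/funext => x; apply/eqP; rewrite -subr_eq0; apply/eqP;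
      exact: (congr1 (fun f => f x) e).
  apply: sqnorm_eq0; first by auto.
  apply/ler_addgt0Pr => e e0; rewrite add0r.
  have [n1 h1] := hg _ (divr_gt0 e0 (mulr_gt0 (ltr0n _ 4) M00)).
  have [n2 h2] := geometric_small (sqnorm r0) th (divr_gt0 e0 (ltr0n _ 4)).
  pose n := maxn n1 n2.
  have {}h1 := h1 n (leq_maxl _ _); have {}h2 := h2 n (leq_maxr _ _).
  have -> : (fun x => A g x - r0 x) =
      (fun x => (A g x - A (f n) x) - r n x).
    by apply/funext => x; rewrite Af; ring.
  have h3 : sqnorm (fun x => A g x - A (f n) x) <= e / 4.
    rewrite -bopB//; apply: (le_trans (hM0 _ (l2B lg (lf n)))).
    rewrite sqnorm_sym//.
    rewrite (_ : e / 4 = M0 * (e / (4 * M0))); last by field; rewrite gt_eqF.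
    by rewrite ler_pM2l.
  have h5 := sqnorm_B (l2B (bop_l2 bA lg) (bop_l2 bA (lf n))) (lr n).
  apply: (le_trans h5); have := Nrn n; lra.
apply/ler_addgt0Pr => e e0.
have [n h1] := hg _ (divr_gt0 e0 (ltr0n _ 2)); have {}h1 := h1 n (leqnn _).
have h2 := lA _ (Wf n); have h3 := sqnorm_B lr0 (lr n); rewrite -Af in h3.
have h4 : sqnorm (r n) <= sqnorm r0.
  apply: le_trans (Nrn n) _; rewrite ler_piMl ?sqnorm_ge0//; case/andP: th => ? ?.
  by rewrite exprn_ile1// ltW.
(* The residuals never exceed [r0], so [c |f n|^2 <= |r0 - r n|^2 <= 4 |r0|^2]; replacing [f n] by
   its limit doubles the constant to [8 / c]. *)
have h5 : sqnorm (f n) <= 4 / c * sqnorm r0.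
  rewrite mulrAC ler_pdivlMr// mulrC; lra.
have -> : g = (fun x => f n x - (f n x - g x)) by apply/funext => x; ring.
apply: (le_trans (sqnorm_B (lf n) (l2B (lf n) lg))).
have -> : 8 / c * sqnorm r0 = 2 * (4 / c * sqnorm r0) by ring.
lra.
Qed.

Definition bdd_below A := exists2 c : R, 0 < c & forall u, l2 u -> c * sqnorm u <= sqnorm (A u).

(** By [shift_normal] the adjoint is bounded below as well, so [richardson] on all of l2 yields
    preimages with a norm bound. Injectivity makes the chosen preimages depend linearly on the
    right-hand side. *)
Lemma bdd_below_resolvent A z : bounded_operator A -> symmetric_op A ->
  bdd_below (shiftop A z) -> resolvent_set A z.
Proof.
move=> bA sA [c c0 hc].
have ex v : exists u, l2 v -> [/\ l2 u, shiftop A z u = v & sqnorm u <= 8 / c * sqnorm v].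
  have [hv|nhv] := pselect (l2 v); last by exists (fun=> 0).
  have [u hu] : exists u, [/\ l2 u, shiftop A z u = v & sqnorm u <= 8 / c * sqnorm v].
    apply: (@richardson _ (shiftop A (conjc z)) (@l2 R X)) => //; auto; try exact: l2_0.
    - exact: shift_adj.
    - by move=> u hu; rewrite -shift_normal//; exact: hc.
  by exists u.
have [B hB] := choice ex.
have inj u v : l2 u -> l2 v -> shiftop A z u = shiftop A z v -> u = v.
  move=> hu hv e; suff : (fun x => u x - v x) = (fun=> 0).
    by move=> e'; apply/funext => x; apply/eqP; rewrite -subr_eq0; apply/eqP;
      exact: (congr1 (fun f => f x) e').
  apply: sqnorm_eq0; auto; rewrite -(ler_pM2l c0) mulr0.
  apply: (le_trans (hc _ (l2B hu hv))); rewrite bopB; auto.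
  by rewrite e; under eq_fun do rewrite subrr; rewrite sqnorm_0.
exists B; last first.
  move=> u hu; have [l1 e1 _] := hB u hu; split; first exact: e1.
  have lv : l2 (shiftop A z u) by auto.
  by have [l2' e2 _] := hB _ lv; exact: inj.
split.
- by move=> u /hB[].
- move=> a u v hu hv; have [l1 e1 _] := hB u hu; have [l2' e2 _] := hB v hv.
  have lw : l2 (fun x => a * u x + v x) by auto.
  have [l3 e3 _] := hB _ lw; apply: inj; auto.
  by rewrite e3 bop_lin; auto; rewrite e1 e2.
exists (Num.sqrt (8 / c)) => u hu; have [_ _ h] := hB u hu.
have c1 := ltW c0.
by rewrite /l2norm -/(sqnorm _) -/(sqnorm _) -sqrtrM ?ler_wsqrtr// divr_ge0.
Qed.

Lemma resolvent_bdd_below A z : (forall u, l2 u -> l2 (A u)) ->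
  resolvent_set A z -> bdd_below (shiftop A z).
Proof.
move=> hA [B bB hB]; have [M M0 hM] := bop_bound bB.
exists M^-1 => [|u hu]; first by rewrite invr_gt0.
rewrite mulrC ler_pdivrMr// mulrC; have [_ {1}<-] := hB u hu.
by apply: hM; apply: l2B; auto.
Qed.

Lemma not_bdd_below A z : ~ bdd_below (shiftop A z) ->
  forall c, 0 < c -> exists2 u, l2 u & sqnorm (shiftop A z u) < c * sqnorm u.
Proof.
move=> h c c0; apply: contrapT => /forall2NP H; apply: h; exists c => // u hu.
by have [//|/negP] := H u; rewrite -leNgt.
Qed.

Lemma spectrumP A z : bounded_operator A -> symmetric_op A ->
  spectrum A z <-> ~ bdd_below (shiftop A z).
Proof.
move=> bA sA; split; first by move=> h /(bdd_below_resolvent bA sA).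
by move=> h /(@resolvent_bdd_below A z (fun u => bop_l2 bA)).
Qed.

Lemma spectrum_real A z : bounded_operator A -> symmetric_op A ->
  spectrum A z -> z = (complex.Re z)%:C.
Proof.
move=> bA sA /spectrumP h; have {}h := h bA sA.
suff : complex.Im z = 0 by case: (z) => a b /= ->.
apply: contrapT => /eqP i0; apply: h; exists (complex.Im z ^+ 2) => [|u hu].
  by rewrite lt_def sqrf_eq0 i0 sqr_ge0.
(* Averaging the expansions for [z] and [conjc z], which are equal by normality, leaves only the
   cross term with the real part of [z]. *)
have E : sqnorm (shiftop A z u) =
      sqnorm (shiftop A (complex.Re z)%:C u) + complex.Im z ^+ 2 * sqnorm u.
  have h1 := shift_normal z bA sA hu; rewrite /shiftop !sqnorm_subE in h1; auto.
  rewrite /shiftop !sqnorm_subE; auto; rewrite !sqnorm_Z// sqnC sqnE.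
  rewrite !sqnorm_Z// sqn_conj in h1.
  have h2 : 2 * dot (A u) (fun x => (complex.Re z)%:C * u x) =
      dot (A u) (fun x => z * u x) + dot (A u) (fun x => (conjc z) * u x).
    have lA : l2 (A u) by auto.
    rewrite ![dot (A u) _]dotC; auto; rewrite -dotDl; auto.
    rewrite (_ : (fun x => z * u x + (conjc z) * u x) =
      (fun x => 2%:C * ((complex.Re z)%:C * u x))).
      rewrite [RHS]dotC; auto; rewrite dotZr; auto.
      by congr (_ * _); rewrite dotC; auto.
    by apply/funext => x; apply: eq_complexP; rewrite !cE; ring.
  lra.
by rewrite E lerDr sqnorm_ge0.
Qed.

End Operators.
#[local] Hint Resolve bop_l2 bop_shift : core.

(** * Isolated points of the spectrum *)

Section SpectralGap.
Variables (R : realType) (X : choiceType).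
Implicit Types (u v w psi phi : X -> R[i]) (A B : (X -> R[i]) -> (X -> R[i])).

Lemma bop_comp A B : bounded_operator A -> bounded_operator B ->
  bounded_operator (A \o B).
Proof.
move=> bA bB; have [M M0 hM] := bop_bound bA; have [K K0 hK] := bop_bound bB.
have [M1 K1] := (ltW M0, ltW K0).
split; [by move=> u hu /=; auto| |].
  by move=> c u v hu hv /=; rewrite bop_lin// bop_lin; auto.
exists (Num.sqrt (M * K)) => u hu /=.
rewrite /l2norm -/(sqnorm _) -/(sqnorm _) -sqrtrM ?mulr_ge0// ler_wsqrtr//.
apply: (le_trans (hM _ (bop_l2 bB hu))).
by rewrite -mulrA ler_wpM2l// hK.
Qed.

Lemma conjc_real (a : R) : conjc a%:C = a%:C.
Proof. by apply: eq_complexP; rewrite !cE ?oppr0. Qed.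

Lemma shift_sym A (a : R) : bounded_operator A -> symmetric_op A ->
  symmetric_op (shiftop A a%:C).
Proof. by move=> bA sA u v hu hv; rewrite shift_adj// conjc_real. Qed.

Lemma sqnorm_realZ (a : R) u : l2 u -> sqnorm (fun x => a%:C * u x) = a ^+ 2 * sqnorm u.
Proof. by move=> hu; rewrite sqnorm_Z// sqnC. Qed.

Lemma shift_shift A (z w : R[i]) u : bounded_operator A -> l2 u ->
  shiftop (shiftop A z) w u = shiftop A (z + w) u.
Proof. by move=> *; apply/funext => x; rewrite /shiftop; ring. Qed.

Lemma shift_prod A (a b : R) u : bounded_operator A -> l2 u ->
  shiftop A (a + b)%:C (shiftop A (a - b)%:C u) =
  (fun x => shiftop A a%:C (shiftop A a%:C u) x - (b ^+ 2)%:C * u x).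
Proof.
move=> bA hu; apply/funext => x.
have lA : l2 (A u) by auto.
rewrite /shiftop !bopB; auto; rewrite !bopZ; auto.
by apply: eq_complexP; rewrite !cE; ring.
Qed.

(* If the infimum nu of sqnorm ((B - t) u) over unit vectors were below t^2, then both
   factors of (B - t)^2 - nu = (B - t - sqrt nu) (B - t + sqrt nu) would be bounded
   below, and nu would not be the infimum. *)
Lemma form_gap B (t : R) : bounded_operator B -> symmetric_op B -> 0 < t ->
  (forall s : R, 0 < s < 2 * t -> bdd_below (shiftop B s%:C)) ->
  forall u, l2 u -> 2 * t * dot (B u) u <= sqnorm (B u).
Proof.
move=> bB sB t0 hs.
pose T := shiftop B t%:C.
have bT : bounded_operator T by exact: bop_shift.
have sT : symmetric_op T by exact: shift_sym.
have [M M0 hM] := bop_bound bT.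
have step (nu : R) : 0 <= nu < t ^+ 2 -> (forall u, l2 u -> nu * sqnorm u <= sqnorm (T u)) ->
    exists2 c, 0 < c & forall u, l2 u -> (nu + c) * sqnorm u <= sqnorm (T u).
  move=> /andP[nu0 nut] hnu; pose mu := Num.sqrt nu.
  have mu0 : 0 <= mu by exact: sqrtr_ge0.
  have mu2 : mu ^+ 2 = nu by exact: sqr_sqrtr.
  have mut : mu < t by rewrite -(ltr_pXn2r (n := 2)) ?nnegrE// ?mu2// ltW.
  have [c1 c10 h1] : bdd_below (shiftop B (t + mu)%:C) by apply: hs; lra.
  have [c2 c20 h2] : bdd_below (shiftop B (t - mu)%:C) by apply: hs; lra.
  exists (M^-1 * (c1 * c2)) => [|u hu]; first by rewrite mulr_gt0 ?invr_gt0 ?mulr_gt0.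
  (* Up to a factor 2, [w] is the gradient at [u] of the nonnegative form [|T u|^2 - nu |u|^2]. A
     step of length [1/M] along [-w] lowers the form by at least [|w|^2 / M], so its value at [u] is
     at least that, hence at least [c1 c2 |u|^2 / M]. *)
  pose w := fun x => T (T u) x - nu%:C * u x.
  have lw : l2 w by rewrite /w; auto.
  have hw : c1 * c2 * sqnorm u <= sqnorm w.
    rewrite /w -mu2 -shift_prod// -mulrA.
    apply: le_trans (h1 _ (bop_l2 (bop_shift _ bB) hu)).
    by rewrite ler_pM2l// h2.
  have ls : l2 (fun x => M^-1%:C * w x) by auto.
  have := hnu _ (l2B hu ls).
  rewrite bopB// bopZ// !sqnorm_subE; auto; rewrite !sqnorm_realZ; auto.
  rewrite !dotZr; auto; rewrite -[dot (T u) (T w)]sT; auto.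
  have Ew : dot (T (T u)) w = sqnorm w + nu * dot u w.
    have : dot (fun x => T (T u) x - nu%:C * u x) w = sqnorm w by rewrite -dot_uu.
    rewrite dotBl; auto; rewrite [dot (fun x => nu%:C * u x) w]dotC; auto.
    by rewrite dotZr// [dot w u]dotC//; lra.
  have hN : M^-1 ^+ 2 * sqnorm (T w) <= M^-1 * sqnorm w.
    rewrite expr2 -mulrA ler_pM2l ?invr_gt0// mulrC ler_pdivrMr// mulrC.
    exact: hM.
  have hN2 : 0 <= M^-1 ^+ 2 * (nu * sqnorm w).
    by rewrite mulr_ge0 ?sqr_ge0// mulr_ge0// sqnorm_ge0.
  have hN3 : M^-1 * (c1 * c2 * sqnorm u) <= M^-1 * sqnorm w by rewrite ler_pM2l ?invr_gt0.
  rewrite Ew => hq; rewrite !mulrDl; lra.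
have key u : l2 u -> t ^+ 2 * sqnorm u <= sqnorm (T u).
  move=> hu; rewrite leNgt; apply/negP => hlt.
  have Nu0 : 0 < sqnorm u.
    rewrite lt_def sqnorm_ge0 andbT; apply/negP => /eqP N0.
    by have := sqnorm_ge0 (T u); rewrite leNgt; rewrite N0 mulr0 in hlt; rewrite hlt.
  pose S := [set nu : R | 0 <= nu /\ forall v, l2 v -> nu * sqnorm v <= sqnorm (T v)].
  have S0 : S 0 by split => // v _; rewrite mul0r sqnorm_ge0.
  have Sub : ubound S (sqnorm (T u) / sqnorm u).
    by move=> nu [_ /(_ u hu)]; rewrite ler_pdivlMr.
  have hS : has_sup S by split; [exists 0|exists (sqnorm (T u) / sqnorm u)].
  have sup0 : 0 <= sup S by exact: (sup_upper_bound hS).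
  have supS : forall v, l2 v -> sup S * sqnorm v <= sqnorm (T v).
    move=> v hv; have [|Nv0] := lerP (sqnorm v) 0.
      by move=> h; rewrite (le_trans _ (sqnorm_ge0 _))// mulr_ge0_le0.
    rewrite -ler_pdivlMr//; apply: ge_sup => [|nu [_ /(_ v hv)]]; first by exists 0.
    by rewrite ler_pdivlMr.
  have supt : sup S < t ^+ 2.
    by rewrite -(ltr_pM2r Nu0); apply: le_lt_trans hlt; exact: supS.
  have [|c c0 hc] := step (sup S) _ supS; first by rewrite sup0.
  have : S (sup S + c) by split; [rewrite addr_ge0// ltW|].
  by move=> /(sup_upper_bound hS); rewrite gerDl leNgt c0.
(* Expanding [|(B - t) u|^2], the terms [t^2 |u|^2] cancel. *)
move=> u hu; have := key u hu; rewrite /T /shiftop sqnorm_subE; auto.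
rewrite sqnorm_realZ// dotZr; auto; lra.
Qed.

(** This is [form_gap] for the square of [A] with [2 t = e^2]; its hypothesis follows from
    [A^2 - s = (A + sqrt s) (A - sqrt s)]. The outcome is that [A] is bounded below on its own
    range. *)
Lemma range_gap A (e : R) : bounded_operator A -> symmetric_op A -> 0 < e ->
  (forall s : R, 0 < `|s| < e -> bdd_below (shiftop A s%:C)) ->
  forall u, l2 u -> e ^+ 2 * sqnorm (A u) <= sqnorm (A (A u)).
Proof.
move=> bA sA e0 hs u hu.
have bB : bounded_operator (A \o A) by exact: bop_comp.
have sB : symmetric_op (A \o A) by move=> v w hv hw /=; rewrite !sA; auto.
have t0 : 0 < e ^+ 2 / 2 by rewrite divr_gt0// exprn_gt0.
have := @form_gap _ _ bB sB t0; rewrite mulrC divfK// => /(_ _ u hu) /=.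
rewrite sA; auto; rewrite dot_uu; auto; apply => s /andP[s0 se].
pose r := Num.sqrt s.
have r0 : 0 < r by rewrite sqrtr_gt0.
have r2 : r ^+ 2 = s by rewrite sqr_sqrtr// ltW.
have re : r < e by rewrite -(ltr_pXn2r (n := 2)) ?nnegrE// ?r2// ltW.
have [c1 c10 h1] : bdd_below (shiftop A (0 + r)%:C).
  by apply: hs; rewrite add0r gtr0_norm// r0.
have [c2 c20 h2] : bdd_below (shiftop A (0 - r)%:C).
  by apply: hs; rewrite sub0r normrN gtr0_norm// r0.
exists (c1 * c2) => [|v hv]; first exact: mulr_gt0.
have -> : shiftop (A \o A) s%:C v = shiftop A (0 + r)%:C (shiftop A (0 - r)%:C v).
  rewrite shift_prod// r2; apply/funext => x; rewrite /shiftop /=.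
  rewrite (_ : (fun x => A v x - 0%:C * v x) = A v); last first.
    by apply/funext => y; rewrite mul0r subr0.
  by rewrite mul0r subr0.
rewrite -mulrA; apply: le_trans (h1 _ (bop_l2 (bop_shift _ bA) hv)).
by rewrite ler_pM2l// h2.
Qed.

(** On the range of [A] the gap makes [richardson] applicable: it solves [A v = A u] with [|v|]
    controlled by [|A u|], and [u - v] is the desired kernel vector. This replaces the spectral
    projection at an isolated point. *)
Lemma near_kernel A (e : R) : bounded_operator A -> symmetric_op A -> 0 < e ->
  (forall s : R, 0 < `|s| < e -> bdd_below (shiftop A s%:C)) ->
  exists2 C : R, 0 < C & forall u, l2 u ->
    exists k, [/\ l2 k, A k = (fun=> 0) & sqnorm (fun x => u x - k x) <= C * sqnorm (A u)].
Proof.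
move=> bA sA e0 hs; have e2 : 0 < e ^+ 2 by rewrite exprn_gt0.
have gap := range_gap bA sA e0 hs.
exists (8 / e ^+ 2) => [|u hu]; first by rewrite divr_gt0.
pose W := [set v | exists2 w, l2 w & v = A w].
have [v [lv Av Nv]] : exists v, [/\ l2 v, A v = A u & sqnorm v <= 8 / e ^+ 2 * sqnorm (A u)].
  apply: (@richardson _ _ A A W) => //.
  - by move=> _ [w hw ->]; auto.
  - move=> a _ _ [w hw ->] [w' hw' ->]; exists (fun x => a * w x + w' x); auto.
    by rewrite bop_lin.
  - by move=> _ [w hw ->]; exists (A w); auto.
  - by move=> _ [w hw ->]; exists (A w); auto.
  - by move=> _ [w hw ->]; exact: gap.
  - by move=> _ [w hw ->]; exact: gap.
  - by exists (fun=> 0); [exact: l2_0|rewrite bop0].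
  - by exists u.
exists (fun x => u x - v x); split; auto.
  by rewrite bopB// Av; apply/funext => x; rewrite subrr.
rewrite (_ : (fun x => _) = v)//.
by apply/funext => x; ring.
Qed.

End SpectralGap.

(** * Limits along a free ultrafilter *)

Section UltraLimits.
Variable R : realType.

Lemma exists_ultra : exists2 U : set_system nat, UltraFilter U & \oo `<=` U.
Proof. by have [U [hU hs]] := @ultraFilterLemma _ \oo _; exists U. Qed.

(** Compactness of a segment. One ultrafilter serves all bounded sequences, so limits at all sites
    exist simultaneously without choosing a diagonal subsequence. *)
Lemma ultra_cvg (U : set_system nat) (a : nat -> R) (M : R) : UltraFilter U ->
  (\forall n \near U, `|a n| <= M) -> exists l : R, a n @[n --> U] --> l.
Proof.
move=> hU hM.
have hV : UltraFilter (a @ U).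
  split; first exact: fmap_proper_filter.
  move=> G hG sG; apply/seteqP; split=> // B GB.
  have [//|hB] := in_ultra_setVsetC (a @^-1` B) hU.
  have GC : G (~` B) by exact: sG.
  by have [x []] := filter_ex (filterI GB GC).
have := @segment_compact R (- M) M; rewrite compact_ultra => /(_ (a @ U) hV)[].
  by rewrite /fmap /=; apply: filterS hM => n; rewrite ler_norml /= in_itv.
by move=> l [_ hl]; exists l.
Qed.

Lemma ultra_ex (U : set_system nat) (P : set nat) : UltraFilter U -> \oo `<=` U ->
  U P -> forall n0, exists2 n, (n0 <= n)%N & P n.
Proof.
move=> hU sU hP n0.
have h0 : U [set n | (n0 <= n)%N] by apply: sU; exists n0.
by have [n [? ?]] := filter_ex (filterI h0 hP); exists n.
Qed.

End UltraLimits.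

(** * Normalizing and truncating approximate eigenvectors *)

Section EssentialSpectrum.
Variables (R : realType) (X : choiceType).
Implicit Types (u v w psi phi : X -> R[i]) (A B : (X -> R[i]) -> (X -> R[i])).

Lemma sqnorm_sum_le n (f : 'I_n -> X -> R[i]) : (forall i, l2 (f i)) ->
  sqnorm (fun x => \sum_i f i x) <= n%:R * \sum_i sqnorm (f i).
Proof.
move=> hf; have [] // := @l2_bound _ _ (fun x => \sum_i f i x) (n%:R * \sum_i sqnorm (f i)).
move=> s us; apply: le_trans (_ : \sum_(x <- s) n%:R * \sum_i sqn (f i x) <= _).
  apply: ler_sum => x _; apply: le_trans (sqn_sum _ _) _.
  by rewrite /index_enum -enumT size_enum_ord.
rewrite -mulr_sumr ler_wpM2l// exchange_big /=.
by apply: ler_sum => i _; exact: sqnorm_seq.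
Qed.

Lemma unitize T u (c : R) : bounded_operator T -> l2 u -> sqnorm (T u) < c * sqnorm u ->
  exists v, [/\ l2 v, sqnorm v = 1, sqnorm (T v) <= c & forall x, u x = 0 -> v x = 0].
Proof.
move=> bT hu h.
have u0 : 0 < sqnorm u.
  rewrite lt_def sqnorm_ge0 andbT; apply/negP => /eqP N0.
  by move: h; rewrite N0 mulr0 ltNge sqnorm_ge0.
pose a := (Num.sqrt (sqnorm u))^-1.
have a2 : a ^+ 2 = (sqnorm u)^-1 by rewrite /a exprVn sqr_sqrtr// ltW.
exists (fun x => a%:C * u x); split; auto.
- by rewrite sqnorm_realZ// a2 mulVf// gt_eqF.
- rewrite bopZ// sqnorm_realZ; auto; rewrite a2 mulrC ler_pdivrMr//; exact: ltW.
- by move=> x ->; rewrite mulr0.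
Qed.

Lemma cut_below A u (c : R) : bounded_operator A -> l2 u -> sqnorm (A u) < c * sqnorm u ->
  exists s, sqnorm (A (cut s u)) < c * sqnorm (cut s u).
Proof.
move=> bA hu h; have [M M0 hM] := bop_bound bA.
have c0 : 0 < c.
  rewrite ltNge; apply/negP => c0.
  by have := sqnorm_ge0 (A u); rewrite leNgt (lt_le_trans h)// mulr_le0_ge0// sqnorm_ge0.
pose q := c * sqnorm u - sqnorm (A u).
have q0 : 0 < q by rewrite subr_gt0.
have [Nu0 M1] := (sqnorm_ge0 u, ltW M0).
(* The errors below add up to at most [2 t B], so [t = q / (4 B)] keeps them under the gap [q]. The
   error [d] must satisfy both [|d|^2 <= t] and, for the cross terms weighted by [t^-1],
   [|d|^2 <= t^2]. *)
pose B := c + M + c * sqnorm u + M * sqnorm u + 1.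
have B0 : 0 < B by rewrite /B ltr_wpDl// !addr_ge0// ?mulr_ge0// ltW.
pose t := q / (4 * B).
have t0 : 0 < t by rewrite divr_gt0// mulr_gt0.
pose e := Num.min (t ^+ 2) t.
have e0 : 0 < e by rewrite lt_min exprn_gt0.
have [s hs] := cut_approx hu e0; exists s; have {}hs := hs s (fun x xs => xs).
set d := (fun x => _) in hs.
have ld : l2 d by apply: l2B => //; exact: l2_cut.
have Ecut : cut s u = (fun x => u x - d x).
  by apply/funext => x; rewrite /d; ring.
rewrite Ecut; clear Ecut; clearbody d; rewrite bopB// !sqnorm_subE; auto.
have d1 := dot_le t0 hu ld.
have d2 := dot_le t0 (bop_l2 bA hu) (bop_l2 bA ld).
have h1 := hM _ ld; have h2 := hM _ hu.
have e1 : sqnorm d <= t ^+ 2 by rewrite (le_trans hs)// ge_min lexx.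
have e2 : sqnorm d <= t by rewrite (le_trans hs)// ge_min lexx orbT.
have f1 : t^-1 * sqnorm d <= t by rewrite mulrC ler_pdivrMr// -expr2.
have f2 : t^-1 * sqnorm (A d) <= M * t.
  apply: le_trans (_ : t^-1 * (M * sqnorm d) <= _); first by rewrite ler_pM2l ?invr_gt0.
  by rewrite mulrCA ler_pM2l.
have f3 : t * sqnorm (A u) <= t * (M * sqnorm u) by rewrite ler_pM2l.
have f4 : sqnorm (A d) <= M * t by rewrite (le_trans h1)// ler_pM2l.
have g1 := ler_norm (dot u d); have g2 := ler_norm (- dot (A u) (A d)).
rewrite normrN in g2.
have tB : 4 * (t * B) = q by rewrite /t; field; rewrite gt_eqF.
have Nd := sqnorm_ge0 d.
have m1 : 0 <= c * sqnorm d by rewrite mulr_ge0// ltW.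
have m2 : c * (2 * `|dot u d|) <= c * (t * sqnorm u + t).
  by rewrite ler_pM2l//; lra.
have m3 : c * (2 * dot u d) <= c * (2 * `|dot u d|) by rewrite ler_pM2l//; lra.
clearbody e; clearbody t; rewrite /B /q in tB q0; clear hs.
have [t1 c1] := (ltW t0, ltW c0).
have m5 : 0 <= t * (M * sqnorm u) := mulr_ge0 t1 (mulr_ge0 M1 Nu0).
have m6 : 0 <= t * (c * sqnorm u) := mulr_ge0 t1 (mulr_ge0 c1 Nu0).
have m7 : 0 <= t * c := mulr_ge0 t1 c1.
have m8 : 0 <= t * M := mulr_ge0 t1 M1.
lra.
Qed.

End EssentialSpectrum.

(** * Finitely supported trial functions and the essential spectrum *)

Section Persson.
Variables (R : realType) (X : choiceType).
Implicit Types (u v w psi phi : X -> R[i]) (A B : (X -> R[i]) -> (X -> R[i])).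

(** A singular Weyl sequence in Persson's form: vanishing on prescribed finite sets replaces weak
    convergence to zero. *)
Definition far_singular A (z : R[i]) := forall (s : seq X) (c : R), 0 < c ->
  exists u, [/\ l2 u, {in s, forall x, u x = 0} & sqnorm (shiftop A z u) < c * sqnorm u].

Lemma normc_real (a : R) : normc a%:C = `|a|.
Proof. by rewrite /normc /= expr0n addr0 sqrtr_sqr. Qed.

Lemma far_singular_spectrum A z : bounded_operator A -> symmetric_op A ->
  far_singular A z -> spectrum A z.
Proof.
move=> bA sA h; apply/spectrumP => // -[c c0 hc].
by have [u [hu _]] := h [::] c c0; rewrite ltNge hc.
Qed.

(** Each vector is truncated to a finite set and the next one is required to vanish on all the sets
    used before. *)
Lemma disjoint_sequence (T : (X -> R[i]) -> X -> R[i]) (c : R) :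
  bounded_operator T ->
  (forall s : seq X, exists u,
    [/\ l2 u, {in s, forall x, u x = 0} & sqnorm (T u) < c * sqnorm u]) ->
  exists f : nat -> X -> R[i], [/\ forall j, l2 (f j), forall j, sqnorm (f j) = 1,
    forall j, sqnorm (T (f j)) <= c &
    forall i j x, i != j -> f i x != 0 -> f j x = 0].
Proof.
move=> bT h.
have step (s : seq X) : exists p : (X -> R[i]) * seq X,
    [/\ l2 p.1, sqnorm p.1 = 1, sqnorm (T p.1) <= c, {in s, forall x, p.1 x = 0} &
       forall x, x \notin p.2 -> p.1 x = 0].
  have [u [hu us hN]] := h s; have [s' hs'] := cut_below bT hu hN.
  have [v [lv Nv1 NTv hv]] := unitize bT (l2_cut _ _) hs'.
  exists (v, s'); split => //= x xs; apply: hv; rewrite /cut.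
    by case: ifP => // _; exact: us.
  by rewrite (negbTE xs).
have [G hG] := choice step.
pose S j := iter j (fun s => s ++ (G s).2) [::].
have Ssub i j : (i < j)%N -> {subset (G (S i)).2 <= S j}.
  elim: j => // j IH; rewrite ltnS leq_eqVlt => /predU1P[<-|/IH{}IH] x hx /=;
    by rewrite mem_cat ?hx ?orbT// IH.
have dis i j x : (i < j)%N -> (G (S i)).1 x != 0 -> (G (S j)).1 x = 0.
  move=> ij xi; have [_ _ _ hj _] := hG (S j); apply: hj; apply: (Ssub i j ij).
  have [_ _ _ _ hi] := hG (S i).
  by apply/negP => /negP /hi e; rewrite e eqxx in xi.
exists (fun j => (G (S j)).1); split.
- by move=> j; case: (hG (S j)).
- by move=> j; case: (hG (S j)).
- by move=> j; case: (hG (S j)).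
move=> i j x; rewrite neq_ltn => /orP[ij|ji] xi; first exact: dis ij xi.
by apply/eqP; apply: contraNT xi => xj; rewrite (dis j i).
Qed.

(** If [z] were isolated with an eigenspace inside the span of [n] vectors, then by [near_kernel]
    disjointly supported approximate eigenvectors would lie close to that span. Among [n + 1] of
    them this gives an almost linear relation, which disjoint supports exclude. *)
Lemma far_singular_ess A z : bounded_operator A -> symmetric_op A ->
  far_singular A z -> ess_spectrum A z.
Proof.
move=> bA sA h; have sz := far_singular_spectrum bA sA h; split => //.
move=> [[e e0 iso] _ [n [ev hev]]].
have zr := spectrum_real bA sA sz.
pose T := shiftop A z.
have bT : bounded_operator T by exact: bop_shift.
have sT : symmetric_op T by rewrite /T zr; exact: shift_sym.
have [|C C0 hC] := near_kernel bT sT e0.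
  move=> s /andP[s0 se]; apply: contrapT => hb.
  have : spectrum A (z + s%:C).
    apply/spectrumP => // -[c c0 hc]; apply: hb; exists c => // u hu.
    by rewrite shift_shift//; exact: hc.
  move=> /iso; rewrite addrAC subrr add0r normc_real => /(_ se)/eqP.
  rewrite -subr_eq0 addrAC subrr add0r => /eqP/(congr1 (@complex.Re R)) /= s00.
  by rewrite s00 normr0 ltxx in s0.
(* Chosen so that the final chain of estimates reads [P <= (n+1)^2 C d P = P / 4] and forces
   [P = 0]. *)
pose d : R := (4 * C * n.+1%:R ^+ 2)^-1.
have n0 : 0 < n.+1%:R :> R by rewrite ltr0n.
have d0 : 0 < d by rewrite invr_gt0 !mulr_gt0// exprn_gt0.
have [f [lf Nf NTf dis]] := disjoint_sequence bT (fun s => h s d d0).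
have [k hk] := choice (fun j => hC _ (lf j)).
have lk j : l2 (k j) by case: (hk j).
have Nk j : sqnorm (fun x => f j x - k j x) <= C * d.
  by case: (hk j) => _ _ /le_trans; apply; rewrite ler_pM2l.
have ek j : eigenvector A z (k j).
  split => //; case: (hk j) => _ Tk _; apply/funext => x; apply/eqP.
  by rewrite -subr_eq0; apply/eqP; exact: (congr1 (fun f => f x) Tk).
have [c hc] := choice (fun j => hev _ (ek j)).
(* With more rows than columns, a nonzero row of the left kernel is a linear relation between the
   kernel vectors [k j]. *)
pose M : 'M[R[i]]_(n.+1, n) := \matrix_(j < n.+1, i < n) c j i.
have kM : kermx M != 0.
  by rewrite kermx_eq0 /row_free neq_ltn (leq_ltn_trans (rank_leq_col M)).
pose v := nz_row (kermx M).
have v0 : v != 0 by rewrite nz_row_eq0.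
have vM : v *m M = 0 by apply/sub_kermxP; exact: nz_row_sub.
have sk y : \sum_(j < n.+1) v 0 j * k j y = 0.
  transitivity (\sum_(i < n) (v *m M) 0 i * ev i y); last first.
    by rewrite vM big1// => i _; rewrite mxE mul0r.
  under [RHS]eq_bigr => i _ do rewrite mxE mulr_suml.
  rewrite exchange_big /=; apply: eq_bigr => j _; rewrite hc mulr_sumr.
  by apply: eq_bigr => i _; rewrite mxE mulrA.
pose F y := \sum_(j < n.+1) v 0 j * f j y.
have lF : l2 F by apply: l2_sum => j; exact: l2Z.
have FE : F = (fun y => \sum_(j < n.+1) v 0 j * (f j y - k j y)).
  apply/funext => y.
  transitivity (F y - \sum_(j < n.+1) v 0 j * k j y); first by rewrite sk subr0.
  by rewrite /F -sumrB; apply: eq_bigr => j _; rewrite mulrBr.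
pose P : R := \sum_(j < n.+1) sqn (v 0 j).
have NF : sqnorm F <= n.+1%:R * (P * (C * d)).
  rewrite FE; apply: le_trans (sqnorm_sum_le _) _; first by move=> j; auto.
  rewrite ler_pM2l// /P mulr_suml; apply: ler_sum => j _.
  by rewrite sqnorm_Z; auto; rewrite ler_wpM2l// sqn_ge0.
have vF j : sqn (v 0 j) <= sqnorm F.
  have hle y : sqn (v 0 j * f j y) <= 1 * sqn (F y).
    rewrite mul1r; have [->|fy] := eqVneq (f j y) 0.
      by rewrite mulr0 sqn0 sqn_ge0.
    rewrite /F (bigD1 j)//= [X in _ + X]big1 ?addr0// => i ij.
        by rewrite (dis j i)// ?mulr0// eq_sym.
  by have [_] := l2_le lF ler01 hle; rewrite sqnorm_Z// Nf; lra.
have PF : P <= n.+1%:R * sqnorm F.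
  apply: le_trans (_ : \sum_(j < n.+1) sqnorm F <= _); first exact: ler_sum.
  by rewrite sumr_const card_ord mulr_natl.
have P0 : P <= 0.
  have : n.+1%:R * sqnorm F <= P / 4.
    rewrite (_ : P / 4 = n.+1%:R * (n.+1%:R * (P * (C * d)))).
      by rewrite ler_pM2l.
    by rewrite /d; field; rewrite !gt_eqF.
  have : 0 <= P by apply: sumr_ge0 => j _; exact: sqn_ge0.
  lra.
move/negP: v0; apply; apply/eqP/rowP => j; rewrite mxE; apply: sqn_eq0.
apply/eqP; rewrite eq_le sqn_ge0 andbT (le_trans _ P0)//.
by rewrite /P (bigD1 j)//= lerDl sumr_ge0// => i _; exact: sqn_ge0.
Qed.


(** On the finite set [s] a subsequence converges pointwise; off [s] the lower bound turns small
    values of [T] into small differences. The subsequence is thus Cauchy in norm, which is the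
    compactness that a Fredholm operator provides. *)
Lemma fredholm_compact (T : (X -> R[i]) -> X -> R[i]) (s : seq X) (c : R) f :
  bounded_operator T -> 0 < c ->
  (forall u, l2 u -> {in s, forall x, u x = 0} -> c * sqnorm u <= sqnorm (T u)) ->
  (forall n, l2 (f n)) -> (forall n, sqnorm (f n) = 1) ->
  (forall n, sqnorm (T (f n)) <= n.+1%:R^-1) ->
  exists g, [/\ l2 g, T g = (fun=> 0) &
    forall (e : R) n0, 0 < e -> exists2 n, (n0 <= n)%N & sqnorm (fun x => f n x - g x) <= e].
Proof.
move=> bT c0 hT lf Nf NTf.
have [U hU sU] := exists_ultra; have PU : ProperFilter U by exact: ultra_proper.
have f1 n x : sqn (f n x) <= 1 by rewrite -(Nf n) sqnorm_point.
have bnd (r : R[i]) : sqn r <= 1 -> `|complex.Re r| <= 1 /\ `|complex.Im r| <= 1.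
  rewrite sqnE => hr; split; rewrite -(@ler_pXn2r _ 2%N)// ?nnegrE// expr1n;
    rewrite real_normK ?num_real// (le_trans _ hr)//.
  - by rewrite lerDl sqr_ge0.
  - by rewrite lerDr sqr_ge0.
have lim x : exists l : R[i], ccvg U (fun n => f n x) l.
  have [a ha] : exists a : R, complex.Re (f n x) @[n --> U] --> a.
    apply: (@ultra_cvg R U (fun n => complex.Re (f n x)) 1) => //.
    by apply: filterE => n; have [] := bnd _ (f1 n x).
  have [b hb] : exists b : R, complex.Im (f n x) @[n --> U] --> b.
    apply: (@ultra_cvg R U (fun n => complex.Im (f n x)) 1) => //.
    by apply: filterE => n; have [] := bnd _ (f1 n x).
  by exists (a +i* b).
have [a ha] := choice lim.
have conv : (\sum_(x <- undup s) sqn (a x - f n x)) @[n --> U] --> (0 : R).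
  rewrite [X in _ --> X](_ : _ = \sum_(x <- undup s) sqn (a x - a x)); last first.
    by rewrite big1// => x _; rewrite subrr sqn0.
  apply: cvg_big => [|x _]; [exact: add_continuous|by apply: ccvg_sqn; exact: ha].
have near0 j : exists n, (j <= n)%N /\ \sum_(x <- undup s) sqn (a x - f n x) <= j.+1%:R^-1.
  have j0 : 0 < j.+1%:R^-1 :> R by rewrite invr_gt0 ltr0n.
  have /cvgrPdist_le/(_ _ j0) hn := conv.
  have [n jn] := ultra_ex hU sU hn j.
  rewrite sub0r normrN => hn'; exists n; split => //.
  exact: le_trans (ler_norm _) hn'.
have [m hm] := choice near0.
have [M M0 hM] := bop_bound bT.
have small (K e : R) : 0 < e -> exists n0, forall n, (n0 <= n)%N -> K / n.+1%:R <= e.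
  move=> e0; exists (Num.truncn (`|K| / e)) => n hn.
  have n1 : 0 < n.+1%:R :> R by rewrite ltr0n.
  rewrite ler_pdivrMr// (le_trans (ler_norm _))// mulrC -ler_pdivrMr//.
  have := truncnS_gt (`|K| / e); move/ltW/le_trans; apply.
  by rewrite ler_nat ltnS.
have Tm j : sqnorm (T (f (m j))) <= j.+1%:R^-1.
  apply: le_trans (NTf _) _; rewrite lef_pV2 ?posrE ?ltr0n// ler_nat ltnS.
  by case: (hm j).
(* A difference of two vectors is split into its part on [s], contributing 4, and the remainder,
   controlled through [c]; [M] enters because [T] of the part on [s] is subtracted. *)
pose K := 4 + 2 * c^-1 * (4 + 4 * M).
have ledif i j : sqnorm (fun x => f (m i) x - f (m j) x) <= K * (i.+1%:R^-1 + j.+1%:R^-1).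
  set di : R := i.+1%:R^-1; set dj : R := j.+1%:R^-1.
  pose d x := f (m i) x - f (m j) x; rewrite -/d.
  have ld : l2 d by exact: l2B.
  have lc := l2_cut s d.
  have Ncut : sqnorm (cut s d) <= 2 * di + 2 * dj.
    have hc x : x \notin undup s -> cut s d x = 0.
      by rewrite mem_undup /cut => /negbTE ->.
    have [_ ->] := fs_bound (undup_uniq _) hc.
    apply: le_trans (_ : \sum_(x <- undup s)
      (2 * sqn (a x - f (m i) x) + 2 * sqn (a x - f (m j) x)) <= _).
      rewrite [leLHS]big_seq [leRHS]big_seq; apply: ler_sum => x.
      rewrite mem_undup /cut => ->; rewrite /d -sqnN -[in leRHS](sqnN (_ - f (m j) x)).
      apply: le_trans (sqnD _ _); rewrite le_eqVlt; apply/orP; left; apply/eqP.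
      by congr sqn; ring.
    by rewrite big_split /= -!mulr_sumr lerD// ler_pM2l//; case: (hm i) (hm j) => _ ? [].
  have lr : l2 (fun x => d x - cut s d x) by auto.
  have h1 : c * sqnorm (fun x => d x - cut s d x) <= sqnorm (T (fun x => d x - cut s d x)).
    by apply: hT => // x xs; rewrite /cut xs subrr.
  rewrite bopB// in h1; have h2 := sqnorm_B (bop_l2 bT ld) (bop_l2 bT lc).
  have h3 := hM _ lc.
  have h4 : sqnorm (T d) <= 2 * di + 2 * dj.
    rewrite bopB//; apply: (le_trans (sqnorm_B (bop_l2 bT (lf _)) (bop_l2 bT (lf _)))).
    by rewrite lerD// ler_pM2l.
  have h5 : sqnorm (fun x => d x - cut s d x) <= c^-1 * ((4 + 4 * M) * (di + dj)).
    rewrite mulrC ler_pdivlMr// mulrC.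
    have h6 : M * sqnorm (cut s d) <= M * (2 * di + 2 * dj) by rewrite ler_pM2l.
    lra.
  have -> : d = (fun x => cut s d x + (d x - cut s d x)).
    by apply/funext => x; ring.
  apply: (le_trans (sqnorm_D lc lr)).
  have -> : K * (di + dj) = 4 * (di + dj) + 2 * (c^-1 * ((4 + 4 * M) * (di + dj))).
    by rewrite /K; ring.
  lra.
have [g lg hg] : exists2 g, l2 g & forall e : R, 0 < e -> exists n0, forall n, (n0 <= n)%N ->
    sqnorm (fun x => f (m n) x - g x) <= e.
  apply: l2_complete => // e e0.
  have [n0 hn0] := small K _ (divr_gt0 e0 (ltr0n _ 2)).
  exists n0 => i j hi hj; apply: (le_trans (ledif i j)).
  by rewrite mulrDr [leRHS]splitr lerD//; exact: hn0.
exists g; split => //; last first.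
  move=> e n0 e0; have [n1 h1] := hg e e0.
  exists (m (maxn n0 n1)); last by apply: h1; exact: leq_maxr.
  by apply: leq_trans (_ : maxn n0 n1 <= _)%N; [exact: leq_maxl|case: (hm (maxn n0 n1))].
apply: sqnorm_eq0; first by auto.
apply/ler_addgt0Pr => e e0; rewrite add0r.
have [n1 h1] := hg _ (divr_gt0 e0 (mulr_gt0 (ltr0n _ 4) M0)).
have [n2 h2] := small 1 _ (divr_gt0 e0 (ltr0n _ 4)).
pose n := maxn n1 n2.
have {}h1 := h1 n (leq_maxl _ _); have {}h2 := h2 n (leq_maxr _ _).
have -> : T g = (fun x => T (f (m n)) x - T (fun y => f (m n) y - g y) x).
  by rewrite bopB//; apply/funext => x; ring.
apply: (le_trans (sqnorm_B (bop_l2 bT (lf _)) (bop_l2 bT (l2B (lf _) lg)))).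
have h3 := hM _ (l2B (lf (m n)) lg); have h4 := Tm n.
have h5 : M * sqnorm (fun x => f (m n) x - g x) <= e / 4.
  rewrite (_ : e / 4 = M * (e / (4 * M))); last by field; rewrite gt_eqF.
  by rewrite ler_pM2l.
rewrite div1r in h2; have h6 := le_trans h4 h2; have h7 := le_trans h3 h5.
lra.
Qed.


Lemma not_far_singularP A z : ~ far_singular A z ->
  exists (s : seq X) (c : R), 0 < c /\
    forall u, l2 u -> {in s, forall x, u x = 0} -> c * sqnorm u <= sqnorm (shiftop A z u).
Proof.
move=> h; apply: contrapT => H; apply: h => s c c0.
apply: contrapT => H'; apply: H; exists s, c; split => // u hu us.
by rewrite leNgt; apply/negP => hN; apply: H'; exists u.
Qed.

Lemma unit_sequence A (z : nat -> R[i]) (c : nat -> R) : bounded_operator A ->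
  symmetric_op A -> (forall n, spectrum A (z n)) -> (forall n, 0 < c n) ->
  exists f, [/\ forall n, l2 (f n), forall n, sqnorm (f n) = 1 &
    forall n, sqnorm (shiftop A (z n) (f n)) <= c n].
Proof.
move=> bA sA hz c0.
have h n : exists u, [/\ l2 u, sqnorm u = 1 & sqnorm (shiftop A (z n) u) <= c n].
  have /spectrumP hn := hz n; have [u hu hN] := not_bdd_below (hn bA sA) (c0 n).
  by have [v [? ? ? _]] := unitize (bop_shift _ bA) hu hN; exists v.
by have [f hf] := choice h; exists f; split => n; case: (hf n).
Qed.

(** Eigenvectors of distinct eigenvalues are orthogonal since [(z - w) <u, g> = <(A - w) u, g>].
    Measuring the residual relative to [|w - z|] keeps the bound uniform as [w] approaches [z]. *)
Lemma almost_orthogonal A (z w : R) (eta : R) u g : bounded_operator A ->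
  symmetric_op A -> l2 u -> l2 g -> shiftop A z%:C g = (fun=> 0) -> w != z -> 0 < eta ->
  sqnorm (shiftop A w%:C u) <= (w - z) ^+ 2 * eta ^+ 2 ->
  2 * `|dot u g| <= eta * (1 + sqnorm g).
Proof.
move=> bA sA hu hg Tg wz eta0 hN.
have d0 : 0 < `|w - z| by rewrite normr_gt0 subr_eq0.
have Ag : A g = (fun x => z%:C * g x).
  apply/funext => x; apply/eqP; rewrite -subr_eq0; apply/eqP.
  exact: (congr1 (fun f => f x) Tg).
have E : dot (shiftop A w%:C u) g = (z - w) * dot u g.
  rewrite (shift_sym _ bA sA)// -dotZr//; congr dot; apply/funext => x.
  by rewrite /shiftop Ag; apply: eq_complexP; rewrite !cE; ring.
have t0 : 0 < (`|w - z| * eta)^-1 by rewrite invr_gt0 mulr_gt0.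
have := dot_le t0 (bop_l2 (bop_shift w%:C bA) hu) hg.
rewrite E normrM [`|z - w|]distrC invrK => h.
rewrite -(ler_pM2l d0) mulrCA; apply: (le_trans h).
have h2 : (`|w - z| * eta)^-1 * sqnorm (shiftop A w%:C u) <= `|w - z| * eta.
  rewrite mulrC ler_pdivrMr ?mulr_gt0// -expr2 exprMn real_normK ?num_real//.
rewrite mulrA mulrDr mulr1 lerD2r//.
Qed.

Lemma ess_far_singular A z : bounded_operator A -> symmetric_op A ->
  ess_spectrum A z -> far_singular A z.
Proof.
move=> bA sA [sz nz]; apply: contrapT => /not_far_singularP[s [c [c0 hc]]]; apply: nz.
have zr := spectrum_real bA sA sz.
have bT : bounded_operator (shiftop A z) by exact: bop_shift.
have inv0 n : 0 < n.+1%:R^-1 :> R by rewrite invr_gt0 ltr0n.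
split.
(* Unit approximate eigenvectors for spectral points [w n] accumulating at [z] would come close to
   an eigenvector [g] of [z], to which they are almost orthogonal: [|f - g|^2 <= 1/4] contradicts
   [2 <f, g> <= (1 + |g|^2) / 4]. *)
- apply: contrapT => niso.
  have wex n : exists w : R[i], [/\ spectrum A w, normc (w - z) ^+ 2 < n.+1%:R^-1 / 4 & w != z].
    apply: contrapT => H; apply: niso.
    exists (Num.sqrt (n.+1%:R^-1 / 4)); first by rewrite sqrtr_gt0 divr_gt0.
    move=> w sw hw; apply/eqP; apply/negPn/negP => wz; apply: H; exists w; split => //.
    rewrite -[ltRHS]sqr_sqrtr ?divr_ge0 ?invr_ge0// ltr_pXn2r ?nnegrE ?sqrtr_ge0//.
    by case: (w - z) => a b; exact: sqrtr_ge0.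
  have [w hw] := choice wex.
  have sw n : spectrum A (w n) by case: (hw n).
  have wr n := spectrum_real bA sA (sw n).
  have wz n : complex.Re (w n) != complex.Re z.
    apply/eqP => e; case: (hw n) => _ _ /eqP; apply.
    by rewrite wr e -zr.
  have wzE n : normc (w n - z) ^+ 2 = (complex.Re (w n) - complex.Re z) ^+ 2.
    rewrite -/(sqn _) sqnE !cE wr zr !cE; ring.
  (* The quarter makes [2 cc n + 2 |w n - z|^2] at most [1 / (n+1)]; the factor [(w n - z)^2] in
     [cc] is the relative accuracy required by [almost_orthogonal]. *)
  pose ee n : R := n.+1%:R^-1 / 4.
  pose cc n := (complex.Re (w n) - complex.Re z) ^+ 2 * (ee n) ^+ 2.
  have ee0 n : 0 < ee n by rewrite divr_gt0.
  have cc0 n : 0 < cc n.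
    apply: mulr_gt0; last exact: exprn_gt0.
    by rewrite exprn_even_gt0//= subr_eq0 wz.
  have [f [lf Nf hf]] := unit_sequence bA sA sw cc0.
  have ee1 n : ee n <= 1 / 4.
    by rewrite ler_pM2r ?invr_gt0// invf_le1 ?ltr0n// ler1n.
  have hT n : sqnorm (shiftop A z (f n)) <= n.+1%:R^-1.
    have -> : shiftop A z (f n) =
        (fun x => shiftop A (w n) (f n) x + (w n - z) * f n x).
      by apply/funext => x; rewrite /shiftop; ring.
    apply: (le_trans (sqnorm_D (bop_l2 (bop_shift _ bA) (lf n)) (l2Z _ (lf n)))).
    rewrite sqnorm_Z// Nf mulr1 /sqn.
    have h1 := hf n; case: (hw n) => _ h2 _; rewrite -/(ee n) in h2.
    have h3 : cc n <= ee n.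
      rewrite /cc -wzE; have := ee1 n; have := ee0 n; move: h2.
      set a := normc _ ^+ 2; have : 0 <= a by exact: sqr_ge0.
      move=> a0 a1 a2 a3; apply: le_trans (_ : a * 1 <= _).
        by rewrite ler_wpM2l// expr_le1//; lra.
      by rewrite mulr1 ltW.
    have -> : n.+1%:R^-1 = 2 * ee n + 2 * ee n by rewrite /ee; field.
    by rewrite lerD// ler_pM2l//; [exact: le_trans h1 h3|exact: ltW].
  have [g [lg Tg hg]] := fredholm_compact bT c0 hc lf Nf hT.
  have [n _ hn] := hg (1 / 4) 0%N (divr_gt0 ltr01 (ltr0n _ 4)).
  have hd : 2 * `|dot (f n) g| <= ee n * (1 + sqnorm g).
    have Tg' : shiftop A (complex.Re z)%:C g = (fun=> 0) by rewrite -zr.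
    apply: (almost_orthogonal bA sA (lf n) lg Tg' (wz n) (ee0 n)).
    by rewrite -wr; exact: hf.
  rewrite sqnorm_subE// Nf in hn; have h1 := ler_norm (dot (f n) g); have Ng := sqnorm_ge0 g.
  have h2 : ee n * (1 + sqnorm g) <= 1 / 4 * (1 + sqnorm g) by rewrite ler_wpM2r// addr_ge0.
  lra.
- have [f [lf Nf hf]] := unit_sequence bA sA (fun _ => sz) inv0.
  have [g [lg Tg hg]] := fredholm_compact bT c0 hc lf Nf hf.
  exists g.
    split => //; apply/funext => x; apply/eqP; rewrite -subr_eq0; apply/eqP.
    exact: (congr1 (fun f => f x) Tg).
  apply: contrapT => H; have g0 : g = (fun=> 0).
    by apply/funext => x; apply: contrapT => /eqP gx; apply: H; exists x.
  have [n _] := hg (1 / 4) 0%N (divr_gt0 ltr01 (ltr0n _ 4)).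
  rewrite g0; under eq_fun do rewrite subr0.
  by rewrite Nf; lra.
(* An eigenvector vanishing on [s] is zero by [hc], so restriction to [s] embeds the eigenspace into
   the rows of length [m]. A family of eigenvectors with a maximal number of independent
   restrictions therefore spans it. *)
pose m := size s.
pose K u := eigenvector A z u.
have Kz u : K u -> (forall i : 'I_m, u (tnth (in_tuple s) i) = 0) -> u = (fun=> 0).
  move=> [lu Au] us; apply: sqnorm_eq0 => //.
  rewrite -(ler_pM2l c0) mulr0; apply: le_trans (hc u lu _) _.
    by move=> x /seq_tnthP[i ->]; exact: us.
  rewrite (_ : shiftop A z u = (fun=> 0)) ?sqnorm_0//.
  by apply/funext => x; rewrite /shiftop Au subrr.
pose Q n := `[< exists e : 'I_n -> X -> R[i], (forall i, K (e i)) /\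
   row_free (\matrix_(i < n, j < m) e i (tnth (in_tuple s) j)) >].
have Q0 : exists n, Q n.
  exists 0%N; apply/asboolP; exists (fun _ _ => 0); split; first by case.
  by rewrite /row_free -leqn0 rank_leq_row.
have Qm n : Q n -> (n <= m)%N.
  by move=> /asboolP[e [_ /eqP <-]]; exact: rank_leq_col.
case: (ex_maxnP Q0 Qm) => n /asboolP[e [he free]] nmax.
exists n, e => u Ku.
pose E := \matrix_(i < n, j < m) e i (tnth (in_tuple s) j).
pose ru := \row_(j < m) u (tnth (in_tuple s) j).
have hsub : (ru <= E)%MS.
  apply: contrapT => /negP nsub.
  have : Q (1 + n)%N.
    pose e' (i : 'I_(1 + n)) := match fintype.split i with inl _ => u | inr k => e k end.
    apply/asboolP; exists e'.
    split; first by move=> i; rewrite /e'; case: (fintype.split i) => // _; exact: Ku.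
    have -> : \matrix_(i < 1 + n, j < m) e' i (tnth (in_tuple s) j) = col_mx ru E.
      apply/matrixP => i j; rewrite mxE [RHS]mxE /e'.
      by case: (fintype.split i) => k; rewrite mxE.
    have /ltn_leqif := mxrank_leqif_sup (addsmxSr ru E).
    rewrite addsmx_sub submx_refl andbT nsub (eqP free) addsmxE => hr.
    by rewrite /row_free eqn_leq rank_leq_row.
  by move/nmax; rewrite ltnn.
have [a ha] := submxP hsub.
exists (fun i => a 0 i).
have lu : l2 u by case: Ku.
have le i : l2 (e i) by case: (he i).
pose v x := u x - \sum_(k < n) a 0 k * e k x.
have lv : l2 v by apply: l2B => //; apply: l2_sum => k; auto.
suff : v = (fun=> 0).
  move=> v0; apply/funext => x; apply/eqP; rewrite -subr_eq0; apply/eqP.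
  exact: (congr1 (fun f => f x) v0).
apply: Kz.
  split => //; rewrite /v bopB//; last by apply: l2_sum => k; auto.
  rewrite bop_sum//; apply/funext => x; case: Ku => _ ->.
  rewrite mulrBr mulr_sumr; congr (_ - _); apply: eq_bigr => k _.
  by case: (he k) => _ ->; rewrite mulrCA.
move=> i; have /rowP/(_ i) := ha; rewrite !mxE => hi.
rewrite /v hi -sumrB big1// => k _; by rewrite mxE subrr.
Qed.

End Persson.

(** * Matrices of finite range *)

Section FiniteSums.
Variables (R : realType) (X : choiceType).

Lemma esum_seq (f : X -> R) (s : seq X) : uniq s -> (forall x, 0 <= f x) ->
  (forall x, x \notin s -> f x = 0) ->
  fine (\esum_(x in [set: X]) (f x)%:E)%E = \sum_(x <- s) f x.
Proof.
move=> us f0 fs.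
have -> : (\esum_(x in [set: X]) (f x)%:E = \esum_(x in [set` s]) (f x)%:E)%E.
  rewrite [RHS]esum_mkcond; apply: eq_esum => x _.
  case: ifPn => // /negP xs; rewrite fs//; apply/negP => xs'; apply: xs.
  by rewrite inE.
rewrite esum_fset; [|exact: finite_seq|by move=> x _; rewrite lee_fin].
by rewrite -fsbig_seq// sumEFin.
Qed.

Lemma rsum_seq (f : X -> R) (s : seq X) : uniq s ->
  (forall x, x \notin s -> f x = 0) -> rsum f = \sum_(x <- s) f x.
Proof.
move=> us fs; rewrite /rsum.
rewrite (@esum_seq (fun x => Num.max (f x) 0) s)//; last 2 first.
- by move=> x; rewrite le_max lexx orbT.
- by move=> x /fs ->; rewrite maxxx.
rewrite (@esum_seq (fun x => Num.max (- f x) 0) s)//; last 2 first.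
- by move=> x; rewrite le_max lexx orbT.
- by move=> x /fs ->; rewrite oppr0 maxxx.
rewrite -sumrB; apply: eq_bigr => x _.
by case: (lerP 0 (f x)) => h; rewrite /Num.max; case: ltP; case: ltP; lra.
Qed.

Lemma csum_seq (f : X -> R[i]) (s : seq X) : uniq s ->
  (forall x, x \notin s -> f x = 0) -> csum f = \sum_(x <- s) f x.
Proof.
move=> us fs; apply: eq_complexP; rewrite /csum /= ?Re_sum ?Im_sum.
  by rewrite (rsum_seq us)// => x /fs ->.
by rewrite (rsum_seq us)// => x /fs ->.
Qed.

End FiniteSums.

(** Two steps multiply [S] by at least [1 + k], so a positive value would grow exponentially. The
    cubic bound is the square of linear growth summed over an interval. *)
Lemma poly_growth (R : realType) (S : nat -> R) (k C : R) : 0 < k ->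
  (forall m, S m <= S m.+1) ->
  (forall m, k * S m.+1 <= S m.+2 - S m) ->
  (forall m, S m <= C * m.+1%:R ^+ 3) -> forall m, S m <= 0.
Proof.
move=> k0 mono rec bound m; rewrite leNgt; apply/negP => Sm0.
(* Here 15 = 4 + 6 + 4 + 1 sums the nonconstant coefficients of [(1 + h)^4], so this power is at
   most [1 + 15 h <= 1 + k]; the fourth power is what beats the cubic bound. *)
pose h : R := Num.min 1 k / 15.
have h0 : 0 < h by rewrite divr_gt0// lt_min ltr01.
have h1 : h <= 1 / 15 by rewrite ler_pM2r ?invr_gt0// ge_min lexx.
have hk : 15 * h <= k by rewrite mulrC divfK// ge_min lexx orbT.
clearbody h; have h0' := ltW h0; have k0' := ltW k0.
have h4 : (1 + h) ^+ 4 <= 1 + k.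
  apply: le_trans (_ : 1 + 15 * h <= _); last by rewrite lerD2l.
  have h2 : h ^+ 2 <= h by nra.
  have h3 : h ^+ 3 <= h by rewrite exprS; nra.
  have h5 : h ^+ 4 <= h by rewrite exprS; nra.
  have -> : (1 + h) ^+ 4 = 1 + 4 * h + 6 * h ^+ 2 + 4 * h ^+ 3 + h ^+ 4 by ring.
  lra.
have bern i : 1 + i%:R * h <= (1 + h) ^+ i.
  elim: i => [|i IH]; first by rewrite expr0 mul0r addr0.
  rewrite exprS; apply: le_trans (_ : (1 + h) * (1 + i%:R * h) <= _); last first.
    by rewrite ler_pM2l// addr_gt0.
  rewrite -natr1; have : 0 <= i%:R * h ^+ 2 by rewrite mulr_ge0// sqr_ge0.
  nra.
have Si i : (1 + k) ^+ i * S m <= S (m + i.*2)%N.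
  elim: i => [|i IH]; first by rewrite expr0 mul1r double0 addn0.
  rewrite exprS -mulrA doubleS !addnS.
  apply: le_trans (_ : (1 + k) * S (m + i.*2)%N <= _).
    by rewrite ler_pM2l// addr_gt0.
  have := rec (m + i.*2)%N; have := mono (m + i.*2)%N.
  move=> a b; have : k * S (m + i.*2)%N <= k * S (m + i.*2).+1 by rewrite ler_pM2l.
  lra.
have C0 : 0 <= C.
  have := bound m; rewrite leNgt => /negP b; rewrite leNgt; apply/negP => C0; apply: b.
  by apply: lt_trans Sm0; rewrite nmulr_rlt0// exprn_gt0.
(* Compare [(j h)^4 S m] with the cubic bound at [m + 2 j], where [m + 2 j + 1 <= j (m + 3)], and
   cancel [j^3]; the left side stays unbounded in [j]. *)
have key j : (0 < j)%N -> j%:R * (h ^+ 4 * S m) <= C * (m + 3)%:R ^+ 3.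
  move=> j0; have jR : 0 < j%:R :> R by rewrite ltr0n.
  rewrite -(ler_pM2l (exprn_gt0 3 jR)).
  apply: le_trans (_ : (1 + k) ^+ j * S m <= _).
    rewrite [leLHS](_ : _ = (j%:R * h) ^+ 4 * S m); last by ring.
    rewrite ler_pM2r//; apply: le_trans (_ : ((1 + h) ^+ j) ^+ 4 <= _).
      rewrite lerXn2r ?nnegrE ?mulr_ge0 ?exprn_ge0 ?addr_ge0 ?ler0n//.
      by apply: le_trans (bern j); rewrite lerDr.
    rewrite -exprM mulnC exprM lerXn2r ?nnegrE ?exprn_ge0 ?addr_ge0//.
  apply: le_trans (Si j) _; apply: le_trans (bound _) _.
  rewrite [leRHS]mulrCA -exprMn -natrM ler_wpM2l// lerXn2r ?nnegrE ?ler0n// ler_nat.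
  by rewrite -(addSnnS m 2) mulnDr muln2 -addSn leq_add2r leq_pmull.
have p0 : 0 < h ^+ 4 * S m by rewrite mulr_gt0// exprn_gt0.
have := truncnS_gt (C * (m + 3)%:R ^+ 3 / (h ^+ 4 * S m)).
by rewrite ltr_pdivrMr// ltNge key.
Qed.

Section Band.
Variables (R : realType) (X : choiceType) (nb : X -> seq X) (D : nat).
Hypotheses (nb_uniq : forall x, uniq (nb x)) (nb_size : forall x, (size (nb x) <= D)%N)
  (nb_sym : forall x y, (y \in nb x) = (x \in nb y)).
Implicit Types (u v w psi phi : X -> R[i]) (M : X -> X -> R[i]).

(** Double counting: by symmetry of [nb] every [y] occurs in at most [D] of the inner sums. *)
Lemma nbsum_le psi phi (c : R) : l2 psi -> 0 <= c ->
  (forall x, sqn (phi x) <= c * \sum_(y <- nb x) sqn (psi y)) ->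
  l2 phi /\ sqnorm phi <= c * D%:R * sqnorm psi.
Proof.
move=> hpsi c0 h; apply: l2_bound => s us.
apply: le_trans (_ : \sum_(x <- s) c * \sum_(y <- nb x) sqn (psi y) <= _).
  exact: ler_sum.
rewrite -mulr_sumr -mulrA ler_wpM2l//.
pose t := undup (flatten [seq nb x | x <- s]).
have -> : \sum_(x <- s) \sum_(y <- nb x) sqn (psi y) =
    \sum_(x <- s) \sum_(y <- t | y \in nb x) sqn (psi y).
  apply: eq_big_seq => x xs; rewrite -[RHS]big_filter; apply: perm_big.
  apply: uniq_perm; rewrite ?filter_uniq ?undup_uniq// => y.
  rewrite mem_filter mem_undup; case: (boolP (y \in nb x)) => //= yx.
  by apply/esym/flatten_mapP; exists x.
rewrite (exchange_big_dep xpredT)//=.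
apply: le_trans (_ : \sum_(y <- t) D%:R * sqn (psi y) <= _); last first.
  by rewrite -mulr_sumr ler_wpM2l// sqnorm_seq// undup_uniq.
apply: ler_sum => y _; rewrite -big_filter.
apply: le_trans (_ : \sum_(x <- nb y) sqn (psi y) <= _).
  apply: sum_sub_le; rewrite ?filter_uniq//; first by move=> _; exact: sqn_ge0.
  by move=> x; rewrite mem_filter nb_sym => /andP[].
rewrite big_const_seq count_predT iter_addr_0 mulr_natl.
by rewrite -[leLHS]mulr_natl -[leRHS]mulr_natl ler_wpM2r ?sqn_ge0// ler_nat.
Qed.

(** A common frame for the tree operator and for Jacobi matrices on [nat] and [int]. *)
Definition banded M (K : R) : Prop :=
  [/\ forall x y, y \notin nb x -> M x y = 0, forall x y, M y x = conjc (M x y) &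
      forall x y, sqn (M x y) <= K].

Lemma mopE M K psi x : banded M K ->
  matrix_operator M psi x = \sum_(y <- nb x) M x y * psi y.
Proof.
case=> h _ _; rewrite /matrix_operator (csum_seq (nb_uniq x))// => y /h ->.
by rewrite mul0r.
Qed.

Lemma band_sqn M K psi x : banded M K -> sqn (\sum_(y <- nb x) M x y * psi y) <=
  D%:R * K * \sum_(y <- nb x) sqn (psi y).
Proof.
case=> _ _ h; apply: le_trans (sqn_sum _ _) _.
have K0 : 0 <= K by apply: le_trans (h x x); exact: sqn_ge0.
rewrite -mulrA; apply: ler_pM; rewrite ?ler_nat//.
  by apply: sumr_ge0 => y _; exact: sqn_ge0.
rewrite mulr_sumr; apply: ler_sum => y _.
by rewrite sqnM ler_wpM2r ?sqn_ge0.
Qed.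

Lemma band_bop M K : banded M K -> bounded_operator (matrix_operator M).
Proof.
(* For empty [X] the hypotheses do not exclude a negative [K]. *)
move=> hM; pose K' := Num.max K 0.
have K0 : 0 <= K' by rewrite le_max lexx orbT.
have hM' : banded M K'.
  by case: hM => a b c; split => // x y; rewrite le_max c.
apply: (@bop_intro _ _ _ (D%:R * K' * D%:R)); first by rewrite !mulr_ge0.
  move=> c u v; apply/funext => x; rewrite !(mopE _ _ hM) mulr_sumr -big_split /=.
  by apply: eq_bigr => y _; ring.
move=> u hu; apply: nbsum_le => //; first by rewrite mulr_ge0.
by move=> x; rewrite (mopE _ _ hM); exact: band_sqn.
Qed.

Lemma dot_seq u v (s : seq X) : l2 u -> uniq s -> (forall x, x \notin s -> v x = 0) ->
  dot u v = \sum_(x <- s) complex.Re (u x * conjc (v x)).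
Proof.
move=> hu us vs; have [lv _] := fs_bound us vs.
have lc := l2_cut s u.
have cs x : x \notin s -> cut s u x = 0 by rewrite /cut => /negbTE ->.
have E : sqnorm (fun x => u x + v x) - sqnorm (fun x => u x - v x) =
    sqnorm (fun x => cut s u x + v x) - sqnorm (fun x => cut s u x - v x).
  have := @sqnorm_comb0 _ _ [:: (1, fun x => u x + v x); (-1, fun x => u x - v x);
    (-1, fun x => cut s u x + v x); (1, fun x => cut s u x - v x)].
  rewrite !big_cons !big_nil /= => h.
  suff : 1 * sqnorm (fun x => u x + v x) + (-1 * sqnorm (fun x => u x - v x) +
    (-1 * sqnorm (fun x => cut s u x + v x) + (1 * sqnorm (fun x => cut s u x - v x) + 0))) = 0.
    lra.
  apply: h => [|x]; first by do !split; auto.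
  rewrite !big_cons !big_nil /= /cut; case: ifPn => xs; first by ring.
  by rewrite vs// !subr0 !addr0 sqn0; ring.
have [_ N1] : l2 (fun x => cut s u x + v x) /\ sqnorm (fun x => cut s u x + v x) =
    \sum_(x <- s) sqn (cut s u x + v x).
  by apply: fs_bound => // x xs; rewrite cs// vs// addr0.
have [_ N2] : l2 (fun x => cut s u x - v x) /\ sqnorm (fun x => cut s u x - v x) =
    \sum_(x <- s) sqn (cut s u x - v x).
  by apply: fs_bound => // x xs; rewrite cs// vs// subr0.
rewrite /dot E N1 N2 -sumrB mulr_suml; apply: eq_big_seq => x xs.
by rewrite /cut xs !sqnE !cE; field.
Qed.

Lemma small_dot u v (t K : R) : 0 < t -> l2 u -> l2 v -> sqnorm u <= t ^+ 2 * K ->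
  sqnorm v <= K -> `|dot u v| <= t * K.
Proof.
move=> t0 hu hv Nu Nv.
have it0 : 0 < t^-1 by rewrite invr_gt0.
have := dot_le it0 hu hv; rewrite invrK => h.
have h1 : t^-1 * sqnorm u <= t * K.
  by rewrite mulrC ler_pdivrMr// mulrAC -expr2.
have h2 : t * sqnorm v <= t * K by rewrite ler_pM2l.
lra.
Qed.

Lemma norm4_le (x1 x2 x3 x4 y : R) : `|x1| <= y -> `|x2| <= y -> `|x3| <= y ->
  `|x4| <= y -> `|x1 + x2 - x3 - x4| <= 4 * y.
Proof. by rewrite !ler_norml; lra. Qed.

(** On truncated vectors this is an exchange of finite sums using the Hermitian entries; boundedness
    extends it to all of l2. *)
Lemma band_sym M K : banded M K -> symmetric_op (matrix_operator M).
Proof.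
move=> hM; have bA := band_bop hM; set A := matrix_operator M in bA *.
have [m m0 hm] := bop_bound bA.
have fs (s : seq X) u v : dot (A (cut s u)) (cut s v) = dot (cut s u) (A (cut s v)).
  have lu := l2_cut s u; have lv := l2_cut s v.
  have cs w x : x \notin undup s -> cut s w x = 0.
    by rewrite mem_undup /cut => /negbTE ->.
  have AE w x : A (cut s w) x = \sum_(y <- undup s) M x y * cut s w y.
    rewrite /A /matrix_operator (csum_seq (undup_uniq s))// => y /cs ->.
    by rewrite mulr0.
  rewrite [RHS]dotC; auto.
  rewrite !(dot_seq _ (undup_uniq s)); auto.
  under eq_bigr do rewrite AE mulr_suml Re_sum.
  under [RHS]eq_bigr do rewrite AE mulr_suml Re_sum.
  rewrite exchange_big /=; apply: eq_bigr => x _; apply: eq_bigr => y _.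
  by case: hM => _ hc _; rewrite (hc x y) !cE; ring.
move=> u v hu hv.
pose K' := (1 + m) * (sqnorm u + sqnorm v + 1).
have [[Nu Nv] m0'] := (sqnorm_ge0 u, sqnorm_ge0 v, ltW m0).
have K0 : 0 < K'.
  by apply: mulr_gt0; [exact: addr_gt0|rewrite ltr_wpDl// addr_ge0].
have mNu : 0 <= m * sqnorm u by exact: mulr_ge0.
have mNv : 0 <= m * sqnorm v by exact: mulr_ge0.
have KE : K' = sqnorm u + sqnorm v + 1 + m * sqnorm u + m * sqnorm v + m by rewrite /K'; ring.
clearbody K'.
apply: subr0_eq; apply: normr0_eq0; apply: le_anti; rewrite normr_ge0 andbT.
apply/ler_addgt0Pr => e e0; rewrite add0r.
pose t := e / (4 * K').
have t0 : 0 < t by rewrite divr_gt0// mulr_gt0.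
have t20 : 0 < t ^+ 2 by rewrite exprn_gt0.
have [s1 h1] := cut_approx hu t20; have [s2 h2] := cut_approx hv t20.
pose s := s1 ++ s2.
have {}h1 : sqnorm (fun x => u x - cut s u x) <= t ^+ 2.
  by apply: h1 => x; rewrite mem_cat => ->.
have {}h2 : sqnorm (fun x => v x - cut s v x) <= t ^+ 2.
  by apply: h2 => x; rewrite mem_cat orbC => ->.
have lu := l2_cut s u; have lv := l2_cut s v.
have Ncut w : l2 w -> sqnorm (cut s w) <= sqnorm w.
  move=> hw; have [|_] := @l2_le _ _ w (cut s w) 1 hw ler01.
    by move=> x; rewrite mul1r /cut; case: ifP => // _; rewrite sqn0 sqn_ge0.
  by rewrite mul1r.
(* Since the truncations satisfy the symmetry exactly, each remaining term contains a truncation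
   error and is at most [t K' = e / 4]. *)
have E : dot (A u) v - dot u (A v) =
    dot (A (fun x => u x - cut s u x)) v + dot (fun x => v x - cut s v x) (A (cut s u))
    - dot (fun x => u x - cut s u x) (A v) - dot (A (fun x => v x - cut s v x)) (cut s u).
  rewrite !bopB// !dotBl; auto.
  rewrite [dot v (A (cut s u))]dotC; auto; rewrite [dot (cut s v) _]dotC; auto.
  rewrite fs [dot (A v) (cut s u)]dotC; auto.
  rewrite [dot (A (cut s v)) _]dotC; auto.
  ring.
have tm w : sqnorm w <= t ^+ 2 -> sqnorm w <= t ^+ 2 * K'.
  by move=> h; apply: le_trans h _; rewrite ler_peMr ?ltW//; lra.
have tA w : l2 w -> sqnorm w <= t ^+ 2 -> sqnorm (A w) <= t ^+ 2 * K'.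
  move=> hw h; apply: le_trans (hm _ hw) _; rewrite mulrC.
  by apply: ler_pM => //; [exact: sqnorm_ge0|lra].
have hK w : l2 w -> sqnorm w <= sqnorm u + sqnorm v -> sqnorm (A w) <= K'.
  move=> hw h; apply: le_trans (hm _ hw) _.
  have : m * sqnorm w <= m * (sqnorm u + sqnorm v) by rewrite ler_pM2l.
  lra.
have a1 : `|dot (A (fun x => u x - cut s u x)) v| <= t * K'.
  by apply: small_dot => //; auto; lra.
have a2 : `|dot (fun x => v x - cut s v x) (A (cut s u))| <= t * K'.
  apply: small_dot => //; auto; apply: hK => //.
  by apply: le_trans (Ncut _ hu) _; rewrite lerDl.
have a3 : `|dot (fun x => u x - cut s u x) (A v)| <= t * K'.
  by apply: small_dot => //; auto; apply: hK => //; rewrite lerDr.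
have a4 : `|dot (A (fun x => v x - cut s v x)) (cut s u)| <= t * K'.
  apply: small_dot => //; auto.
  by apply: le_trans (Ncut _ hu) _; lra.
have te : 4 * (t * K') = e by rewrite /t; field; rewrite gt_eqF.
rewrite E -te; exact: norm4_le.
Qed.

(* Truncating u at radius m leaves a residual carried by the spheres m and m+1, so
   a lower bound for M - z would force exponential growth of u. *)
Lemma band_growth M K (z : R[i]) u (rho : X -> nat) (C : R) (x0 : X) : banded M K ->
  (forall x y, y \in nb x -> (rho y <= (rho x).+1)%N) ->
  (forall x, \sum_(y <- nb x) M x y * u y = z * u x) ->
  (forall m : nat, l2 (fun x => if (rho x <= m)%N then u x else 0) /\
    sqnorm (fun x => if (rho x <= m)%N then u x else 0) <= C * m.+1%:R ^+ 3) ->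
  u x0 != 0 -> ~ bdd_below (shiftop (matrix_operator M) z).
Proof.
move=> hM rho1 hu hC ux0 [c c0 hc].
have bA := band_bop hM; set A := matrix_operator M in bA hc *.
pose g (m : nat) x := if (rho x <= m)%N then u x else 0.
pose K' := Num.max K 1.
have K0 : 0 < K' by rewrite lt_max ltr01 orbT.
have hM' : banded M K' by case: hM => a b d; split => // x y; rewrite le_max d.
pose k := c / (D%:R * K' * D%:R + 1).
have DK0 : 0 <= D%:R * K' by rewrite mulr_ge0// ltW.
have DK : 0 < D%:R * K' * D%:R + 1 by rewrite ltr_wpDl// mulr_ge0.
have k0 : 0 < k by rewrite divr_gt0.
have lg m : l2 (g m) by case: (hC m).
have mono m : sqnorm (g m) <= sqnorm (g m.+1).
  have hle x : sqn (g m x) <= 1 * sqn (g m.+1 x).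
    rewrite mul1r /g; case: (leqP (rho x) m) => [h|_]; first by rewrite (leq_trans h).
    by rewrite sqn0 sqn_ge0.
  by have [_] := l2_le (lg m.+1) ler01 hle; rewrite mul1r.
have rec m : k * sqnorm (g m.+1) <= sqnorm (g m.+2) - sqnorm (g m).
  (* Inside the ball of radius [m + 1] the residual comes from values cut off on sphere [m + 2],
     outside from values kept on sphere [m + 1]. [v] carries both, and its squared norm is the
     increment of [S] over two steps. *)
  pose v x := if (m < rho x)%N then g m.+2 x else 0.
  have hle x : sqn (v x) <= 1 * sqn (g m.+2 x).
    by rewrite mul1r /v; case: ifP => // _; rewrite sqn0 sqn_ge0.
  have [lv _] := l2_le (lg m.+2) ler01 hle.
  have -> : sqnorm (g m.+2) - sqnorm (g m) = sqnorm v.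
    have := @sqnorm_comb0 _ _ [:: (1, g m.+2); (-1, g m); (-1, v)].
    rewrite !big_cons !big_nil /= => h.
    suff : 1 * sqnorm (g m.+2) + (-1 * sqnorm (g m) + (-1 * sqnorm v + 0)) = 0 by lra.
    apply: h => // x; rewrite !big_cons !big_nil /= /v /g.
    case: (leqP (rho x) m) => h; last by rewrite sqn0; ring.
    by rewrite (leq_trans h) ?leqW// sqn0; ring.
  have res x : sqn (shiftop A z (g m.+1) x) <= D%:R * K' * \sum_(y <- nb x) sqn (v y).
    rewrite /shiftop /A (mopE _ _ hM'); case: (leqP (rho x) m.+1) => hx.
      have -> : \sum_(y <- nb x) M x y * g m.+1 y - z * g m.+1 x =
          - \sum_(y <- nb x) M x y * (u y - g m.+1 y).
        rewrite /g hx -hu -sumrB -sumrN; apply: eq_bigr => y _; ring.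
      rewrite sqnN; apply: le_trans (band_sqn _ _ hM') _; rewrite ler_wpM2l//.
      rewrite big_seq [leRHS]big_seq; apply: ler_sum => y /rho1 yx.
      rewrite /v /g; case: (leqP (rho y) m.+1) => hy.
        by rewrite subrr sqn0 sqn_ge0.
      by rewrite (leq_trans yx)// (ltnW hy) subr0.
    rewrite {2}/g leqNgt hx /= mulr0 subr0.
    apply: le_trans (band_sqn _ _ hM') _; rewrite ler_wpM2l//.
    rewrite big_seq [leRHS]big_seq; apply: ler_sum => y; rewrite nb_sym => /rho1 xy.
    rewrite /v /g; case: (leqP (rho y) m.+1) => hy; last by rewrite sqn0 sqn_ge0.
    by rewrite -ltnS (leq_trans hx xy) (leq_trans hy).
  have [lr Nr] := nbsum_le lv DK0 res.
  rewrite /k mulrAC ler_pdivrMr// mulrC [leRHS]mulrC.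
  rewrite mulrC; apply: le_trans (hc _ (lg _)) _; apply: le_trans Nr _.
  by rewrite ler_wpM2r ?sqnorm_ge0// lerDl.
have := poly_growth k0 mono rec (fun m => (hC m).2) (rho x0).
by apply/negP; rewrite -ltNge; apply: (@sqnorm_gt0 _ _ _ x0) => //; rewrite /g leqnn.
Qed.

End Band.

(** * Regular trees *)

Section TreeLevels.
Variables (V : choiceType) (adj : rel V) (d : nat).
Hypothesis htree : regular_tree adj d.
Variable v0 : V.

Let adjC : symmetric adj. Proof. by case: htree. Qed.
Let adjxx : irreflexive adj. Proof. by case: htree. Qed.

Definition lev (v : V) : nat := gdist adj v v0.

(** Connectedness rules out the case in which [gdist] takes its default value. *)
Lemma levP v : (exists2 p, walk adj v p v0 & size p = lev v) /\
  (forall p, walk adj v p v0 -> (lev v <= size p)%N).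
Proof.
rewrite /lev /gdist; case: xgetP => [n _ //|H].
have [_ _ hw _ _] := htree.
pose P n := `[< exists2 p, walk adj v p v0 & size p = n >].
have exP : exists n, P n by have [p hp] := hw v v0; exists (size p); apply/asboolP; exists p.
case: (ex_minnP exP) => n /asboolP hn hmin.
by case: (H n); split => // p hp; apply: hmin; apply/asboolP; exists p.
Qed.

Lemma lev_walk v p : walk adj v p v0 -> (lev v <= size p)%N.
Proof. exact: (levP v).2. Qed.

Lemma lev_root : lev v0 = 0%N.
Proof. by apply/eqP; rewrite -leqn0; apply: (@lev_walk v0 [::]). Qed.

Lemma lev_adj u v : adj u v -> (lev u <= (lev v).+1)%N.
Proof.
move=> uv; have [[p [hp hl] <-] _] := levP v.
by apply: (@lev_walk u (v :: p)); split => //=; rewrite uv.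
Qed.

Lemma lev_prev v : v != v0 -> exists2 u, adj v u & (lev u).+1 = lev v.
Proof.
move=> vv0; have [[[|u p] [/= hp hl] hs] _] := levP v.
  by rewrite hl eqxx in vv0.
case/andP: hp => vu hp; exists u => //; apply/eqP; rewrite eqn_leq lev_adj//.
by rewrite -hs ltnS (@lev_walk u p)// andbT.
Qed.

Lemma geodesic_lev u p w : walk adj u p v0 -> size p = lev u -> w \in p ->
  (lev w < lev u)%N.
Proof.
move=> [hp hl] hs hw; case/splitPr: hw hp hl hs => p1 p2.
rewrite cat_path last_cat /= => /and3P[_ _ hp2] hl; rewrite size_cat /= => <-.
by apply: (@leq_ltn_trans (size p2)); [exact: lev_walk|rewrite addnS ltnS leq_addl].
Qed.

(* Two such neighbours, joined by their geodesics to the root, would close a cycle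
   through v. *)
Lemma lower_neighbor_unique v u1 u2 : adj v u1 -> adj v u2 ->
  (lev u1 <= lev v)%N -> (lev u2 <= lev v)%N -> u1 = u2.
Proof.
move=> vu1 vu2 l1 l2; apply/eqP/negPn/negP => u12.
have avoid u : adj v u -> (lev u <= lev v)%N ->
    exists p, walk adj u p v0 /\ v \notin u :: p.
  move=> vu lu; have [[p hp hs] _] := levP u; exists p; split => //.
  rewrite inE negb_or; apply/andP; split.
    by apply/eqP => e; rewrite e adjxx in vu.
  by apply/negP => /(geodesic_lev hp hs); rewrite ltnNge lu.
have [p1 [[hp1 hl1] hv1]] := avoid _ vu1 l1.
have [p2 [[hp2 hl2] hv2]] := avoid _ vu2 l2.
pose q := p1 ++ rev (belast u2 p2).
have hq : path adj u1 q.
  rewrite cat_path hp1 hl1 -hl2 rev_path.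
  by apply: sub_path hp2 => x y; rewrite adjC.
have hlq : last u1 q = u2.
  rewrite last_cat hl1; case: (p2) hl2 => [|x p] //= hl.
  by rewrite rev_cons last_rcons.
have hvq : v \notin u1 :: q.
  rewrite inE mem_cat mem_rev negb_or.
  move: hv1; rewrite inE negb_or => /andP[-> h1] /=.
  rewrite negb_or h1 /=; apply: contra hv2 => /mem_belast //.
case: (shortenP hq) hlq hvq => q' hq' uq' sub hlast hvq.
have [_ _ _ acyclic _] := htree.
apply: (acyclic (v :: u1 :: q')).
  by case: (q') hlast => [|//] /= e; rewrite e eqxx in u12.
apply/andP; split.
  by rewrite (cycle_path v) /= hlast adjC vu2 vu1.
rewrite cons_uniq uq' andbT; apply: contra hvq.
by rewrite !inE => /predU1P[->|/sub ->]; rewrite ?eqxx ?orbT.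
Qed.

Definition nb (v : V) : seq V := finmap.enum_fset (fset_set [set u | adj v u]).

Lemma nb_fin v : finite_set [set u | adj v u].
Proof. by case: htree => _ _ _ _ h; apply/finite_setP; exists d. Qed.

Lemma mem_nb v u : (u \in nb v) = adj v u.
Proof. by rewrite /nb (in_fset_set (nb_fin v)); apply/idP/idP; rewrite inE. Qed.

Lemma nb_uniq v : uniq (nb v). Proof. exact: finmap.fset_uniq. Qed.

Lemma size_nb v : size (nb v) = d.
Proof. by case: htree => _ _ _ _ h; apply: card_fset_set. Qed.

Definition ch (v : V) : seq V := [seq u <- nb v | (lev v < lev u)%N].

Lemma mem_ch v c : (c \in ch v) = adj v c && (lev c == (lev v).+1).
Proof.
rewrite mem_filter mem_nb andbC; case: (boolP (adj v c)) => //= vc.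
by rewrite eqn_leq lev_adj// adjC.
Qed.

Lemma ch_uniq v : uniq (ch v). Proof. exact/filter_uniq/nb_uniq. Qed.

Lemma ch_lev v c : c \in ch v -> lev c = (lev v).+1.
Proof. by rewrite mem_ch => /andP[_ /eqP]. Qed.

Lemma ch_root : ch v0 = nb v0.
Proof.
apply/all_filterP/allP => u; rewrite mem_nb lev_root lt0n => vu.
apply/eqP => u0; have [[[|? ?] [_ hl] hs] _] := levP u; last by rewrite u0 in hs.
by rewrite -hl /= adjxx in vu.
Qed.

(** The list has exactly one element unless [v] is the root, where the default [v] is returned. *)
Definition par (v : V) : V := head v [seq u <- nb v | (lev u < lev v)%N].

Lemma nb_par v : v != v0 -> perm_eq (nb v) (par v :: ch v).
Proof.
move=> vv0; have [u vu lu] := lev_prev vv0.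
have E : [seq u <- nb v | (lev u < lev v)%N] = [:: u].
  apply/perm_small_eq => //; apply: uniq_perm; rewrite ?filter_uniq ?nb_uniq//.
  move=> w; rewrite mem_filter mem_nb inE; apply/andP/eqP => [[lw vw]|->].
    by apply: (lower_neighbor_unique vw vu); [exact: ltnW|rewrite -lu].
  by rewrite -lu ltnSn.
rewrite /par E /=; apply: uniq_perm; rewrite ?nb_uniq//=.
  by rewrite ch_uniq mem_filter -lu ltnNge leqnSn.
move=> w; rewrite mem_nb inE mem_ch; apply/idP/predU1P => [vw|[->//|/andP[]//]].
case: (leqP (lev w) (lev v)) => lw.
  by left; apply: (lower_neighbor_unique vw vu) => //; rewrite -lu.
by right; rewrite vw eqn_leq lw andbT lev_adj// adjC.
Qed.

Lemma par_ch v c : c \in ch v -> par c = v.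
Proof.
move=> cv; have lc := ch_lev cv; move: cv; rewrite mem_ch => /andP[vc _].
have c0 : c != v0 by apply/eqP => e; rewrite e lev_root in lc.
have /perm_mem/(_ v) := nb_par c0; rewrite mem_nb adjC vc inE mem_ch lc.
have /negbTE -> : lev v != (lev v).+2 by rewrite neq_ltn ltnS leqnSn.
by rewrite andbF orbF => /esym/eqP.
Qed.

Lemma ch_par v : v != v0 -> v \in ch (par v).
Proof.
move=> vv0; have [u vu lu] := lev_prev vv0.
have uv : v \in ch u by rewrite mem_ch adjC vu lu eqxx.
by rewrite (par_ch uv).
Qed.

Lemma size_ch v : size (ch v) = if v == v0 then d else d.-1.
Proof.
case: eqVneq => [->|vv0]; first by rewrite ch_root size_nb.
by have := perm_size (nb_par vv0); rewrite size_nb => ->.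
Qed.

Fixpoint sph (k : nat) : seq V :=
  if k is j.+1 then flatten [seq ch u | u <- sph j] else [:: v0].

Lemma mem_sph k v : (v \in sph k) = (lev v == k).
Proof.
elim: k v => [|k IH] v /=.
  rewrite inE; apply/eqP/eqP => [->|lv]; first exact: lev_root.
  apply/eqP/negPn/negP => /lev_prev[u _]; by rewrite lv.
apply/flatten_mapP/eqP => [[u]|lv].
  by rewrite IH => /eqP <-; exact: ch_lev.
have vv0 : v != v0 by apply/eqP => e; rewrite e lev_root in lv.
have vp := ch_par vv0; exists (par v) => //.
by rewrite IH; have := ch_lev vp; rewrite lv => -[->].
Qed.

Lemma sph_uniq k : uniq (sph k).
Proof.
elim: k => //= k IH.
have disj (s : seq V) : uniq s -> uniq (flatten [seq ch u | u <- s]).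
  elim: s => //= u s IHs /andP[us uqs]; rewrite cat_uniq ch_uniq IHs// andbT /=.
  apply/hasPn => c /flatten_mapP[w ws cw]; apply/negP => cu.
  by move: us; rewrite -(par_ch cu) (par_ch cw) ws.
exact: disj.
Qed.

Lemma big_sph (R : nmodType) (f : V -> R) k :
  \sum_(u <- sph k.+1) f u = \sum_(u <- sph k) \sum_(c <- ch u) f c.
Proof. by rewrite /= big_flatten big_map. Qed.

Lemma sph_neq0 k : (1 < d)%N -> exists v, lev v = k.
Proof.
move=> d1; elim: k => [|k [v lv]]; first by exists v0; exact: lev_root.
have : (0 < size (ch v))%N.
  by rewrite size_ch; case: ifP => _; [exact: ltnW|rewrite -subn1 subn_gt0].
by case E: (ch v) => [//|c s] _; exists c; rewrite (@ch_lev v) ?lv// E mem_head.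
Qed.

Section Sums.
Variables (R : realType) (Q : V -> R).
Implicit Types psi : V -> R[i].

Lemma schrodinger_nb psi v : schrodinger adj Q psi v =
  \sum_(u <- nb v) psi u + (Q v - d%:R)%:C * psi v.
Proof.
rewrite /schrodinger fsbig_finite; last exact: nb_fin.
rewrite -/(nb v) sumrB big_const_seq count_predT iter_addr_0 size_nb.
rewrite -addrA; congr (_ + _).
have -> : (Q v - d%:R)%:C = (Q v)%:C - d%:R by rewrite rmorphB /= rmorph_nat.
by rewrite mulrBl mulr_natl addrC.
Qed.

Lemma schrodinger_ch psi v : v != v0 -> schrodinger adj Q psi v =
  psi (par v) + \sum_(c <- ch v) psi c + (Q v - d%:R)%:C * psi v.
Proof. by move=> vv0; rewrite schrodinger_nb (perm_big _ (nb_par vv0)) big_cons. Qed.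

Lemma schrodinger_root psi : schrodinger adj Q psi v0 =
  \sum_(c <- ch v0) psi c + (Q v0 - d%:R)%:C * psi v0.
Proof. by rewrite schrodinger_nb ch_root. Qed.

Definition tnb (v : V) : seq V := v :: nb v.

Definition tree_mx (v u : V) : R[i] :=
  if u == v then (Q v - d%:R)%:C else (adj v u)%:R.

Lemma tnb_uniq v : uniq (tnb v).
Proof. by rewrite /= nb_uniq mem_nb adjxx. Qed.

Lemma size_tnb v : (size (tnb v) <= d.+1)%N.
Proof. by rewrite /= size_nb. Qed.

Lemma tnb_sym u v : (v \in tnb u) = (u \in tnb v).
Proof. by rewrite !inE !mem_nb eq_sym adjC. Qed.

Lemma tree_banded (M : R) : (forall v, `|Q v| <= M) ->
  banded tnb tree_mx (1 + (M + d%:R) ^+ 2).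
Proof.
move=> hM; split.
- move=> v u; rewrite inE negb_or mem_nb /tree_mx => /andP[/negbTE -> /negbTE ->].
  by [].
- move=> v u; rewrite /tree_mx eq_sym; case: eqVneq => [->|_].
    by apply: eq_complexP; rewrite !cE ?oppr0.
  by rewrite adjC; case: (adj _ _); apply: eq_complexP; rewrite /= ?cE ?oppr0.
- move=> v u; rewrite /tree_mx; case: eqP => _.
    rewrite sqnC; have := hM v; rewrite ler_norml => /andP[h1 h2].
    have d0 : 0 <= d%:R :> R by [].
    nra.
  apply: le_trans (_ : 1 <= _); last by rewrite lerDl sqr_ge0.
  by rewrite sqnE; case: (adj _ _); rewrite /= ?cE; lra.
Qed.

Lemma schrodinger_mop : (exists M : R, forall v, `|Q v| <= M) ->
  schrodinger adj Q = matrix_operator tree_mx.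
Proof.
move=> [M hM]; apply/funext => psi; apply/funext => v.
rewrite (mopE tnb_uniq _ _ (tree_banded hM)) schrodinger_nb big_cons addrC.
congr (_ + _); first by rewrite /tree_mx eqxx.
apply: eq_big_seq => u; rewrite mem_nb => vu; rewrite /tree_mx vu.
by case: eqP vu => [->|_ _]; rewrite ?adjxx// mul1r.
Qed.

End Sums.

End TreeLevels.

(** * Radial functions and the Jacobi matrix *)

Lemma sum_const_seq (A : pzSemiRingType) (I : Type) (s : seq I) (z : A) :
  \sum_(c <- s) z = (size s)%:R * z.
Proof. by rewrite big_const_seq count_predT iter_addr_0 mulr_natl. Qed.

Lemma l2dotE (R : realType) (X : choiceType) (u v : X -> R[i]) :
  l2dot u v = csum (fun x => u x * conjc (v x)).
Proof. by []. Qed.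

Section Radial.
Variables (V : choiceType) (adj : rel V) (d : nat).
Hypotheses (htree : regular_tree adj d) (d_gt1 : (1 < d)%N).
Variables (v0 : V) (R : realType) (Q : V -> R) (q : nat -> R).
Hypothesis hq : forall v, Q v = q (gdist adj v v0).+1.

Local Notation lev := (lev adj v0).
Local Notation ch := (ch adj v0).
Local Notation par := (par adj v0).
Local Notation sph := (sph adj v0).
Local Notation H := (schrodinger adj Q).

Definition tail_a : R := Num.sqrt d.-1%:R.
(** The root has [d] children and every other vertex [d - 1]; each entry is the square root of the
    ratio of consecutive sphere sizes. *)
Definition jac_a (k : nat) : R := if k == 0%N then Num.sqrt d%:R else tail_a.
Definition jac_b (k : nat) : R := q k.+1 - d%:R.
Definition sph_norm (k : nat) : R := Num.sqrt (size (sph k))%:R.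

Lemma tail_a_gt0 : 0 < tail_a.
Proof. by rewrite sqrtr_gt0 ltr0n -subn1 subn_gt0. Qed.

Lemma sqr_tail_a : tail_a ^+ 2 = d.-1%:R.
Proof. by rewrite sqr_sqrtr. Qed.

Lemma jac_a_gt0 k : 0 < jac_a k.
Proof. by rewrite /jac_a; case: eqP => _; [rewrite sqrtr_gt0 ltr0n ltnW|exact: tail_a_gt0]. Qed.

Lemma Q_jac_b v : Q v - d%:R = jac_b (lev v). Proof. by rewrite hq. Qed.

Lemma size_sphS k : (size (sph k.+1))%:R = jac_a k ^+ 2 * (size (sph k))%:R :> R.
Proof.
rewrite -!sum1_size natr_sum big_sph natr_sum mulr_sumr; apply: eq_big_seq => v.
rewrite (mem_sph htree) => /eqP lv.
rewrite sum_const_seq !mulr1 (size_ch htree) /jac_a -lv.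
have -> : (lev v == 0%N) = (v == v0).
  apply/eqP/eqP => [l0|->]; last exact: (lev_root htree).
  by apply/eqP/negPn/negP => /(lev_prev htree)[u _]; rewrite l0.
by case: eqP => _; rewrite ?sqr_tail_a ?sqr_sqrtr.
Qed.

Lemma sph_norm_gt0 k : 0 < sph_norm k.
Proof.
rewrite sqrtr_gt0 ltr0n; have [v lv] := sph_neq0 htree v0 k d_gt1.
have : v \in sph k by rewrite (mem_sph htree) lv eqxx.
by case: (sph k).
Qed.

Lemma sph_normS k : sph_norm k.+1 = jac_a k * sph_norm k.
Proof.
rewrite /sph_norm size_sphS sqrtrM ?sqr_ge0// sqrtr_sqr ger0_norm//; exact/ltW/jac_a_gt0.
Qed.

(** Sends the unit vectors of [nat] to the normalized indicators of spheres, hence finitely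
    supported sequences isometrically to radial functions. *)
Definition rad (g : nat -> R[i]) (v : V) : R[i] := (sph_norm (lev v))^-1%:C * g (lev v).

Definition jacg (g : nat -> R[i]) (k : nat) : R[i] :=
  (jac_a k)%:C * g k.+1 + (if k is j.+1 then (jac_a j)%:C * g j else 0) + (jac_b k)%:C * g k.

Lemma realC_sum_const (s : seq V) (z : R[i]) : \sum_(c <- s) z = (size s)%:R%:C * z.
Proof. by rewrite sum_const_seq rmorph_nat. Qed.

Lemma schrodinger_rad g : H (rad g) = rad (jacg g).
Proof.
apply/funext => v; rewrite /rad.
have hch : \sum_(c <- ch v) rad g c =
    (size (ch v))%:R%:C * ((sph_norm (lev v).+1)^-1%:C * g (lev v).+1).
  rewrite -realC_sum_const; apply: eq_big_seq => c cv.
  by rewrite /rad (ch_lev htree cv).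
have hga : (size (ch v))%:R = jac_a (lev v) ^+ 2 :> R.
  rewrite (size_ch htree) /jac_a; case: eqVneq => [->|vv0].
    by rewrite (lev_root htree) eqxx sqr_sqrtr.
  by have [u _ <-] := lev_prev htree vv0; rewrite sqr_tail_a.
have g0 := gt_eqF (jac_a_gt0 (lev v)); have r0 := gt_eqF (sph_norm_gt0 (lev v)).
have cf : (size (ch v))%:R%:C * ((sph_norm (lev v).+1)^-1%:C * g (lev v).+1) =
    (sph_norm (lev v))^-1%:C * ((jac_a (lev v))%:C * g (lev v).+1).
  rewrite !mulrA -!rmorphM /=; congr (_%:C * _).
  by rewrite hga sph_normS; field; rewrite r0 g0.
case: (eqVneq v v0) => [e|vv0].
  subst v; rewrite (schrodinger_root htree) hch cf Q_jac_b /jacg (lev_root htree).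
  by ring.
rewrite (schrodinger_ch htree _ _ vv0) hch cf Q_jac_b /jacg /rad.
have [u vu lu] := lev_prev htree vv0.
have lp : lev v = (lev (par v)).+1 by apply: (ch_lev htree); exact: (ch_par htree vv0).
rewrite lp /=.
have -> : (sph_norm (lev (par v)))^-1%:C =
    (sph_norm (lev (par v)).+1)^-1%:C * (jac_a (lev (par v)))%:C.
  rewrite -rmorphM /= sph_normS; congr (_%:C); field.
  by rewrite !gt_eqF ?jac_a_gt0 ?sph_norm_gt0.
ring.
Qed.

Definition del (k : nat) : nat -> R[i] := fun j => (j == k)%:R.

Lemma l2dot_rad g k : l2dot (rad g) (rad (del k)) = g k.
Proof.
rewrite l2dotE (csum_seq (sph_uniq htree v0 k)); last first.
  by move=> v; rewrite (mem_sph htree) /rad /del => /negbTE ->; rewrite mulr0 conjc0 mulr0.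
transitivity (\sum_(v <- sph k) (size (sph k))%:R^-1%:C * g k).
  apply: eq_big_seq => v; rewrite (mem_sph htree) => /eqP lv.
  rewrite /rad lv /del eqxx mulr1.
  rewrite conjc_real.
  rewrite mulrAC -rmorphM /=; congr (_%:C * _).
  by rewrite -invfM -expr2 sqr_sqrtr.
rewrite realC_sum_const mulrA -rmorphM /= mulfV ?mul1r//.
by have := sph_norm_gt0 k; rewrite sqrtr_gt0 lt0r => /andP[].
Qed.

Lemma l2norm_rad (c : R) k : 0 < c -> l2norm (rad (fun j => c%:C * del k j)) = c.
Proof.
move=> c0; rewrite /l2norm -/(sqnorm _).
have [|_ ->] := @fs_bound _ _ (rad (fun j => c%:C * del k j)) _ (sph_uniq htree v0 k).
  by move=> v; rewrite (mem_sph htree) /rad /del => /negbTE ->; rewrite !mulr0.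
transitivity (Num.sqrt (c ^+ 2)); last by rewrite sqrtr_sqr gtr0_norm.
congr Num.sqrt; transitivity (\sum_(v <- sph k) (size (sph k))%:R^-1 * c ^+ 2).
  apply: eq_big_seq => v; rewrite (mem_sph htree) => /eqP lv.
  by rewrite /rad lv /del eqxx mulr1 sqnM !sqnC exprVn sqr_sqrtr.
rewrite sum_const_seq mulrA mulfV ?mul1r//.
by have := sph_norm_gt0 k; rewrite sqrtr_gt0 lt0r => /andP[].
Qed.


(** Triangularity with a positive leading coefficient is exactly what makes Gram-Schmidt return the
    normalized sphere indicators, without zero vectors or phase factors. *)
Lemma schrodinger_iter_rad n : exists g : nat -> R[i],
  [/\ iter n H (delta R v0) = rad g, forall k, (n < k)%N -> g k = 0 &
    exists2 c : R, 0 < c & g n = c%:C].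
Proof.
elim: n => [|n [g [e g0 [c c0 gn]]]].
  exists (del 0); split; last by exists 1.
    apply/funext => v; rewrite /= /delta /rad /del.
    have -> : (v == v0) = (lev v == 0%N).
      by rewrite -(mem_sph htree) /= inE.
    case: eqP => [->|_]; last by rewrite mulr0.
    by rewrite /sph_norm /= sqrtr1 invr1 mulr1.
  by move=> [|k].
exists (jacg g); split.
- by rewrite iterS e schrodinger_rad.
- move=> [|k] //; rewrite ltnS => nk; rewrite /jacg.
  have -> : g k = 0 by exact: g0.
  have -> : g k.+1 = 0 by apply: g0; exact: leqW.
  have -> : g k.+2 = 0 by apply: g0; do 2!apply: leqW.
  by ring.
exists (jac_a n * c); first by rewrite mulr_gt0// jac_a_gt0.
rewrite /jacg (g0 n.+1)// (g0 n.+2); last exact: leqW.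
by rewrite gn rmorphM /=; ring.
Qed.

Lemma gram_schmidt_rad n :
  gram_schmidt_seq (fun n => iter n H (delta R v0)) n = [seq rad (del k) | k <- iota 0 n].
Proof.
elim: n => [|n IH] //.
rewrite -addn1 iotaD map_cat cats1 add0n addn1 /= {}IH; congr rcons.
have [g [-> g0 [c c0 gn]]] := schrodinger_iter_rad n.
have E : (fun x => rad g x -
      \sum_(e <- [seq rad (del k) | k <- iota 0 n]) l2dot (rad g) e * e x)
    = rad (fun j => c%:C * del n j).
  apply/funext => v; rewrite big_map.
  under eq_bigr do rewrite l2dot_rad /rad mulrCA.
  rewrite /rad -mulr_sumr -mulrBr; congr (_ * _).
  have [ltn|] := ltnP (lev v) n.
    rewrite (bigD1_seq (lev v)) ?mem_iota ?iota_uniq//= {1}/del eqxx mulr1 big1 ?addr0 ?subrr.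
      by rewrite /del ltn_eqF// mulr0.
    by move=> k kl; rewrite /del eq_sym (negbTE kl) mulr0.
  rewrite leq_eqVlt => /predU1P[<-|ltn].
    rewrite gn big_seq big1 ?subr0 ?/del ?eqxx ?mulr1// => k.
    by rewrite mem_iota /= add0n => kn; rewrite gtn_eqF// mulr0.
  rewrite g0// big_seq big1 ?subr0 /del ?gtn_eqF ?mulr0// => k.
  by rewrite mem_iota /= add0n => kn; rewrite gtn_eqF ?mulr0// (ltn_trans kn).
rewrite E /normalize l2norm_rad//; apply/funext => v.
have cc : (c^-1)%:C * c%:C = 1 by rewrite -rmorphM /= mulVf ?gt_eqF.
transitivity ((c^-1)%:C * c%:C * rad (del n) v); last by rewrite cc mul1r.
by rewrite /rad; ring.
Qed.

Lemma jacobi_entries i j : jacobi_of H v0 i j =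
  if j == i then (jac_b i)%:C else if j == i.+1 then (jac_a i)%:C
  else if i == j.+1 then (jac_a j)%:C else 0.
Proof.
have gs k : gram_schmidt (fun n => iter n H (delta R v0)) k = rad (del k).
  rewrite /gram_schmidt gram_schmidt_rad -addn1 iotaD map_cat last_cat /=.
  by rewrite add0n.
rewrite /jacobi_of !gs schrodinger_rad l2dot_rad /jacg /del [j == i]eq_sym [j == i.+1]eq_sym.
have kE k : (k.+1 == j.+1) = (k == j) by [].
case: (eqVneq i j) => [<-|ij].
  rewrite gtn_eqF//; case: (i) => [|k]; first by rewrite /=; ring.
  by rewrite ltn_eqF//=; ring.
case: (eqVneq i.+1 j) => [<-|ij1].
  case: (i) => [|k]; first by rewrite /=; ring.
  have -> : (k == k.+2) = false by rewrite ltn_eqF// leqW.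
  by rewrite /=; ring.
case: (i) => [|k]; first by rewrite /=; ring.
by rewrite kE; case: eqVneq => [->|_]; rewrite /=; ring.
Qed.

End Radial.

(** * Tails and their limits *)

(** Carries vectors along shifts of [nat] and [int]. Injectivity is asked only on the support of
    [psi], because [absz] and truncated subtraction are not injective elsewhere. *)
Lemma sqnorm_pull_le (R : realType) (X Y : choiceType) (phi : Y -> R[i]) (psi : X -> R[i])
    (k : X -> Y) : l2 phi ->
  (forall x, psi x != 0 -> sqn (psi x) <= sqn (phi (k x))) ->
  (forall x x', psi x != 0 -> psi x' != 0 -> k x = k x' -> x = x') ->
  l2 psi /\ sqnorm psi <= sqnorm phi.
Proof.
move=> hphi hle inj; apply: l2_bound => s us.
pose s' := [seq x <- s | psi x != 0].
have us' : uniq s' by exact: filter_uniq.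
have -> : \sum_(x <- s) sqn (psi x) = \sum_(x <- s') sqn (psi x).
  rewrite big_filter [LHS](bigID (fun x => psi x != 0))/= [X in _ + X]big1 ?addr0//.
  by move=> x /negPn/eqP ->; rewrite sqn0.
apply: le_trans (_ : \sum_(y <- [seq k x | x <- s']) sqn (phi y) <= _).
  rewrite big_map big_seq [leRHS]big_seq; apply: ler_sum => x.
  by rewrite mem_filter => /andP[/hle].
apply: sqnorm_seq => //; rewrite map_inj_in_uniq// => x x'.
by rewrite !mem_filter => /andP[hx _] /andP[hx' _]; exact: inj.
Qed.

Section JacobiOperators.
Variable R : realType.

(** The off-diagonal is a single constant, as it is for every proper tail of [J_H] and for the
    limits of these tails. *)
Definition jacN (a : R) (b : nat -> R) (i j : nat) : R[i] :=
  if j == i then (b i)%:C else if j == i.+1 then a%:C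
  else if i == j.+1 then a%:C else 0.

Definition nbN (i : nat) : seq nat := [:: i, i.+1 & if i is k.+1 then [:: k] else [::]].

Definition nbZ (l : int) : seq int := [:: l; l + 1; l - 1].

Lemma nbN_uniq i : uniq (nbN i).
Proof. by case: i => [|k] //=; rewrite !inE; lia. Qed.

Lemma size_nbN i : (size (nbN i) <= 3)%N. Proof. by case: i. Qed.

Lemma nbN_sym i j : (j \in nbN i) = (i \in nbN j).
Proof. by case: i => [|i]; case: j => [|j]; rewrite !inE; lia. Qed.

Lemma nbZ_uniq l : uniq (nbZ l).
Proof. by rewrite /= !inE; lia. Qed.

Lemma size_nbZ l : (size (nbZ l) <= 3)%N. Proof. by []. Qed.

Lemma nbZ_sym l m : (m \in nbZ l) = (l \in nbZ m).
Proof. by rewrite !inE; lia. Qed.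

Lemma jacN_banded a b (B : R) : (forall i, `|b i| <= B) ->
  banded nbN (jacN a b) (a ^+ 2 + B ^+ 2).
Proof.
move=> hB; have B0 : 0 <= B := le_trans (normr_ge0 _) (hB 0%N).
split.
- move=> i j; rewrite /jacN; case: i => [|i]; rewrite !inE => h.
    by rewrite !ifF//; lia.
  by rewrite !ifF//; lia.
- move=> i j; rewrite /jacN [i == j]eq_sym; case: eqVneq => [->|ji].
    by rewrite conjc_real.
  case: (eqVneq i j.+1) => [e|h1].
    by rewrite ifF ?conjc_real//; lia.
  by case: ifP => _; rewrite ?conjc_real//; apply: eq_complexP; rewrite !cE ?oppr0.
- move=> i j; rewrite /jacN; case: ifP => _.
    rewrite sqnC ler_wpDl ?sqr_ge0// -real_normK ?num_real// lerXn2r//.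
  by do 2 (case: ifP => _; first by rewrite sqnC lerDl sqr_ge0);
    rewrite sqn0 addr_ge0// sqr_ge0.
Qed.

Lemma jacZ_banded a b (B : R) : (forall l, `|b l| <= B) ->
  banded nbZ (jacobiZ (fun=> a) b) (a ^+ 2 + B ^+ 2).
Proof.
move=> hB; have B0 : 0 <= B := le_trans (normr_ge0 _) (hB 0).
split.
- by move=> l m; rewrite /jacobiZ !inE => h; rewrite !ifF//; lia.
- move=> l m; rewrite /jacobiZ [l == m]eq_sym; case: eqVneq => [->|ji].
    by rewrite conjc_real.
  case: (eqVneq l (m + 1)) => [e|h1].
    by rewrite ifF ?conjc_real//; lia.
  by case: ifP => _; rewrite ?conjc_real//; apply: eq_complexP; rewrite !cE ?oppr0.
- move=> l m; rewrite /jacobiZ; case: ifP => _.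
    rewrite sqnC ler_wpDl ?sqr_ge0// -real_normK ?num_real// lerXn2r//.
  by do 2 (case: ifP => _; first by rewrite sqnC lerDl sqr_ge0);
    rewrite sqn0 addr_ge0// sqr_ge0.
Qed.

Lemma jacNE a b (B : R) f i : (forall i, `|b i| <= B) ->
  matrix_operator (jacN a b) f i = (b i)%:C * f i + a%:C * f i.+1 +
    a%:C * (if i is k.+1 then f k else 0).
Proof.
move=> hB; rewrite (mopE nbN_uniq _ _ (jacN_banded a hB)) /nbN !big_cons.
have e0 : jacN a b i i = (b i)%:C by rewrite /jacN eqxx.
have e1 : jacN a b i i.+1 = a%:C by rewrite /jacN eqxx ifF//; lia.
rewrite e0 e1; case: i {e0 e1} => [|k]; first by rewrite big_nil; ring.
rewrite big_cons big_nil.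
have -> : jacN a b k.+1 k = a%:C by rewrite /jacN eqxx !ifF//; lia.
by rewrite /=; ring.
Qed.

Lemma jacZE a b (B : R) f l : (forall l, `|b l| <= B) ->
  matrix_operator (jacobiZ (fun=> a) b) f l =
    (b l)%:C * f l + a%:C * f (l + 1) + a%:C * f (l - 1).
Proof.
move=> hB; rewrite (mopE nbZ_uniq _ _ (jacZ_banded a hB)) /nbZ !big_cons big_nil.
have -> : jacobiZ (fun=> a) b l l = (b l)%:C by rewrite /jacobiZ eqxx.
have -> : jacobiZ (fun=> a) b l (l + 1) = a%:C by rewrite /jacobiZ eqxx ifF//; lia.
have -> : jacobiZ (fun=> a) b l (l - 1) = a%:C.
  by rewrite /jacobiZ subrK eqxx !ifF//; lia.
by rewrite addr0 addrA.
Qed.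

Variables (a B : R) (c : nat -> R).
Hypothesis cB : forall k, `|c k| <= B.

Definition tailop (n : nat) := matrix_operator (jacN a (fun i => c (i + n)%N)).

Definition tails_bounded_below (z : R[i]) := exists (n0 : nat) (C : R), 0 < C /\
  forall n f, (n0 <= n)%N -> l2 f -> sqnorm f <= C * sqnorm (shiftop (tailop n) z f).

Let cnB n i : `|c (i + n)%N| <= B. Proof. exact: cB. Qed.

Lemma tail_bop n : bounded_operator (tailop n).
Proof. exact: (band_bop nbN_uniq size_nbN nbN_sym (jacN_banded a (cnB n))). Qed.

Lemma tail_sym n : symmetric_op (tailop n).
Proof. exact: (band_sym nbN_uniq size_nbN nbN_sym (jacN_banded a (cnB n))). Qed.

Lemma sqnorm_l2norm (X : choiceType) (u : X -> R[i]) : sqnorm u = l2norm u ^+ 2.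
Proof. by rewrite /l2norm sqr_sqrtr// sqnorm_ge0. Qed.

Lemma l2norm_ge0 (X : choiceType) (u : X -> R[i]) : 0 <= l2norm u.
Proof. exact: sqrtr_ge0. Qed.

Lemma l2norm_small (X : choiceType) (u : nat -> X -> R[i]) (e : R) :
  (l2norm (u j) @[j --> \oo] --> (0 : R)) -> 0 < e ->
  exists j0, forall j, (j0 <= j)%N -> sqnorm (u j) <= e ^+ 2.
Proof.
move=> /cvgrPdist_le h e0; have [j0 _ hj] := h e e0; exists j0 => j jj.
have := hj j jj; rewrite sub0r normrN ger0_norm ?l2norm_ge0// => hle.
by rewrite sqnorm_l2norm lerXn2r// nnegrE ?l2norm_ge0// ltW.
Qed.

(** An approximate eigenvector of [S] is one for the tails along the sequence. [S] is known only as
    a strong limit, so the symmetry needed for [spectrumP] is first inherited from the tails. *)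
Lemma strong_limit_not_bounded_below S (n : nat -> nat) z : bounded_operator S ->
  {homo n : i j / (i < j)%N} ->
  (forall psi, l2 psi -> l2norm (fun i => tailop (n j) psi i - S psi i)
     @[j --> \oo] --> (0 : R)) ->
  spectrum S z -> ~ tails_bounded_below z.
Proof.
move=> bS nmono conv sz [n0 [C [C0 hC]]].
have sS : symmetric_op S.
  move=> u v hu hv.
  pose K := sqnorm u + sqnorm v + 1.
  have [Nu Nv] := (sqnorm_ge0 u, sqnorm_ge0 v).
  have K0 : 0 < K by rewrite ltr_wpDl// addr_ge0.
  apply: subr0_eq; apply: normr0_eq0; apply: le_anti; rewrite normr_ge0 andbT.
  apply/ler_addgt0Pr => e e0; rewrite add0r.
  pose t := e / (2 * K).
  have t0 : 0 < t by rewrite divr_gt0// mulr_gt0.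
  have [j1 h1] := l2norm_small (conv u hu) t0.
  have [j2 h2] := l2norm_small (conv v hv) t0.
  pose j := maxn j1 j2.
  have {}h1 := h1 j (leq_maxl _ _); have {}h2 := h2 j (leq_maxr _ _).
  have bT := tail_bop (n j).
  have E : dot (S u) v - dot u (S v) = dot (fun i => tailop (n j) v i - S v i) u
      - dot (fun i => tailop (n j) u i - S u i) v.
    rewrite !dotBl; auto; rewrite (tail_sym _ hu hv).
    by rewrite [dot u (S v)]dotC; auto; rewrite [dot u (tailop _ v)]dotC; auto; ring.
  have K1 w : sqnorm w <= t ^+ 2 -> sqnorm w <= t ^+ 2 * K.
    by move=> h; apply: le_trans h _; rewrite ler_peMr ?sqr_ge0// /K; lra.
  have a1 : `|dot (fun i => tailop (n j) v i - S v i) u| <= t * K.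
    by apply: small_dot => //; auto; rewrite /K; lra.
  have a2 : `|dot (fun i => tailop (n j) u i - S u i) v| <= t * K.
    by apply: small_dot => //; auto; rewrite /K; lra.
  have te : 2 * (t * K) = e by rewrite /t; field; rewrite gt_eqF.
  rewrite E; move: a1 a2; rewrite !ler_norml; lra.
have /spectrumP hb := sz; have {}hb := hb bS sS.
(* The residual and the convergence error each contribute [2 / (8 C)]; after multiplication by [C]
   their sum is half of [|f|^2], a contradiction. *)
have C4 : 0 < (8 * C)^-1 by rewrite invr_gt0 mulr_gt0.
have [f hf hN] := not_bdd_below hb C4.
have f0 : 0 < sqnorm f.
  rewrite -(pmulr_rgt0 _ C4); apply: le_lt_trans hN; exact: sqnorm_ge0.
pose e := Num.sqrt (sqnorm f * (8 * C)^-1).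
have e0 : 0 < e by rewrite sqrtr_gt0 mulr_gt0.
have e2 : e ^+ 2 = sqnorm f * (8 * C)^-1 by rewrite sqr_sqrtr// ltW// mulr_gt0.
have [j1 h1] := l2norm_small (conv f hf) e0.
pose j := maxn j1 n0.
have {}h1 := h1 j (leq_maxl _ _).
have jn : (j <= n j)%N.
  by elim: (j) => // k IH; apply: leq_ltn_trans IH _; exact: nmono.
have := hC (n j) f (leq_trans (leq_maxr j1 n0) jn) hf.
have -> : shiftop (tailop (n j)) z f =
   (fun i => shiftop S z f i + (tailop (n j) f i - S f i)).
  by apply/funext => i; rewrite /shiftop; ring.
have bT := tail_bop (n j).
have h2 := sqnorm_D (bop_l2 (bop_shift z bS) hf) (l2B (bop_l2 bT hf) (bop_l2 bS hf)).
move=> h3; have h4 : C * sqnorm (fun x => shiftop S z f x + (tailop (n j) f x - S f x)) <=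
    C * (2 * ((8 * C)^-1 * sqnorm f) + 2 * ((8 * C)^-1 * sqnorm f)).
  rewrite ler_pM2l//; apply: le_trans h2 _; apply: lerD; rewrite ler_pM2l//.
    exact: ltW.
  by rewrite [leRHS]mulrC -e2.
have : C * (2 * ((8 * C)^-1 * sqnorm f) + 2 * ((8 * C)^-1 * sqnorm f)) = sqnorm f / 2.
  by field; rewrite gt_eqF.
lra.
Qed.

(** A finitely supported approximate eigenvector of the two-sided limit, translated far to the
    right, becomes one of the single tail [n0]; only the finitely many diagonal entries over its
    support have to be close to the limit. *)
Lemma right_limit_not_bounded_below (b : int -> R) (n : nat -> nat) z :
  (forall l, `|b l| <= B) -> n j @[j --> \oo] --> \oo ->
  (forall l, c (absz (l + (n j)%:Z)) @[j --> \oo] --> b l) ->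
  spectrum (matrix_operator (jacobiZ (fun=> a) b)) z -> ~ tails_bounded_below z.
Proof.
move=> bB ninf conv sz [n0 [C [C0 hC]]].
have hM := jacZ_banded a bB.
have bA := band_bop nbZ_uniq size_nbZ nbZ_sym hM.
have sA := band_sym nbZ_uniq size_nbZ nbZ_sym hM.
have /spectrumP hb := sz; have {}hb := hb bA sA.
have C4 : 0 < (8 * C)^-1 by rewrite invr_gt0 mulr_gt0.
have [g' hg' hN'] := not_bdd_below hb C4.
have [s hN] := cut_below (bop_shift z bA) hg' hN'.
set g := cut s g' in hN.
have lg : l2 g by exact: l2_cut.
have gs l : l \notin s -> g l = 0 by rewrite /g /cut => /negbTE ->.
have g0 : 0 < sqnorm g.
  rewrite -(pmulr_rgt0 _ C4); apply: le_lt_trans hN; exact: sqnorm_ge0.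
clearbody g.
pose m := \max_(l <- s) absz l.
have sm l : g l != 0 -> (absz l <= m)%N.
  move=> gl; apply: leq_bigmax_seq => //.
  by apply: contraNT gl => /gs ->.
(* The support of [g] lies in [[-m, m]], so after the translation by [n j - n0] it starts at index 2
   at the earliest and the first row of the tail is not disturbed. *)
have [j [nj cj]] : exists j, (n0 + m + 2 <= n j)%N /\
    forall l, l \in s -> (c (absz (l + (n j)%:Z)) - b l) ^+ 2 <= (8 * C)^-1.
  have h1 : \forall j \near \oo, (n0 + m + 2 <= n j)%N.
    by apply: (ninf [set k | (n0 + m + 2 <= k)%N]); exists (n0 + m + 2)%N.
  have h2 : \forall j \near \oo, forall l, l \in s ->
      (c (absz (l + (n j)%:Z)) - b l) ^+ 2 <= (8 * C)^-1.
    elim: (s) => [|l s' IH]; first exact: filterE.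
    have sq0 : 0 < Num.sqrt ((8 * C)^-1) by rewrite sqrtr_gt0.
    have /cvgrPdist_le/(_ _ sq0) hl := conv l.
    apply: filterS2 IH hl => j hj hl l'; rewrite inE => /predU1P[->|/hj//].
    rewrite -[leRHS]sqr_sqrtr; last exact: ltW.
    rewrite -real_normK ?num_real// lerXn2r ?nnegrE ?sqrtr_ge0//.
    by rewrite distrC.
  by have [j [? ?]] := filter_ex (filterI h1 h2); exists j.
pose h (i : nat) : int := i%:Z + n0%:Z - (n j)%:Z.
pose f i := g (h i).
have [lf _] : l2 f /\ sqnorm f <= sqnorm g.
  by apply: (@sqnorm_pull_le _ _ _ _ _ h) => // i i' _ _; rewrite /h; lia.
have [_ Ngf] : l2 g /\ sqnorm g <= sqnorm f.
  refine (@sqnorm_pull_le _ _ _ f g (fun l => absz (l + (n j)%:Z - n0%:Z)%R) lf _ _).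
    move=> l /sm lm; rewrite /f /h le_eqVlt; apply/orP; left; apply/eqP.
    by congr (sqn (g _)); lia.
  by move=> l l' /sm lm /sm lm'; lia.
have := hC n0 f (leqnn _) lf.
pose r1 i := shiftop (matrix_operator (jacobiZ (fun=> a) b)) z g (h i).
have [lr1 Nr1] : l2 r1 /\ sqnorm r1 <= sqnorm (shiftop (matrix_operator (jacobiZ (fun=> a) b)) z g).
  apply: (@sqnorm_pull_le _ _ _ _ r1 h) => //; first by auto.
  by move=> i i' _ _; rewrite /h; lia.
have E i : shiftop (tailop n0) z f i = r1 i + (c (i + n0)%N - b (h i))%:C * f i.
  rewrite /r1 /shiftop /tailop (jacNE _ _ _ (cnB n0)) (jacZE _ _ _ bB) /f.
  have -> : h i.+1 = h i + 1 by rewrite /h; lia.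
  have -> : (if i is k.+1 then g (h k) else 0) = g (h i - 1).
    case: i => [|k]; last by congr g; rewrite /h; lia.
    apply/esym/eqP; apply: contraT => /sm; rewrite /h; lia.
  by rewrite rmorphB /=; ring.
have Nr : sqnorm (shiftop (tailop n0) z f) <= 2 * sqnorm r1 + 2 * (8 * C)^-1 * sqnorm f.
  have C5 : 0 <= 2 * (8 * C)^-1 by rewrite mulr_ge0// ltW.
  have hle i : sqn (shiftop (tailop n0) z f i) <=
      2 * sqn (r1 i) + 2 * (8 * C)^-1 * sqn (f i).
    rewrite E; apply: le_trans (sqnD _ _) _; rewrite lerD2l -mulrA ler_pM2l//.
    rewrite sqnM sqnC; have [->|fi] := eqVneq (f i) 0; first by rewrite sqn0 !mulr0.
    rewrite ler_wpM2r ?sqn_ge0//.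
    have hs : h i \in s by apply: contraNT fi => /gs; rewrite /f => ->.
    have e : absz (h i + (n j)%:Z) = (i + n0)%N by rewrite /h subrK -PoszD.
    by have := cj _ hs; rewrite e.
  by have [] := l2_le2 lr1 lf (ler0n _ 2) C5 hle.
have Nfg : sqnorm f <= sqnorm g.
  by have [] := @sqnorm_pull_le _ _ _ g f h lg => // i i' _ _; rewrite /h; lia.
move=> h3; have h4 : C * sqnorm (shiftop (tailop n0) z f) <=
    C * (2 * ((8 * C)^-1 * sqnorm g) + 2 * ((8 * C)^-1 * sqnorm g)).
  rewrite ler_pM2l//; apply: le_trans Nr _; rewrite lerD//.
    by rewrite ler_pM2l//; apply: le_trans Nr1 _; exact: ltW.
  by rewrite -mulrA !ler_pM2l.
have : C * (2 * ((8 * C)^-1 * sqnorm g) + 2 * ((8 * C)^-1 * sqnorm g)) = sqnorm g / 2.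
  by field; rewrite gt_eqF.
lra.
Qed.

End JacobiOperators.

(** * Complex limits and extraction of subsequences from an ultrafilter *)

Section FilterTools.
Variable R : realType.

Lemma ccvg_cst T (F : set_system T) {PF : ProperFilter F} (z : R[i]) :
  ccvg F (fun=> z) z.
Proof. by split; exact: cvg_cst. Qed.

Lemma ccvgD T (F : set_system T) {PF : ProperFilter F} (f g : T -> R[i]) x y :
  ccvg F f x -> ccvg F g y -> ccvg F (fun t => f t + g t) (x + y).
Proof.
by move=> [f1 f2] [g1 g2]; split; rewrite cE; under eq_fun do rewrite cE;
  exact: cvgD.
Qed.

Lemma ccvgM T (F : set_system T) {PF : ProperFilter F} (f g : T -> R[i]) x y :
  ccvg F f x -> ccvg F g y -> ccvg F (fun t => f t * g t) (x * y).
Proof.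
move=> [f1 f2] [g1 g2]; split; rewrite cE; under eq_fun do rewrite cE.
  by apply: cvgB; exact: cvgM.
by apply: cvgD; exact: cvgM.
Qed.

Lemma ccvg_real T (F : set_system T) {PF : ProperFilter F} (f : T -> R) (x : R) :
  f t @[t --> F] --> x -> ccvg F (fun t => (f t)%:C) x%:C.
Proof. by move=> h; split => //=; exact: cvg_cst. Qed.

Lemma filter_forall_le T (F : set_system T) {PF : ProperFilter F} (A : nat -> set T) k :
  (forall t, F (A t)) -> F [set x | forall t, (t <= k)%N -> A t x].
Proof.
move=> hA; elim: k => [|k IH].
  by apply: filterS (hA 0%N) => x h t; rewrite leqn0 => /eqP ->.
apply: filterS2 IH (hA k.+1) => x h h' t; rewrite leq_eqVlt => /predU1P[->//|].
by rewrite ltnS; exact: h.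
Qed.

(** Limits along an ultrafilter must be turned back into limits of sequences, as the definitions of
    the limit operators demand. The growth condition makes [h \o phi] strictly increasing once
    [j <= h j]. *)
Lemma extract (U : set_system nat) (E : nat -> set nat) (h : nat -> nat) :
  UltraFilter U -> \oo `<=` U -> (forall k, U (E k)) ->
  exists phi : nat -> nat, (forall k j, (k <= j)%N -> E k (phi j)) /\
    (forall j, (h (phi j) < phi j.+1)%N) /\ (forall j, (j < phi j)%N).
Proof.
move=> hU sU hE.
have PU : ProperFilter U by exact: ultra_proper.
have step (p : nat * nat) : exists x, (p.2 <= x)%N /\ forall k, (k <= p.1)%N -> E k x.
  have [x ? ?] := ultra_ex hU sU (filter_forall_le p.1 hE) p.2.
  by exists x.
have [g hg] := choice step.
pose phi := fix phi j := if j is i.+1 then g (i.+1, (h (phi i) + phi i).+1) else g (0%N, 1%N).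
have phiS j : phi j.+1 = g (j.+1, (h (phi j) + phi j).+1) by [].
exists phi; split; [|split].
- by move=> k [|j] kj; [exact: (hg (0%N, 1%N)).2|rewrite phiS; exact: (hg _).2].
- move=> j; rewrite phiS; apply: leq_trans (hg _).1 => /=.
  by rewrite ltnS leq_addr.
- elim=> [|j IH]; first exact: (hg (0%N, 1%N)).1.
  rewrite phiS; apply: leq_trans (hg _).1 => /=.
  by rewrite ltnS (leq_trans IH) ?leq_addl.
Qed.

(** Telescoping, from [1/(t+2)^2 <= 1/(t+1) - 1/(t+2)]. *)
Lemma sum_weights_le j : \sum_(t < j) (4 * t.+2%:R ^+ 2)^-1 <= 1 / 4 :> R.
Proof.
suff : \sum_(t < j) (4 * t.+2%:R ^+ 2)^-1 <= 1 / 4 - (4 * j.+1%:R)^-1 :> R.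
  by move/le_trans; apply; rewrite gerBl invr_ge0 mulr_ge0.
elim: j => [|j IH]; first by rewrite big_ord0 mulr1 div1r subrr.
rewrite big_ord_recr /=.
suff : (4 * j.+2%:R ^+ 2)^-1 <= (4 * j.+1%:R)^-1 - (4 * j.+2%:R)^-1 :> R.
  by move=> h; apply: le_trans (lerD IH h) _; rewrite addrA subrK.
have j1 : 0 < j.+1%:R :> R by [].
have -> : j.+2%:R = j.+1%:R + 1 :> R by rewrite -natr1.
set y : R := j.+1%:R in j1 *.
have y1 : 0 < y + 1 by rewrite addr_gt0.
have -> : (4 * y)^-1 - (4 * (y + 1))^-1 = (4 * (y * (y + 1)))^-1.
  by field; rewrite !gt_eqF.
rewrite lef_pV2 ?posrE ?mulr_gt0 ?exprn_gt0//.
by rewrite ler_pM2l// expr2 ler_pM2r// lerDl.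
Qed.

Lemma cvg_small_from (x : nat -> R) (l : R) k :
  (forall j, (k <= j)%N -> `|x j - l| <= j.+1%:R^-1) -> x j @[j --> \oo] --> l.
Proof.
move=> h; apply/cvgrPdist_le => e e0; exists (maxn k (Num.truncn e^-1)) => // n /=.
rewrite geq_max => /andP[kn hn]; rewrite distrC; apply: le_trans (h n kn) _.
rewrite -[leRHS]invrK lef_pV2 ?posrE ?invr_gt0//.
by apply: ltW; apply: lt_le_trans (truncnS_gt _) _; rewrite ler_nat ltnS.
Qed.

End FilterTools.

(** * From unbounded inverses of the tails to limit operators *)

Section TailLimits.
Variable R : realType.
Variables (a B : R) (c : nat -> R).
Hypothesis cB : forall k, `|c k| <= B.

Let cnB n i : `|c (i + n)%N| <= B. Proof. exact: cB. Qed.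

Definition ext (f : nat -> R[i]) (l : int) : R[i] := if l is Posz k then f k else 0.

Lemma sqnorm_ext_shift f (k : int) : l2 f ->
  l2 (fun p : nat => ext f (p%:Z + k)) /\ sqnorm (fun p : nat => ext f (p%:Z + k)) <= sqnorm f.
Proof.
move=> hf; apply: (@sqnorm_pull_le _ _ _ f _ (fun p : nat => absz (p%:Z + k)%R)) => //.
  by move=> p; case: (p%:Z + k) => [m|m] /=; rewrite ?eqxx.
move=> p p'; case E: (p%:Z + k) => [m|m] /=; rewrite ?eqxx//.
by case E': (p'%:Z + k) => [m'|m'] /=; rewrite ?eqxx// => _ _ mm; lia.
Qed.

(* Summed over p it bounds the tails below, because the weights 1/(4(t+2)^2) sum to
   at most 1/4; violated for every j, it yields in the limit a generalized
   eigenfunction of at most linear growth. *)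
Definition local_estimate (z : R[i]) (j : nat) := forall n f p, (j <= n)%N -> l2 f ->
  sqn (f p) <= \sum_(t < j) (4 * t.+2%:R ^+ 2)^-1 *
      (sqn (ext f (p%:Z + t.+1%:Z)) + sqn (ext f (p%:Z - t.+1%:Z))) +
    j.+1%:R * \sum_(t < (2 * j).+1)
      sqn (ext (shiftop (tailop a c n) z f) (p%:Z + (t%:Z - j%:Z))).

(** Summed over [p], the weighted terms amount to at most [|f|^2 / 2] and are absorbed on the left;
    this doubles the factor in front of the residual. *)
Lemma local_estimate_bounded_below z j :
  local_estimate z j -> tails_bounded_below a c z.
Proof.
move=> hj; exists j, (2 * (j.+1%:R * (2 * j).+1%:R)); split.
  by rewrite mulr_gt0// mulr_gt0.
move=> n f jn hf; pose r := shiftop (tailop a c n) z f.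
have lr : l2 r by apply: bop_l2 => //; apply: bop_shift; exact: tail_bop.
have : sqnorm f <= \sum_(t < j) (4 * t.+2%:R ^+ 2)^-1 * (sqnorm f + sqnorm f) +
    j.+1%:R * \sum_(t < (2 * j).+1) sqnorm r.
  have [] // := @l2_bound _ _ f (\sum_(t < j) (4 * t.+2%:R ^+ 2)^-1 * (sqnorm f + sqnorm f) +
    j.+1%:R * \sum_(t < (2 * j).+1) sqnorm r) => s us.
  apply: le_trans (ler_sum _ (fun p _ => hj n f p jn hf)) _.
  rewrite big_split /= -mulr_sumr; apply: lerD.
    rewrite exchange_big /=; apply: ler_sum => t _; rewrite -mulr_sumr.
    rewrite ler_wpM2l ?invr_ge0 ?mulr_ge0 ?exprn_ge0// big_split /=; apply: lerD.
      have [l1 n1] := sqnorm_ext_shift t.+1%:Z hf.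
      exact: le_trans (sqnorm_seq l1 us) n1.
    have [l1 n1] := sqnorm_ext_shift (- t.+1%:Z) hf.
    exact: le_trans (sqnorm_seq l1 us) n1.
  rewrite ler_wpM2l// exchange_big /=; apply: ler_sum => t _.
  have [l1 n1] := sqnorm_ext_shift (t%:Z - j%:Z) lr.
  exact: le_trans (sqnorm_seq l1 us) n1.
rewrite sumr_const card_ord -[sqnorm r *+ _]mulr_natl => h.
have h2 : \sum_(i < j) (4 * i.+2%:R ^+ 2)^-1 * (sqnorm f + sqnorm f) <=
    1 / 4 * (sqnorm f + sqnorm f).
  by rewrite -mulr_suml ler_wpM2r ?addr_ge0 ?sqnorm_ge0// sum_weights_le.
rewrite -/r; lra.
Qed.

End TailLimits.

Section LimitExtraction.
Variable R : realType.
Variables (a B : R) (c : nat -> R).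
Hypothesis cB : forall k, `|c k| <= B.

Let cnB n i : `|c (i + n)%N| <= B. Proof. exact: cB. Qed.

(** Row [p + l] of [J_n - z] in coordinates centred at [p]. The vectors used vanish left of the
    boundary, so the first row needs no separate formula. *)
Definition residual (z : R[i]) (n p : nat) (u : int -> R[i]) (l : int) : R[i] :=
  if p%:Z + l is Posz k then
    a%:C * u (l + 1) + a%:C * u (l - 1) + ((c (k + n)%N)%:C - z) * u l
  else 0.

(** Divide a violation of [local_estimate] by [f p]: each summand on its right-hand side is then
    below 1, so the weights give the growth bound and the factor [j + 1] makes the residual
    small. *)
Lemma bad_sequences z : ~ tails_bounded_below a c z ->
  exists (n p : nat -> nat) (u : nat -> int -> R[i]), forall j,
    [/\ (j <= n j)%N, u j 0 = 1, forall l, (p j)%:Z + l < 0 -> u j l = 0,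
      forall l, (absz l <= j)%N -> sqn (u j l) <= 4 * (absz l).+1%:R ^+ 2 &
      forall l, (absz l <= j)%N -> sqn (residual z (n j) (p j) (u j) l) <= j.+1%:R^-1].
Proof.
move=> nUB.
have bad j : exists w : nat * nat * (int -> R[i]),
    [/\ (j <= w.1.1)%N, w.2 0 = 1, forall l, w.1.2%:Z + l < 0 -> w.2 l = 0,
      forall l, (absz l <= j)%N -> sqn (w.2 l) <= 4 * (absz l).+1%:R ^+ 2 &
      forall l, (absz l <= j)%N -> sqn (residual z w.1.1 w.1.2 w.2 l) <= j.+1%:R^-1].
  apply: contrapT => H; apply: nUB; apply: (local_estimate_bounded_below cB (j := j)).
  move=> n f p jn hf; rewrite leNgt; apply/negP => hlt; apply: H.
  set S1 := \sum_(t < j) _ in hlt; set S2 := \sum_(t < _) _ in hlt.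
  have S10 : 0 <= S1.
    apply: sumr_ge0 => t _; rewrite mulr_ge0 ?invr_ge0 ?mulr_ge0 ?exprn_ge0//.
    by rewrite addr_ge0 ?sqn_ge0.
  have S20 : 0 <= S2 by apply: sumr_ge0 => t _; exact: sqn_ge0.
  have j0 : 0 < j.+1%:R :> R by [].
  have jS2 : 0 <= j.+1%:R * S2 by apply: mulr_ge0.
  have s0 : 0 < sqn (f p) by lra.
  have fp : f p != 0 by apply/eqP => e; move: s0; rewrite e sqn0 ltxx.
  pose u (l : int) := ext f (p%:Z + l) / f p.
  have uE l : ext f (p%:Z + l) = u l * f p by rewrite /u divfK.
  have u0 : u 0 = 1 by rewrite /u addr0 /= mulfV.
  have uneg l : p%:Z + l < 0 -> u l = 0.
    by rewrite /u; case: (p%:Z + l) => // k _ /=; rewrite mul0r.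
  clearbody u.
  exists (n, p, u); split => //=.
  - have key (t : nat) : (t < j)%N ->
        sqn (u t.+1%:Z) + sqn (u (- t.+1%:Z)) <= 4 * t.+2%:R ^+ 2.
      move=> tj; have w0 : 0 < 4 * t.+2%:R ^+ 2 :> R by rewrite mulr_gt0// exprn_gt0.
      have h : (4 * t.+2%:R ^+ 2)^-1 *
          (sqn (ext f (p%:Z + t.+1%:Z)) + sqn (ext f (p%:Z - t.+1%:Z))) <= S1.
        rewrite /S1 (bigD1 (Ordinal tj))//= lerDl; apply: sumr_ge0 => i _.
        rewrite mulr_ge0 ?invr_ge0 ?mulr_ge0 ?exprn_ge0//.
        by rewrite addr_ge0 ?sqn_ge0.
      rewrite !uE !sqnM -mulrDl in h.
      by rewrite -(ler_pM2r s0) -ler_pdivrMl//; apply: (le_trans h); lra.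
    move=> l lj; have [e|] : l = 0 \/ (exists2 t, (t < j)%N & l = t.+1%:Z \/ l = - t.+1%:Z).
      case: l lj => [[|t]|t] h; [by left|right; exists t => //; by left|].
      by right; exists t => //; right; rewrite NegzE.
      rewrite e u0 sqnE !cE absz0; lra.
    move=> [t tj lE]; have h := key t tj.
    have p1 := sqn_ge0 (u t.+1%:Z); have p2 := sqn_ge0 (u (- t.+1%:Z)).
    by case: lE => ->; rewrite ?abszN absz_nat; lra.
  - move=> l lj.
    have rE : ext (shiftop (tailop a c n) z f) (p%:Z + l) = residual z n p u l * f p.
      rewrite /residual; case E: (p%:Z + l) => [k|k] /=; last by rewrite mul0r.
      rewrite /shiftop /tailop (jacNE _ _ _ (cnB n)).
      rewrite !mulrDl -!mulrA -!uE E /=.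
      have -> : p%:Z + (l + 1) = Posz k.+1 by lia.
      have -> : ext f (p%:Z + (l - 1)) = if k is k'.+1 then f k' else 0.
        have -> : p%:Z + (l - 1) = k%:Z - 1 by lia.
        case: (k) => [|k'] //; have -> : k'.+1%:Z - 1 = k'%:Z by lia.
        by [].
      by case: (k) => [|k'] /=; ring.
    have h : sqn (residual z n p u l) * sqn (f p) <= S2.
      have tj : (absz (l + j%:Z)%R < (2 * j).+1)%N by lia.
      rewrite /S2 (bigD1 (Ordinal tj))//=.
      have -> : (absz (l + j%:Z))%:Z - j%:Z = l by lia.
      by rewrite rE sqnM lerDl; apply: sumr_ge0 => i _; exact: sqn_ge0.
    have h2 : j.+1%:R * (sqn (residual z n p u l) * sqn (f p)) <= j.+1%:R * S2.
      by rewrite ler_pM2l.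
    rewrite -(ler_pM2r s0) -(ler_pM2l j0) [leRHS]mulrA mulfV ?gt_eqF// mul1r; lra.
have [w hw] := choice bad.
by exists (fun j => (w j).1.1), (fun j => (w j).1.2), (fun j => (w j).2).
Qed.

(** Dominated convergence for diagonal operators: the factors are small on a finite set carrying
    most of [psi], and bounded by [K] elsewhere. It turns pointwise convergence of the diagonals
    into strong convergence. *)
Lemma sqnorm_mul_small (x : nat -> nat -> R) (K : R) psi : l2 psi ->
  (forall j i, `|x j i| <= K) -> (forall i, x j i @[j --> \oo] --> (0 : R)) ->
  l2norm (fun i => (x j i)%:C * psi i) @[j --> \oo] --> (0 : R).
Proof.
move=> hpsi xK x0; have K0 : 0 <= K := le_trans (normr_ge0 _) (xK 0%N 0%N).
have K1 : 0 < K ^+ 2 + 1 by rewrite ltr_wpDl// sqr_ge0.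
have N1 : 0 < sqnorm psi + 1 by rewrite ltr_wpDl// sqnorm_ge0.
apply/cvgrPdist_le => e e0.
have q0 : 0 < e ^+ 2 / 4 by rewrite divr_gt0// exprn_gt0.
have [s hs] := cut_approx hpsi (divr_gt0 q0 K1); have {}hs := hs s (fun _ h => h).
have lc := l2_cut s psi; have ld := l2B hpsi lc.
have hx : \forall j \near \oo, forall i, i \in s -> x j i ^+ 2 <= e ^+ 2 / 4 / (sqnorm psi + 1).
  elim: (s) => [|i s' IH]; first exact: filterE.
  have sq0 : 0 < Num.sqrt (e ^+ 2 / 4 / (sqnorm psi + 1)) by rewrite sqrtr_gt0 divr_gt0.
  have /cvgrPdist_le/(_ _ sq0) hl := x0 i.
  apply: filterS2 IH hl => j hj hl i'; rewrite inE => /predU1P[->|/hj//].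
  rewrite -[leRHS]sqr_sqrtr; last by rewrite ltW// divr_gt0.
  rewrite -real_normK ?num_real// lerXn2r ?nnegrE ?sqrtr_ge0//.
  by rewrite sub0r normrN in hl.
apply: filterS hx => j hj; rewrite sub0r normrN ger0_norm ?l2norm_ge0//.
have c1 : 0 <= 2 * (e ^+ 2 / 4 / (sqnorm psi + 1)) by rewrite mulr_ge0// ltW// divr_gt0.
have c2 : 0 <= 2 * K ^+ 2 by rewrite mulr_ge0// sqr_ge0.
have hle i : sqn ((x j i)%:C * psi i) <=
    2 * (e ^+ 2 / 4 / (sqnorm psi + 1)) * sqn (psi i) + 2 * K ^+ 2 * sqn (psi i - cut s psi i).
  rewrite sqnM sqnC /cut; case: ifPn => is_.
    rewrite subrr sqn0 mulr0 addr0 ler_wpM2r ?sqn_ge0//.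
    apply: le_trans (hj i is_) _; rewrite mulrDl mul1r lerDl ltW// divr_gt0//.
  rewrite subr0; apply: le_trans (_ : 2 * K ^+ 2 * sqn (psi i) <= _).
    rewrite ler_wpM2r ?sqn_ge0//.
    apply: le_trans (_ : K ^+ 2 <= _); last by rewrite mulrDl mul1r lerDl sqr_ge0.
    by rewrite -real_normK ?num_real// lerXn2r ?nnegrE.
  by rewrite lerDr mulr_ge0// sqn_ge0.
have [lx Nx] := l2_le2 hpsi ld c1 c2 hle.
rewrite -(@ler_pXn2r _ 2%N) ?nnegrE ?l2norm_ge0//; last exact: ltW.
rewrite -sqnorm_l2norm; apply: le_trans Nx _.
have h1 : e ^+ 2 / 4 / (sqnorm psi + 1) * sqnorm psi <= e ^+ 2 / 4.
  by rewrite mulrAC ler_pdivrMr// ler_wpM2l ?lerDl// ltW.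
have h2 : K ^+ 2 * sqnorm (fun i => psi i - cut s psi i) <= e ^+ 2 / 4.
  apply: le_trans (_ : (K ^+ 2 + 1) * (e ^+ 2 / 4 / (K ^+ 2 + 1)) <= _).
    by apply: ler_pM => //; rewrite ?sqr_ge0 ?sqnorm_ge0// lerDl.
  by rewrite mulrC divfK// gt_eqF.
lra.
Qed.

End LimitExtraction.

Section LimitOperators.
Variable R : realType.
Variables (a B : R) (c : nat -> R).
Hypothesis cB : forall k, `|c k| <= B.

Lemma ccvg_sqn_le (U : set_system nat) {PU : ProperFilter U} (f : nat -> R[i]) l z (e : R) :
  ccvg U f l -> (\forall j \near U, sqn (z - f j) <= e) -> sqn (z - l) <= e.
Proof. by move=> /ccvg_sqn h; exact: cvgr_to_le. Qed.

(** Bounded and unbounded [p] are still treated together: for each [l] exactly one of the two sets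
    in the last clauses belongs to the ultrafilter. The limit diagonal is read around the absolute
    position [p + n] in [J_H]. *)
Lemma limit_solution z : ~ tails_bounded_below a c z ->
  exists (U : set_system nat) (n p : nat -> nat) (u : int -> R[i]) (b : int -> R),
  [/\ UltraFilter U /\ \oo `<=` U, forall j, (j <= n j)%N,
    u 0 = 1 /\ (forall l, sqn (u l) <= 4 * (absz l).+1%:R ^+ 2),
    (forall l, `|b l| <= B) /\
      (forall l, c (absz (l + (p j + n j)%N%:Z)) @[j --> U] --> b l) &
    (forall l, U [set j | (p j)%:Z + l < 0] -> u l = 0) /\
    (forall l, U [set j | 0 <= (p j)%:Z + l] ->
      a%:C * u (l + 1) + a%:C * u (l - 1) + ((b l)%:C - z) * u l = 0)].
Proof.
move=> /(bad_sequences cB)[n [p [u hw]]].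
have [U hU sU] := exists_ultra; have PU : ProperFilter U by exact: ultra_proper.
have large k : \forall j \near U, (k <= j)%N by apply: sU; exists k.
have small (e : R) : 0 < e -> \forall j \near U, j.+1%:R^-1 <= e.
  move=> e0; apply: filterS (large (Num.truncn e^-1)) => j hj.
  rewrite -[leRHS]invrK lef_pV2 ?posrE ?invr_gt0//.
  by apply: ltW; apply: lt_le_trans (truncnS_gt _) _; rewrite ler_nat ltnS.
have ub l : \forall j \near U, sqn (u j l) <= 4 * (absz l).+1%:R ^+ 2.
  by apply: filterS (large (absz l)) => j hj; case: (hw j) => _ _ _ h _; exact: h.
have bnd (r : R[i]) (K : R) : 0 <= K -> sqn r <= 4 * K ^+ 2 ->
    `|complex.Re r| <= 2 * K /\ `|complex.Im r| <= 2 * K.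
  move=> K0; rewrite sqnE (_ : 4 * K ^+ 2 = (2 * K) ^+ 2); last by ring.
  move=> hr; split; rewrite -(@ler_pXn2r _ 2%N)// ?nnegrE ?mulr_ge0//;
    rewrite real_normK ?num_real// (le_trans _ hr)//.
  - by rewrite lerDl sqr_ge0.
  - by rewrite lerDr sqr_ge0.
have ulim l : exists x : R[i], ccvg U (fun j => u j l) x.
  have [x hx] : exists x : R, complex.Re (u j l) @[j --> U] --> x.
    apply: (@ultra_cvg R U (fun j => complex.Re (u j l)) (2 * (absz l).+1%:R)) => //.
    by apply: filterS (ub l) => j /bnd[].
  have [y hy] : exists y : R, complex.Im (u j l) @[j --> U] --> y.
    apply: (@ultra_cvg R U (fun j => complex.Im (u j l)) (2 * (absz l).+1%:R)) => //.
    by apply: filterS (ub l) => j /bnd[].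
  by exists (x +i* y).
have [v hv] := choice ulim.
have blim l : exists x : R, c (absz (l + (p j + n j)%N%:Z)) @[j --> U] --> x.
  by apply: (@ultra_cvg R U _ B) => //; apply: filterE => j; exact: cB.
have [b hb] := choice blim.
exists U, n, p, v, b; split => //.
- by move=> j; case: (hw j).
- split.
    apply/eqP; rewrite eq_sym -subr_eq0; apply/eqP/sqn_eq0/eqP.
    rewrite eq_le sqn_ge0 andbT; apply: (ccvg_sqn_le (hv 0)).
    by apply: filterE => j; case: (hw j) => _ -> _ _ _; rewrite subrr sqn0.
  move=> l; rewrite -[v l]opprK sqnN -[- v l]sub0r; apply: (ccvg_sqn_le (hv l)).
  by apply: filterS (ub l) => j; rewrite sub0r sqnN.
- split=> // l; have /cvg_norm h := hb l; apply: (cvgr_to_le h).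
  by apply: filterE => j; exact: cB.
split.
  move=> l hl; apply: sqn_eq0; apply/eqP; rewrite eq_le sqn_ge0 andbT.
  rewrite -[v l]opprK sqnN -[- v l]sub0r; apply: (ccvg_sqn_le (hv l)).
  by apply: filterS hl => j /= hj; case: (hw j) => _ _ -> //; rewrite subr0 sqn0.
move=> l hl.
pose E j := a%:C * u j (l + 1) + a%:C * u j (l - 1) +
  ((c (absz (l + (p j + n j)%N%:Z)))%:C + - z) * u j l.
have hE : ccvg U E (a%:C * v (l + 1) + a%:C * v (l - 1) + ((b l)%:C + - z) * v l).
  apply: ccvgD; first by apply: ccvgD; apply: ccvgM => //; exact: ccvg_cst.
  by apply: ccvgM => //; apply: ccvgD; [exact: ccvg_real|exact: ccvg_cst].
apply: sqn_eq0; apply/eqP; rewrite eq_le sqn_ge0 andbT.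
apply/ler_addgt0Pr => e e0; rewrite add0r -sqnN -sub0r.
apply: (ccvg_sqn_le hE).
apply: filterS3 hl (large (absz l)) (small e e0) => j /= h1 h2 h3.
rewrite sub0r sqnN; apply: le_trans h3; case: (hw j) => _ _ _ _ /(_ l h2).
rewrite /residual /E; case Ek: ((p j)%:Z + l) h1 => [k|k] // _.
congr (_ <= _); congr sqn; congr (_ + (_%:C - z) * _); congr c; lia.
Qed.

(** Along an ultrafilter [p] is either constant on a member or exceeds every bound on members;
    [extract] then supplies the actual index sequence. *)
Lemma not_bounded_below_limit z : ~ tails_bounded_below a c z ->
  (exists (b : int -> R) (n : nat -> nat), [/\ forall l, `|b l| <= B,
     n j @[j --> \oo] --> \oo,
     forall l, c (absz (l + (n j)%:Z)) @[j --> \oo] --> b l &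
     spectrum (matrix_operator (jacobiZ (fun=> a) b)) z]) \/
  (exists (b : nat -> R) (n : nat -> nat), [/\ forall i, `|b i| <= B,
     (forall j, (1 <= n j)%N) /\ {homo n : i j / (i < j)%N},
     forall psi, l2 psi -> l2norm (fun i => tailop a c (n j) psi i -
       matrix_operator (jacN a b) psi i) @[j --> \oo] --> (0 : R) &
     spectrum (matrix_operator (jacN a b)) z]).
Proof.
move=> /limit_solution[U [n [p [u [b [[hU sU] jn [u0 ub] [bB hb] [uneg ueq]]]]]]].
have PU : ProperFilter U by exact: ultra_proper.
have inv0 k : 0 < k.+1%:R^-1 :> R by rewrite invr_gt0 ltr0n.
have [[s hs]|nop] := pselect (exists s, U [set j | p j = s]).
- right.
  pose b' (k : nat) := b (k%:Z - s%:Z); pose f (k : nat) := u (k%:Z - s%:Z).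
  have b'B k : `|b' k| <= B by exact: bB.
  pose E (k : nat) := [set j | p j = s /\
    forall i, (i <= k)%N -> `|c (i + n j)%N - b' i| <= k.+1%:R^-1].
  have UE k : U (E k).
    apply: (filterI hs).
    apply: (filter_forall_le (A := fun i => [set j | `|c (i + n j)%N - b' i| <= k.+1%:R^-1])) => i.
    have /cvgrPdist_le/(_ _ (inv0 k)) h := hb (i%:Z - s%:Z).
    apply: filterS2 hs h => j /= pj; rewrite distrC /b'; congr (`|c _ - _| <= _); lia.
  have [phi [phiE [phih phij]]] := extract n hU sU UE.
  have hM := jacN_banded a b'B.
  exists b', (fun j => n (phi j)); split=> //.
  + split; first by move=> j; apply: leq_trans (jn _); apply: leq_trans (phij j).
    apply: homo_ltn => [|j]; first exact: ltn_trans.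
    by apply: leq_trans (phih j) (jn _).
  + move=> psi hpsi.
    rewrite (_ : (fun j => _) = (fun j => l2norm (fun i =>
      (c (i + n (phi j))%N - b' i)%:C * psi i))); last first.
      apply/funext => j; congr l2norm; apply/funext => i.
      rewrite /tailop (jacNE _ _ _ (fun i => cB (i + n (phi j)))) (jacNE _ _ _ b'B).
      by rewrite rmorphB /=; ring.
    apply: (@sqnorm_mul_small _ _ (B + B)) => // [j i|i].
      by apply: le_trans (ler_normB _ _) _; rewrite lerD.
    apply: (@cvg_small_from _ _ _ i) => j ij.
    by rewrite subr0; apply: (phiE j j (leqnn _)).2.
  + have bA := band_bop nbN_uniq size_nbN nbN_sym hM.
    have sA := band_sym nbN_uniq size_nbN nbN_sym hM.
    apply/(spectrumP _ bA sA).
    (* Moving the centre from [s] back to 0 costs [|k - s| + 1 <= (s + 1) (k + 1)], whence the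
       constant [4 (s + 1)^2]. The solution is nonzero at [s], where it was normalized. *)
    apply: (@band_growth _ _ _ _ nbN_uniq size_nbN nbN_sym _ _ _ f (fun k => k)
      (4 * s.+1%:R ^+ 2) s hM).
    * by move=> [|k] y; rewrite !inE; lia.
    * move=> k; rewrite -(mopE nbN_uniq _ _ hM) (jacNE _ _ _ b'B).
      have hk : U [set j | 0 <= (p j)%:Z + (k%:Z - s%:Z)].
        by apply: filterS hs => j /= ->; lia.
      have := ueq _ hk; rewrite -/(b' k) -/(f k).
      have -> : k%:Z - s%:Z + 1 = k.+1%:Z - s%:Z by lia.
      rewrite -/(f k.+1).
      have -> : u (k%:Z - s%:Z - 1) = if k is k'.+1 then f k' else 0.
        case: (k) => [|k'].
          by apply: uneg; apply: filterS hs => j /= ->; lia.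
        by congr u; lia.
      by case: (k) => [|k'] h; apply/eqP; rewrite -subr_eq0; apply/eqP;
        rewrite -[RHS]h; ring.
    * move=> m; have fs x : x \notin iota 0 m.+1 -> (if (x <= m)%N then f x else 0) = 0.
        by rewrite mem_iota /= add0n ltnS => /negbTE ->.
      have [l -> ] := fs_bound (iota_uniq 0 m.+1) fs; split => //.
      apply: le_trans (_ : \sum_(x <- iota 0 m.+1) 4 * s.+1%:R ^+ 2 * m.+1%:R ^+ 2 <= _).
        rewrite big_seq [leRHS]big_seq; apply: ler_sum => x.
        rewrite mem_iota /= add0n ltnS => xm; rewrite xm.
        apply: le_trans (ub _) _; rewrite -mulrA ler_wpM2l// -exprMn lerXn2r ?nnegrE ?mulr_ge0//.
        by rewrite -natrM ler_nat; nia.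
      rewrite sum_const_seq size_iota le_eqVlt; apply/orP; left; apply/eqP; ring.
    * by rewrite /f subrr u0 oner_neq0.
- left; pose N' j := (p j + n j)%N.
  (* Discarding finitely many values of [p] pushes the boundary to the left of any [l], so the limit
     equation holds on all of [int]. *)
  have pos l : U [set j | 0 <= (p j)%:Z + l].
    have hne s : U [set j | p j <> s].
      have [h|//] := in_ultra_setVsetC [set j | p j = s] hU.
      by exfalso; apply: nop; exists s.
    apply: filterS (filter_forall_le (absz l) hne) => j /= h.
    rewrite leNgt; apply/negP => pl; apply: (h (p j)) => //; lia.
  pose E (k : nat) := [set j | forall i, (i <= k)%N ->
    `|c (absz (i%:Z + (N' j)%:Z)) - b i%:Z| <= k.+1%:R^-1 /\
    `|c (absz (- i%:Z + (N' j)%:Z)) - b (- i%:Z)| <= k.+1%:R^-1].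
  have UE k : U (E k).
    apply: (filter_forall_le (A := fun i => [set j |
      `|c (absz (i%:Z + (N' j)%:Z)) - b i%:Z| <= k.+1%:R^-1 /\
      `|c (absz (- i%:Z + (N' j)%:Z)) - b (- i%:Z)| <= k.+1%:R^-1])) => i.
    have /cvgrPdist_le/(_ _ (inv0 k)) h1 := hb i%:Z.
    have /cvgrPdist_le/(_ _ (inv0 k)) h2 := hb (- i%:Z).
    by apply: filterS2 h1 h2 => j /= h1 h2; split; rewrite distrC.
  have [phi [phiE [_ phij]]] := extract id hU sU UE.
  have hM := jacZ_banded a bB.
  exists b, (fun j => N' (phi j)); split=> //.
  + move=> P [m _ hm]; exists m => // j /= mj; apply: hm => /=.
    apply: leq_trans (leq_addl _ _); apply: leq_trans (jn _).
    by apply: leq_trans mj _; exact: ltnW (phij j).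
  + move=> l; apply: (@cvg_small_from _ _ _ (absz l)) => j lj.
    have [h1 h2] := phiE j j (leqnn _) _ lj.
    by case: (l) h1 h2 lj => [k|k] h1 h2 _; [exact: h1|rewrite NegzE; exact: h2].
  + have bA := band_bop nbZ_uniq size_nbZ nbZ_sym hM.
    have sA := band_sym nbZ_uniq size_nbZ nbZ_sym hM.
    apply/(spectrumP _ bA sA).
    (* The constant 8: at most [2 (m + 1)] sites, each contributing at most [4 (m + 1)^2]. *)
    apply: (@band_growth _ _ _ _ nbZ_uniq size_nbZ nbZ_sym _ _ _ u absz
      8 0 hM).
    * by move=> x y; rewrite !inE; lia.
    * move=> l; rewrite -(mopE nbZ_uniq _ _ hM) (jacZE _ _ _ bB).
      move: (ueq l (pos l)) => h.
      by apply/eqP; rewrite -subr_eq0; apply/eqP; rewrite -[RHS]h; ring.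
    * move=> m; pose s := [seq (i%:Z - m%:Z)%R | i <- iota 0 (2 * m).+1].
      have us : uniq s by rewrite map_inj_uniq ?iota_uniq// => i i'; lia.
      have ms x : (x \in s) = (absz x <= m)%N.
        apply/mapP/idP => [[k]|xm]; first by rewrite mem_iota; lia.
        by exists (absz (x + m%:Z)%R); rewrite ?mem_iota; lia.
      have fs x : x \notin s -> (if (absz x <= m)%N then u x else 0) = 0.
        by rewrite ms => /negbTE ->.
      have [lu ->] := fs_bound us fs; split => //.
      apply: le_trans (_ : \sum_(x <- s) 4 * m.+1%:R ^+ 2 <= _).
        rewrite big_seq [leRHS]big_seq; apply: ler_sum => x; rewrite ms => xm; rewrite xm.
        by apply: le_trans (ub _) _; rewrite ler_wpM2l// lerXn2r ?nnegrE// ler_nat.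
      rewrite sum_const_seq size_map size_iota.
      have h : (2 * m).+1%:R <= 2 * m.+1%:R :> R by rewrite -natrM ler_nat; lia.
      have -> : 8 * m.+1%:R ^+ 3 = 2 * m.+1%:R * (4 * m.+1%:R ^+ 2) :> R by ring.
      by rewrite ler_wpM2r// mulr_ge0// exprn_ge0.
    * by rewrite u0 oner_neq0.
Qed.

End LimitOperators.

(** * From the tails to the tree *)

Section TreeTails.
Variables (V : choiceType) (adj : rel V) (d : nat).
Hypotheses (htree : regular_tree adj d) (d_gt2 : (2 < d)%N).
Variables (v0 : V) (R : realType) (Q : V -> R) (q : nat -> R).
Hypothesis hq : forall v, Q v = q (gdist adj v v0).+1.
Hypothesis QB : exists M : R, forall v, `|Q v| <= M.

Local Notation lev := (lev adj v0).
Local Notation ch := (ch adj v0).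
Local Notation par := (par adj v0).
Local Notation sph := (sph adj v0).
Local Notation H := (schrodinger adj Q).
Local Notation tail_a := (tail_a d R).
Local Notation jac_a := (jac_a d R).
Local Notation jac_b := (jac_b d q).
Local Notation T := (tailop tail_a jac_b).

Let d_gt1 : (1 < d)%N. Proof. exact: ltnW. Qed.
Let al0 : 0 < tail_a. Proof. exact: (tail_a_gt0 d_gt1). Qed.

Lemma jac_b_bounded : exists M : R, forall k, `|jac_b k| <= M.
Proof.
have [M hM] := QB; exists (M + d%:R) => k.
have [v lv] := sph_neq0 htree v0 k d_gt1.
rewrite -lv -(Q_jac_b d hq) (le_trans (ler_normB _ _))// lerD// normr_nat//.
Qed.

Lemma schrodinger_bop : bounded_operator H.
Proof.
have [M hM] := QB; rewrite (schrodinger_mop htree QB).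
exact: (band_bop (tnb_uniq htree) (size_tnb htree) (tnb_sym htree) (tree_banded htree hM)).
Qed.

Lemma schrodinger_sym : symmetric_op H.
Proof.
have [M hM] := QB; rewrite (schrodinger_mop htree QB).
exact: (band_sym (tnb_uniq htree) (size_tnb htree) (tnb_sym htree) (tree_banded htree hM)).
Qed.

Definition ball (K : nat) : seq V := flatten [seq sph k | k <- iota 0 K].

Lemma mem_ball K v : (v \in ball K) = (lev v < K)%N.
Proof.
apply/flatten_mapP/idP => [[k]|vK].
  by rewrite mem_iota (mem_sph htree) /= add0n => kK /eqP ->.
by exists (lev v); rewrite ?mem_iota// (mem_sph htree).
Qed.

Lemma ball_uniq K : uniq (ball K).
Proof.
rewrite /ball; elim: K => [|K IH] //.
rewrite -addn1 iotaD map_cat flatten_cat cat_uniq {}IH /= cats0 (sph_uniq htree) andbT.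
apply/hasPn => v; rewrite (mem_sph htree) => /eqP lv; apply/negP => /flatten_mapP[k].
by rewrite mem_iota (mem_sph htree) lv /= !add0n => kK /eqP e; rewrite e ltnn in kK.
Qed.

Lemma big_ball (f : V -> R) K : \sum_(v <- ball K) f v = \sum_(k < K) \sum_(v <- sph k) f v.
Proof. by rewrite /ball big_flatten big_map -{1}(subn0 K) -/(index_iota 0 K) big_mkord. Qed.

Lemma fs_ball psi K : (forall v, (K <= lev v)%N -> psi v = 0) ->
  l2 psi /\ sqnorm psi = \sum_(k < K) \sum_(v <- sph k) sqn (psi v) :> R.
Proof.
move=> h; rewrite -big_ball; apply: fs_bound; first exact: ball_uniq.
by move=> v; rewrite mem_ball -leqNgt; exact: h.
Qed.

(** * Tails of the Jacobi matrix inside the tree operator *)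

Section Embedding.
Variables (n : nat) (w0 v1 v2 : V) (s : seq V).
Hypotheses (w0n : (lev w0).+1 = n) (chw0 : ch w0 = [:: v1, v2 & s]).

Let sg0 (v : V) : R := (v == v1)%:R - (v == v2)%:R.
Let sg (v : V) : R := if (lev v < n)%N then 0 else sg0 (iter (lev v - n) par v).

(* The sign sg is 1 below v1, -1 below v2 and 0 elsewhere; these siblings cancel at
   their common parent, so that H acts on emb f as a tail of the Jacobi matrix. *)
Definition emb (f : nat -> R[i]) (v : V) : R[i] :=
  (sg v * tail_a ^- (lev v - n))%:C * f (lev v - n)%N.

Let v12 : v1 != v2.
Proof. by have := ch_uniq adj v0 w0; rewrite chw0 /= inE negb_or => /andP[/andP[]]. Qed.

Let v12F : (v1 == v2) = false. Proof. exact: negbTE. Qed.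

Let v21F : (v2 == v1) = false. Proof. by rewrite eq_sym. Qed.

Let sg_ch u c : c \in ch u -> (n <= lev u)%N -> sg c = sg u.
Proof.
move=> cu nu; rewrite /sg (ch_lev htree cu) !ltnNge nu (leqW nu) /=.
by rewrite subSn// iterSr (par_ch htree cu).
Qed.

Let sg_sum u : (lev u < n)%N -> \sum_(c <- ch u) sg c = 0.
Proof.
move=> un; have [un'|nu] := ltnP (lev u).+1 n.
  by rewrite big_seq big1// => c cu; rewrite /sg (ch_lev htree cu) un'.
have E : (lev u).+1 = n by apply/eqP; rewrite eqn_leq un nu.
transitivity (\sum_(c <- ch u) sg0 c).
  by apply: eq_big_seq => c cu; rewrite /sg (ch_lev htree cu) E ltnn subnn.
rewrite /sg0; have [->|uw] := eqVneq u w0.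
  have := ch_uniq adj v0 w0; rewrite chw0 /= !inE negb_or => /and3P[/andP[_ h1] h2 _].
  rewrite !big_cons !eqxx v12F v21F big_seq big1.
    by rewrite addr0; ring.
  by move=> c cs; do 2 (case: eqVneq => [e|_]; first by rewrite -e cs in h1 h2); ring.
rewrite big_seq big1// => c cu.
have h v : v \in ch w0 -> (c == v) = false.
  by move=> vw; apply/eqP => e; rewrite -(par_ch htree cu) e (par_ch htree vw) eqxx in uw.
by rewrite !h ?chw0 ?inE ?eqxx ?orbT// subrr.
Qed.

Let emb_sum f u : \sum_(c <- ch u) emb f c = if (lev u < n)%N then 0 else
  (tail_a * (sg u * tail_a ^- (lev u - n)))%:C * f (lev u - n).+1.
Proof.
case: ltnP => un.
  transitivity ((\sum_(c <- ch u) sg c)%:C *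
      ((tail_a ^- ((lev u).+1 - n))%:C * f ((lev u).+1 - n)%N)).
    rewrite rmorph_sum mulr_suml; apply: eq_big_seq => c cu.
    by rewrite /emb (ch_lev htree cu) rmorphM mulrA.
  by rewrite sg_sum// mul0r.
transitivity (\sum_(c <- ch u) (sg u * tail_a ^- (lev u - n).+1)%:C * f (lev u - n).+1).
  apply: eq_big_seq => c cu.
  by rewrite /emb (ch_lev htree cu) subSn// (sg_ch cu un).
have u0 : (u == v0) = false.
  by apply/eqP => e; rewrite e (lev_root htree) -w0n in un.
rewrite realC_sum_const (size_ch htree) u0 -(sqr_tail_a d R) mulrA -rmorphM /=.
congr (_%:C * _); rewrite [tail_a ^+ (lev u - n).+1]exprSr; field.
by rewrite expf_neq0 ?gt_eqF.
Qed.

Lemma schrodinger_emb f : H (emb f) = emb (T n f).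
Proof.
have [M hM] := jac_b_bounded.
apply/funext => u; rewrite {2}/emb /tailop (jacNE _ _ _ (fun i => hM (i + n)%N)).
have sum := emb_sum f u.
have [un|nu] := ltnP (lev u) n.
  rewrite un in sum; rewrite {1}/sg un mul0r rmorph0 mul0r.
  have e0 v : (lev v < n)%N -> emb f v = 0 by move=> vn; rewrite /emb /sg vn mul0r rmorph0 mul0r.
  case: (eqVneq u v0) => [e|u0].
    by move: sum un; rewrite e => sum un; rewrite (schrodinger_root htree) sum e0// mulr0 addr0.
  rewrite (schrodinger_ch htree _ _ u0) sum !e0 ?mulr0 ?addr0//.
  by have := ch_lev htree (ch_par htree u0); move: un => /[swap] ->; exact: ltnW.
rewrite ltnNge nu /= in sum.
have u0 : u != v0.
  by apply/eqP => e; rewrite e (lev_root htree) -w0n in nu.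
have up := ch_par htree u0; have lp := ch_lev htree up.
rewrite (schrodinger_ch htree _ _ u0) sum (Q_jac_b d hq) /emb subnK//.
case E: (lev u - n)%N => [|k].
  have pn : (lev (par u) < n)%N by move: lp E nu; lia.
  have -> : sg (par u) = 0 by rewrite /sg pn.
  by rewrite mul0r rmorph0 mul0r !rmorphM /=; ring.
have pn : (n <= lev (par u))%N by move: lp E nu; lia.
have -> : (lev (par u) - n)%N = k by move: lp E; lia.
rewrite -(sg_ch up pn).
have -> : tail_a ^- k = tail_a * tail_a ^- k.+1.
  by rewrite [tail_a ^+ k.+1]exprSr; field; rewrite expf_neq0 ?gt_eqF.
by rewrite !rmorphM /=; ring.
Qed.

Lemma shift_emb z f : shiftop H z (emb f) = emb (shiftop (T n) z f).
Proof. by rewrite /shiftop schrodinger_emb; apply/funext => u; rewrite /emb; ring. Qed.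

(** In generation [n + k] the sign is nonzero exactly on the [2 (d-1)^k] descendants of [v1] and
    [v2]. *)
Let sg_sq k : \sum_(v <- sph (n + k)) sg v ^+ 2 = 2 * (tail_a ^+ 2) ^+ k.
Proof.
elim: k => [|k IH].
  rewrite addn0 expr0 mulr1 -w0n big_sph.
  have wl : w0 \in sph (lev w0) by rewrite (mem_sph htree).
  have sE u c : lev u = lev w0 -> c \in ch u -> sg c = sg0 c.
    by move=> lu cu; rewrite /sg (ch_lev htree cu) lu -w0n ltnn subnn.
  rewrite (bigD1_seq w0 wl (sph_uniq htree v0 (lev w0)))/=.
  rewrite [X in _ + X]big_seq_cond [X in _ + X]big1 ?addr0.
    transitivity (\sum_(c <- ch w0) sg0 c ^+ 2).
      by apply: eq_big_seq => c cw; rewrite (sE w0).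
    have := ch_uniq adj v0 w0; rewrite chw0 /= !inE negb_or => /and3P[/andP[_ h1] h2 _].
    rewrite /sg0 !big_cons !eqxx v12F v21F big_seq big1.
      by rewrite addr0 /= !(subr0, sub0r) sqrrN !expr1n.
    by move=> c cs; do 2 (case: eqVneq => [e|_]; first by rewrite -e cs in h1 h2); ring.
  move=> u /andP[]; rewrite (mem_sph htree) => /eqP lu uw.
  rewrite big_seq big1// => c cu; rewrite (sE u)//.
  have h v : v \in ch w0 -> (c == v) = false.
    by move=> vw; apply/eqP => e; rewrite -(par_ch htree cu) e (par_ch htree vw) eqxx in uw.
  by rewrite /sg0 !h ?chw0 ?inE ?eqxx ?orbT// subrr expr0n.
rewrite addnS big_sph exprS mulrCA -IH mulr_sumr; apply: eq_big_seq => u.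
rewrite (mem_sph htree) => /eqP lu.
have nu : (n <= lev u)%N by rewrite lu leq_addr.
have u0 : (u == v0) = false.
  by apply/eqP => e; rewrite e (lev_root htree) -w0n in nu.
transitivity (\sum_(c <- ch u) sg u ^+ 2).
  by apply: eq_big_seq => c cu; rewrite (sg_ch cu nu).
by rewrite sum_const_seq (size_ch htree) u0 sqr_tail_a.
Qed.

(** The powers of [tail_a] compensate the growth of the generations, so each of the two branches
    reproduces [|f|^2]; the factor 2 drops out of the comparison with [H - z]. *)
Lemma sqnorm_emb f K : (forall k, (K <= k)%N -> f k = 0) ->
  l2 (emb f) /\ sqnorm (emb f) = 2 * sqnorm f.
Proof.
move=> fK.
have [_ ->] : l2 f /\ sqnorm f = \sum_(x <- iota 0 K) sqn (f x).
  by apply: fs_bound; [exact: iota_uniq|move=> k; rewrite mem_iota /= -leqNgt add0n; exact: fK].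
have [|l ->] := @fs_ball (emb f) (n + K).
  by move=> v nK; rewrite /emb fK ?mulr0//; lia.
split=> //; rewrite big_split_ord /= big1 ?add0r; last first.
  move=> i _; rewrite big_seq big1// => v; rewrite (mem_sph htree) => /eqP lv.
  by rewrite /emb /sg lv ltn_ord mul0r rmorph0 mul0r sqn0.
have -> : \sum_(x <- iota 0 K) sqn (f x) = \sum_(k < K) sqn (f k).
  by rewrite -(big_mkord xpredT (fun k => sqn (f k))) /index_iota subn0.
rewrite mulr_sumr; apply: eq_bigr => k _.
transitivity (\sum_(v <- sph (n + k)) (tail_a ^- k) ^+ 2 * sqn (f k) * sg v ^+ 2).
  apply: eq_big_seq => v; rewrite (mem_sph htree) => /eqP lv.
  rewrite /emb lv addKn sqnM sqnC exprMn; ring.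
rewrite -mulr_sumr sg_sq exprAC; field.
by rewrite expf_neq0 ?gt_eqF.
Qed.

End Embedding.

(** A vector embedded at generation [n] vanishes on all earlier generations, hence on [s] once [n]
    exceeds every level in [s]. *)
Lemma tails_far_singular z : ~ tails_bounded_below tail_a jac_b z -> far_singular H z.
Proof.
move=> nUB s c c0; have [M hM] := jac_b_bounded.
pose n0 := (\max_(v <- s) lev v).+1.
have [n [f [nn hf hlt]]] : exists n f, [/\ (n0 <= n)%N, l2 f &
    sqnorm (shiftop (T n) z f) < c * sqnorm f].
  apply: contrapT => h; apply: nUB; exists n0, c^-1; split; first by rewrite invr_gt0.
  move=> n f nn hf; rewrite mulrC ler_pdivlMr// mulrC leNgt; apply/negP => hlt.
  by apply: h; exists n, f.
have bT : bounded_operator (T n) by exact: (tail_bop tail_a hM).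
have [s' hs'] := cut_below (bop_shift z bT) hf hlt.
set g := cut s' f in hs'.
pose K := (\max_(k <- s') k).+1.
have gK k : (K <= k)%N -> g k = 0.
  rewrite /g /cut; case: ifPn => // ks Kk; exfalso.
  have : (k < K)%N by rewrite /K ltnS; exact: leq_bigmax_seq.
  by rewrite ltnNge Kk.
have [w0 lw0] := sph_neq0 htree v0 n.-1 d_gt1.
have n_gt0 : (0 < n)%N by apply: leq_trans nn.
have w0n : (lev w0).+1 = n by rewrite lw0 prednK.
(* Here [d > 2] enters: every vertex has at least [d - 1 >= 2] children, so the cancelling pair
   exists. *)
have sz : (1 < size (ch w0))%N.
  by rewrite (size_ch htree); case: ifP => _ //; rewrite -subn1 ltn_subRL.
have [v1 [v2 [t chw0]]] : exists v1 v2 t, ch w0 = [:: v1, v2 & t].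
  by case: (ch w0) sz => [|v1 [|v2 t]] // _; exists v1, v2, t.
have [le Ne] := sqnorm_emb w0n chw0 gK.
exists (emb n v1 v2 g); split => //.
  move=> v vs; rewrite /emb ifT ?mul0r ?rmorph0 ?mul0r//.
  apply: leq_trans nn; rewrite ltnS; exact: leq_bigmax_seq.
rewrite (shift_emb w0n chw0) Ne.
have [|_ ->] := @sqnorm_emb _ _ _ _ _ w0n chw0 (shiftop (T n) z g) K.+1.
  move=> k Kk; rewrite /shiftop /tailop (jacNE _ _ _ (fun i => hM (i + n)%N)).
  rewrite !gK ?leqW// 1?ltnW// !mulr0 subr0 !add0r.
  by case: k Kk => [|k] Kk; rewrite ?gK ?mulr0.
by rewrite mulrCA ltr_pM2l.
Qed.

End TreeTails.

(** * From the tree to the tails *)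

Section TreeAverages.
Variables (V : choiceType) (adj : rel V) (d : nat).
Hypotheses (htree : regular_tree adj d) (d_gt2 : (2 < d)%N).
Variables (v0 : V) (R : realType) (Q : V -> R) (q : nat -> R).
Hypothesis hq : forall v, Q v = q (gdist adj v v0).+1.
Hypothesis QB : exists M : R, forall v, `|Q v| <= M.

Local Notation lev := (lev adj v0).
Local Notation ch := (ch adj v0).
Local Notation par := (par adj v0).
Local Notation sph := (sph adj v0).
Local Notation H := (schrodinger adj Q).
Local Notation tail_a := (tail_a d R).
Local Notation jac_a := (jac_a d R).
Local Notation jac_b := (jac_b d q).
Local Notation T := (tailop tail_a jac_b).

Let d_gt1 : (1 < d)%N. Proof. exact: ltnW. Qed.
Let al0 : 0 < tail_a. Proof. exact: (tail_a_gt0 d_gt1). Qed.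


Let coB : exists M : R, forall k, `|jac_b k| <= M.
Proof. exact: (jac_b_bounded htree d_gt2 hq QB). Qed.

Lemma variance (s : seq V) (f : V -> R[i]) (m : R) : m != 0 -> (size s)%:R = m ->
  \sum_(c <- s) sqn (f c) = m^-1 * sqn (\sum_(c <- s) f c) +
    \sum_(c <- s) sqn (f c - m^-1%:C * \sum_(c' <- s) f c').
Proof.
move=> m0 sm; set S := \sum_(c <- s) f c.
have E c : sqn (f c - m^-1%:C * S) = sqn (f c) + (m^-1 ^+ 2 * sqn S
   - 2 * m^-1 * (complex.Re S * complex.Re (f c) + complex.Im S * complex.Im (f c))).
  by rewrite !sqnE !cE; ring.
rewrite (eq_bigr _ (fun c _ => E c)) big_split /= sumrB sum_const_seq sm.
rewrite -mulr_sumr big_split /= -!mulr_sumr -Re_sum -Im_sum -/S !sqnE; field.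
exact: m0.
Qed.

(* The normalized mean of psi over the k-th generation of descendants of v,
   i.e. its inner product with the normalized indicator of that generation. *)
Fixpoint avg (psi : V -> R[i]) (k : nat) (v : V) : R[i] :=
  if k is j.+1 then (jac_a (lev v))^-1%:C * \sum_(c <- ch v) avg psi j c else psi v.

(** For fixed [c] the sequence in [k] is the component on which [H] acts as the tail of index
    [lev c]. Components of siblings sum to zero, a redundancy that does not affect the identity for
    square sums. *)
Definition dev (psi : V -> R[i]) (k : nat) (c : V) : R[i] :=
  avg psi k c - (size (ch (par c)))%:R^-1%:C * \sum_(c' <- ch (par c)) avg psi k c'.

Let gaE v : jac_a (lev v) ^+ 2 = (size (ch v))%:R.
Proof.
rewrite (size_ch htree) /jac_a; case: (eqVneq v v0) => [->|vv0].
  by rewrite (lev_root htree) eqxx sqr_sqrtr.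
by have [u _ <-] := lev_prev htree vv0; rewrite sqr_tail_a.
Qed.

Let ga0 k : 0 < jac_a k. Proof. exact: (jac_a_gt0 d_gt1). Qed.

Let sch0 v : (size (ch v))%:R != 0 :> R.
Proof. by rewrite -gaE expf_neq0// gt_eqF. Qed.

Lemma avg_zero psi k v : (forall u, lev u = (lev v + k)%N -> psi u = 0) ->
  avg psi k v = 0.
Proof.
elim: k v => [|k IH] v h /=; first by apply: h; rewrite addn0.
rewrite big_seq big1 ?mulr0// => c cv; apply: IH => u lu; apply: h.
by rewrite lu (ch_lev htree cv) addSnnS.
Qed.

Lemma avg_lin (x : R[i]) psi phi k v :
  avg (fun u => phi u - x * psi u) k v = avg phi k v - x * avg psi k v.
Proof.
elim: k v => [|k IH] v //=.
rewrite (eq_bigr _ (fun c _ => IH c)) sumrB -mulr_sumr; ring.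
Qed.

Lemma dev_lin (x : R[i]) psi phi k c :
  dev (fun u => phi u - x * psi u) k c = dev phi k c - x * dev psi k c.
Proof.
rewrite /dev avg_lin (eq_bigr _ (fun c' _ => avg_lin x psi phi k c')) sumrB -mulr_sumr.
ring.
Qed.

Lemma avg_variance psi k w : \sum_(c <- ch w) sqn (avg psi k c) =
  sqn (avg psi k.+1 w) + \sum_(c <- ch w) sqn (dev psi k c).
Proof.
rewrite (variance (avg psi k) (sch0 w) erefl); congr (_ + _).
  by rewrite /= sqnM sqnC exprVn gaE.
by apply: eq_big_seq => c cw; rewrite /dev (par_ch htree cw).
Qed.

(** Parseval's identity for the splitting: [avg_variance] moves the square sums of one generation to
    its parents and splits off the deviations; iterating up to the root telescopes. *)
Lemma level_decomposition psi K :
  \sum_(j < K) \sum_(v <- sph j) sqn (psi v) =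
  \sum_(k < K) sqn (avg psi k v0) +
  \sum_(j < K) \sum_(c <- sph j.+1) \sum_(k < K - j.+1) sqn (dev psi k c).
Proof.
pose X j k := \sum_(v <- sph j) sqn (avg psi k v).
pose Y j := \sum_(k < K - j) X j k.
pose W j := \sum_(c <- sph j.+1) \sum_(k < K - j.+1) sqn (dev psi k c).
have XS j k : X j.+1 k = X j k.+1 + \sum_(c <- sph j.+1) sqn (dev psi k c).
  rewrite /X !big_sph -big_split /=; apply: eq_bigr => w _; exact: avg_variance.
have YS j : (j < K)%N -> X j 0%N = Y j - Y j.+1 + W j.
  move=> jK; rewrite /Y /W [X in _ = _ + X]exchange_big /=.
  have -> : (K - j = (K - j.+1).+1)%N by rewrite subnSK.
  have -> : \sum_(k < (K - j.+1).+1) X j k = X j 0%N + \sum_(k < K - j.+1) X j k.+1.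
    by rewrite big_ord_recl.
  have -> : \sum_(k < K - j.+1) X j.+1 k = \sum_(k < K - j.+1) X j k.+1 +
      \sum_(k < K - j.+1) \sum_(c <- sph j.+1) sqn (dev psi k c).
    by rewrite -big_split; apply: eq_bigr => k _; exact: XS.
  ring.
transitivity (\sum_(j < K) (Y j - Y j.+1 + W j)).
  by apply: eq_bigr => j _; rewrite -YS.
rewrite big_split /=; congr (_ + _).
rewrite -(big_mkord xpredT (fun j => Y j - Y j.+1)).
have -> : \sum_(0 <= j < K) (Y j - Y j.+1) = - \sum_(0 <= j < K) (Y j.+1 - Y j).
  by rewrite -sumrN; apply: eq_bigr => j _; rewrite opprB.
rewrite telescope_sumr// opprB /Y subnn big_ord0 subr0 subn0.
by apply: eq_bigr => k _; rewrite /X /= big_seq1.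
Qed.

(** Averaging commutes with [H] up to a tridiagonal action on [k]; the value at the parent enters
    only for [k = 0] and is the boundary term treated in [dev_sch]. *)
Lemma avg_sch psi k v : v != v0 -> avg (H psi) k v =
  tail_a%:C * avg psi k.+1 v + (jac_b (lev v + k))%:C * avg psi k v +
  (if k is j.+1 then tail_a%:C * avg psi j v else psi (par v)).
Proof.
have gal w : w != v0 -> jac_a (lev w) = tail_a.
  by move=> w0; have [u _ <-] := lev_prev htree w0.
have al1 : tail_a%:C * (tail_a^-1)%:C = 1 :> R[i] by rewrite -rmorphM /= mulfV// gt_eqF.
elim: k v => [|k IH] v vv0.
  rewrite /= (schrodinger_ch htree _ _ vv0) (Q_jac_b d hq) gal// addn0 mulrA al1 mul1r.
  ring.
have cv0 c : c \in ch v -> c != v0.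
  by move=> cv; apply/eqP => e; have := ch_lev htree cv; rewrite e (lev_root htree).
have E c : c \in ch v -> avg (H psi) k c =
    tail_a%:C * avg psi k.+1 c + (jac_b (lev v + k.+1))%:C * avg psi k c +
    (if k is j.+1 then tail_a%:C * avg psi j c else psi v).
  move=> cv; rewrite IH ?cv0// (ch_lev htree cv) addSnnS.
  by case: (k) => // ; rewrite (par_ch htree cv).
rewrite [LHS]/= (eq_big_seq _ E) !big_split /= -!mulr_sumr !mulrDr.
have -> : \sum_(c <- ch v) (jac_a (lev c))^-1%:C * \sum_(c' <- ch c) avg psi k c' =
    \sum_(c <- ch v) avg psi k.+1 c by [].
rewrite gal//; congr (_ + _ + _); [ring|ring|].
case: k {IH E} => [|k]; last by rewrite -mulr_sumr /= gal//; ring.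
rewrite realC_sum_const -gaE gal// mulrA -rmorphM /=; congr (_%:C * _).
by field; rewrite gt_eqF.
Qed.

(** The boundary term in [avg_sch] is the value at the common parent; it is the same for all
    siblings and cancels in the deviation, leaving a matrix with a free left end. *)
Lemma dev_sch psi n : forall c, lev c = n.+1 ->
  (fun k => dev (H psi) k c) = T n.+1 (fun k => dev psi k c).
Proof.
move=> c lc; have [M hM] := coB; apply/funext => k.
rewrite /tailop (jacNE _ _ _ (fun i => hM (i + n.+1)%N)).
have c0 : c != v0 by apply/eqP => e; rewrite e (lev_root htree) in lc.
have cp := ch_par htree c0; set w := par c in cp.
have E c' : c' \in ch w -> avg (H psi) k c' =
    tail_a%:C * avg psi k.+1 c' + (jac_b (k + n.+1))%:C * avg psi k c' +
    (if k is j.+1 then tail_a%:C * avg psi j c' else psi w).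
  move=> cw; rewrite avg_sch; last first.
    by apply/eqP => e; have := ch_lev htree cw; rewrite e (lev_root htree).
  rewrite (ch_lev htree cw) -(ch_lev htree cp) lc addnC.
  by case: (k) => //; rewrite (par_ch htree cw).
rewrite /dev -/w E// (eq_big_seq _ E) !big_split /= -!mulr_sumr.
case: k {E} => [|k]; last by rewrite -mulr_sumr; ring.
rewrite realC_sum_const.
have m1 : (size (ch w))%:R^-1%:C * (size (ch w))%:R%:C = 1 :> R[i].
  by rewrite -rmorphM /= mulVf.
have -> : tail_a%:C * avg psi 1 c = tail_a%:C * avg psi 1 c by [].
transitivity (tail_a%:C * avg psi 1 c + (jac_b (0 + n.+1))%:C * psi c + psi w -
  ((size (ch w))%:R^-1%:C * (tail_a%:C * (\sum_(i <- ch w) avg psi 1 i)) +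
   (size (ch w))%:R^-1%:C * ((jac_b (0 + n.+1))%:C * \sum_(i <- ch w) psi i) +
   (size (ch w))%:R^-1%:C * (size (ch w))%:R%:C * psi w)).
  by rewrite /=; ring.
by rewrite m1 /=; ring.
Qed.

(** Starting the averages at [k = 1] bypasses the exceptional entry sqrt(d): the coupling to index 0
    is lost because [psi] vanishes at the root. *)
Lemma root_sch psi : psi v0 = 0 ->
  (fun k => avg (H psi) k.+1 v0) = T 1%N (fun k => avg psi k.+1 v0).
Proof.
move=> p0; have [M hM] := coB; apply/funext => k.
rewrite /tailop (jacNE _ _ _ (fun i => hM (i + 1)%N)).
have E c : c \in ch v0 -> avg (H psi) k c =
    tail_a%:C * avg psi k.+1 c + (jac_b (k + 1))%:C * avg psi k c +
    (if k is j.+1 then tail_a%:C * avg psi j c else 0).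
  move=> cv; rewrite avg_sch; last first.
    by apply/eqP => e; have := ch_lev htree cv; rewrite e (lev_root htree).
  rewrite (ch_lev htree cv) (lev_root htree) addnC.
  by case: (k) => //; rewrite (par_ch htree cv) p0.
rewrite [LHS]/= (eq_big_seq _ E) !big_split /= -!mulr_sumr !mulrDr.
have -> : \sum_(c <- ch v0) (jac_a (lev c))^-1%:C * \sum_(c' <- ch c) avg psi k c' =
    \sum_(c <- ch v0) avg psi k.+1 c by [].
case: k {E} => [|k] /=; last by rewrite -mulr_sumr; ring.
have -> : \sum_(i <- ch v0) 0 = 0 :> R[i] by rewrite big1.
ring.
Qed.

(** Tails with [n < N0] are not covered by the uniform bound, but on functions vanishing before
    generation [N0] they act as the tail [N0], except for one additional row, which only increases
    the right-hand side. *)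
Lemma shift_tail_far z (N0 n : nat) (C : R) : 0 < C ->
  (forall m f, (N0 <= m)%N -> l2 f -> sqnorm f <= C * sqnorm (shiftop (T m) z f)) ->
  forall f, l2 f -> (forall k, (n + k < N0)%N -> f k = 0) ->
  sqnorm f <= C * sqnorm (shiftop (T n) z f).
Proof.
move=> C0 hUB f hf f0; have [nN|Nn] := leqP N0 n; first exact: hUB.
have [M hM] := coB.
have bT k : bounded_operator (T k) by exact: (tail_bop tail_a hM).
pose m := (N0 - n)%N; pose g k := f (k + m)%N.
have [lg _] : l2 g /\ sqnorm g <= sqnorm f.
  by apply: (@sqnorm_pull_le _ _ _ f g (fun k => (k + m)%N)) => // k k' _ _ /addIn.
have [_ Nfg] : l2 f /\ sqnorm f <= sqnorm g.
  have fm k : f k != 0 -> (m <= k)%N.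
    move=> fk; rewrite leqNgt; apply/negP => km; move: fk; rewrite f0 ?eqxx//.
    by rewrite /m in km; lia.
  apply: (@sqnorm_pull_le _ _ _ g f (fun k => (k - m)%N)) => //.
    by move=> k /fm mk; rewrite /g subnK.
  by move=> k k' /fm mk /fm mk'; lia.
apply: (le_trans Nfg); apply: (le_trans (hUB N0 g (leqnn _) lg)).
rewrite ler_pM2l//.
have sh : l2 (shiftop (T n) z f) by apply: bop_l2 => //; exact: bop_shift.
have [] // := @sqnorm_pull_le _ _ _ (shiftop (T n) z f) (shiftop (T N0) z g)
  (fun k => (k + m)%N) sh; last by move=> k k' _ _ /addIn.
move=> k _; rewrite le_eqVlt; apply/orP; left; apply/eqP; congr sqn.
rewrite /shiftop /tailop (jacNE _ _ _ (fun i => hM (i + N0)%N))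
  (jacNE _ _ _ (fun i => hM (i + n)%N)) /g.
have -> : (k + m + n = k + N0)%N by rewrite /m; lia.
congr (_ + _ + _ * _ - _).
case: k => [|k] //; rewrite add0n.
have : (0 < m)%N by rewrite /m subn_gt0.
case E: m => [//|m'] _; apply/esym/f0; rewrite /m in E; lia.
Qed.

(** Both [psi] and [(H - z) psi] are split by [level_decomposition]. Their components correspond
    under the tails, and the estimates for the components add up to one for [H - z]. *)
Lemma tails_far_bounded_below z : tails_bounded_below tail_a jac_b z -> ~ far_singular H z.
Proof.
(* [N0 >= 1] puts the root into the ball, so that [psi v0 = 0] as [root_sch] requires. *)
move=> [n0 [C [C0 hUB]]] hfar; pose N0 := maxn n0 1.
have [M hM] := coB.
have bT k : bounded_operator (T k) by exact: (tail_bop tail_a hM).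
have bH := schrodinger_bop htree QB.
have hUB' m f : (N0 <= m)%N -> l2 f -> sqnorm f <= C * sqnorm (shiftop (T m) z f).
  by move=> Nm; apply: hUB; apply: leq_trans Nm; exact: leq_maxl.
have Ci : 0 < C^-1 by rewrite invr_gt0.
have [psi0 [lpsi0 zpsi0 hN0]] := hfar (ball adj v0 N0) C^-1 Ci.
have [s hs] := cut_below (bop_shift z bH) lpsi0 hN0.
set psi := cut s psi0 in hs.
(* [psi] vanishes from generation [K.-1] on; [(H - z) psi] spreads one generation further and
   vanishes from [K] on. *)
pose K := (\max_(v <- s) lev v).+2.
have psiK v : (K.-1 <= lev v)%N -> psi v = 0.
  rewrite /psi /cut; case: ifPn => // vs Kv; exfalso.
  have : (lev v < K.-1)%N by rewrite /K /= ltnS; exact: leq_bigmax_seq.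
  by rewrite ltnNge Kv.
have psiN v : (lev v < N0)%N -> psi v = 0.
  move=> vN; rewrite /psi /cut; case: ifP => // _; apply: zpsi0.
  by rewrite (mem_ball htree).
pose phi := shiftop H z psi.
have phiK v : (K <= lev v)%N -> phi v = 0.
  move=> Kv; have p0 : psi v = 0 by apply: psiK; apply: leq_trans Kv; exact: leqnSn.
  rewrite /phi /shiftop p0 (schrodinger_nb htree) p0 !mulr0 subr0 addr0.
  rewrite big_seq big1// => u; rewrite (mem_nb htree) => vu; apply: psiK.
  by have := lev_adj htree v0 vu; rewrite /K /= in Kv *; lia.
have psiK' v : (K <= lev v)%N -> psi v = 0.
  by move=> Kv; apply: psiK; apply: leq_trans Kv; exact: leqnSn.
have [_ Npsi] := fs_ball htree psiK'.
have [_ Nphi] := fs_ball htree phiK.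
rewrite level_decomposition in Npsi; rewrite level_decomposition in Nphi.
have p0 : psi v0 = 0.
  by apply: psiN; rewrite (lev_root htree) leq_max orbT.
have fsum (f : nat -> R[i]) m : (forall k, (m <= k)%N -> f k = 0) ->
    l2 f /\ sqnorm f = \sum_(k < m) sqn (f k).
  move=> hf; have [||l ->] := @fs_bound _ _ f (iota 0 m).
  - exact: iota_uniq.
  - by move=> k; rewrite mem_iota /= -leqNgt add0n; exact: hf.
  by split=> //; rewrite -(big_mkord xpredT (fun k => sqn (f k))) /index_iota subn0.
suff : sqnorm psi <= C * sqnorm phi.
  by rewrite leNgt -ltr_pdivlMl// hs.
rewrite Npsi Nphi mulrDr; apply: lerD.
  pose g k := avg psi k.+1 v0; pose h k := avg phi k.+1 v0.
  have gK k : (K.-1 <= k)%N -> g k = 0.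
    move=> Kk; apply: avg_zero => u lu; apply: psiK; rewrite lu (lev_root htree) add0n.
    exact: leq_trans Kk _.
  have hK k : (K.-1 <= k)%N -> h k = 0.
    by move=> Kk; apply: avg_zero => u lu; apply: phiK; rewrite lu (lev_root htree) add0n.
  have [lg Ng] := fsum g _ gK; have [_ Nh] := fsum h _ hK.
  have gh : shiftop (T 1%N) z g = h.
    rewrite /shiftop /g -root_sch//; apply/funext => k.
    by rewrite /h /phi /shiftop avg_lin.
  have KS (f : nat -> R) : \sum_(k < K) f k = f 0%N + \sum_(k < K.-1) f k.+1.
    by rewrite /K big_ord_recl.
  rewrite (KS (fun k => sqn (avg psi k v0))) (KS (fun k => sqn (avg phi k v0))) /=.
  rewrite p0 sqn0 add0r mulrDr.
  apply: le_trans (_ : C * sqnorm h <= _); last first.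
    by rewrite Nh lerDr mulr_ge0 ?sqn_ge0// ltW.
  rewrite -gh; apply: le_trans (_ : sqnorm g <= _); first by rewrite Ng.
  apply: (shift_tail_far C0 hUB' lg) => k kN; apply: avg_zero => u lu.
  by apply: psiN; rewrite lu (lev_root htree).
rewrite mulr_sumr; apply: ler_sum => j _; rewrite mulr_sumr big_seq [leRHS]big_seq.
apply: ler_sum => c; rewrite (mem_sph htree) => /eqP lc.
pose g k := dev psi k c; pose h k := dev phi k c.
have sib c' : c' \in ch (par c) -> lev c' = lev c.
  have c0 : c != v0 by apply/eqP => e; rewrite e (lev_root htree) in lc.
  by move=> /(ch_lev htree) ->; rewrite (ch_lev htree (ch_par htree c0)).
have dev0 f k : (forall u, lev u = (lev c + k)%N -> f u = 0) -> dev f k c = 0.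
  move=> f0; rewrite /dev avg_zero// big_seq big1 ?mulr0 ?subr0// => c' /sib lc'.
  by apply: avg_zero => u lu; apply: f0; rewrite lu lc'.
have gK k : (K - j.+1 <= k)%N -> g k = 0.
  by move=> Kk; apply: dev0 => u lu; apply: psiK'; rewrite lu lc; lia.
have hK k : (K - j.+1 <= k)%N -> h k = 0.
  by move=> Kk; apply: dev0 => u lu; apply: phiK; rewrite lu lc; lia.
have [lg Ng] := fsum g _ gK; have [_ Nh] := fsum h _ hK.
have gh : shiftop (T j.+1) z g = h.
  rewrite /shiftop /g -(dev_sch psi lc); apply/funext => k.
  by rewrite /h /phi /shiftop dev_lin.
rewrite -Ng -Nh -gh; apply: (shift_tail_far C0 hUB' lg) => k kN.
by apply: dev0 => u lu; apply: psiN; rewrite lu lc.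
Qed.

End TreeAverages.

Lemma normc_realB (R : realType) (x y : R) : normc (x%:C - y%:C) = `|x - y|.
Proof. by rewrite /normc /= subrr expr0n addr0 sqrtr_sqr. Qed.

(** * Limit operators of the Jacobi matrix and the essential spectrum *)

Section EssentialSpectrumOfTree.
Variables (V : choiceType) (adj : rel V) (d : nat).
Hypotheses (htree : regular_tree adj d) (d_gt2 : (2 < d)%N).
Variables (v0 : V) (R : realType) (Q : V -> R) (q : nat -> R).
Hypothesis hq : forall v, Q v = q (gdist adj v v0).+1.
Hypothesis QB : exists M : R, forall v, `|Q v| <= M.

Local Notation H := (schrodinger adj Q).
Local Notation J := (jacobi_of H v0).
Local Notation tail_a := (tail_a d R).
Local Notation jac_b := (jac_b d q).

Let d_gt1 : (1 < d)%N. Proof. exact: ltnW. Qed.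

(** Cutting off at least one row removes the exceptional first off-diagonal entry sqrt(d). *)
Lemma tail_jacobi n : (0 < n)%N -> matrix_operator (tail J n) = tailop tail_a jac_b n.
Proof.
move=> n0; congr matrix_operator; apply/funext => i; apply/funext => j.
rewrite /tail (jacobi_entries htree d_gt1 hq) /jacN -!addSn !eqn_add2r.
have gaE k : jac_a d R (k + n) = tail_a by rewrite /jac_a addn_eq0 [n == _]gtn_eqF ?andbF.
by rewrite !gaE.
Qed.

Lemma jacobi_diag k : J k k = (jac_b k)%:C.
Proof. by rewrite (jacobi_entries htree d_gt1 hq) eqxx. Qed.

Lemma jacobi_offdiag k : (0 < k)%N -> J k k.+1 = tail_a%:C.
Proof.
move=> k0; rewrite (jacobi_entries htree d_gt1 hq) gtn_eqF// eqxx /jac_a.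
by rewrite gtn_eqF.
Qed.

(** For each [l] the index [l + n j] is eventually positive in absolute value, where the
    off-diagonal entry is already [tail_a]; this forces [ab.1], and only the diagonal imposes a
    condition. *)
Lemma right_limitP (ab : (int -> R) * (int -> R)) : right_limit J ab <->
  ab.1 = (fun=> tail_a) /\ exists2 n : nat -> nat, n j @[j --> \oo] --> \oo &
    forall l, jac_b (absz (l + (n j)%:Z)) @[j --> \oo] --> ab.2 l.
Proof.
have pos (n : nat -> nat) (l : int) : n j @[j --> \oo] --> \oo ->
    \forall j \near \oo, (0 < absz (l + (n j)%:Z)%R)%N.
  move=> ninf.
  have : \forall j \near \oo, (absz l < n j)%N.
    by apply: (ninf [set k | (absz l < k)%N]); exists (absz l).+1.
  by apply: filterS => j; lia.
have offd (n : nat -> nat) (l : int) (x : R) : n j @[j --> \oo] --> \oo ->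
    \forall j \near \oo, normc (J (absz (l + (n j)%:Z)) (absz (l + (n j)%:Z)).+1 - x%:C) =
      `|tail_a - x|.
  move=> ninf; apply: filterS (pos n l ninf) => j kj.
  by rewrite jacobi_offdiag// normc_realB.
split=> [[ab0 [n ninf hn]]|[a1 [n ninf hn]]].
  split.
    apply/funext => l; have [h _] := hn l.
    apply/esym/subr0_eq/normr0_eq0/eqP; rewrite eq_le normr_ge0 andbT.
    by apply: (cvgr_to_ge h); apply: filterS (offd n l (ab.1 l) ninf) => j <-.
  exists n => // l; have [_ h] := hn l.
  apply/cvgrPdist_le => e e0; have /cvgrPdist_le/(_ e e0) := h.
  apply: filterS => j; cbv zeta beta; rewrite jacobi_diag normc_realB sub0r normrN normr_id.
  by rewrite distrC.
split; first by move=> l; rewrite a1 sqrtr_ge0.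
exists n => // l; split.
  apply/cvgrPdist_le => e e0; apply: filterS (offd n l (ab.1 l) ninf) => j.
  cbv zeta beta => ->; by rewrite a1 subrr normr0 subr0 normr0 ltW.
apply/cvgrPdist_le => e e0; have /cvgrPdist_le/(_ e e0) := hn l.
apply: filterS => j; cbv zeta beta; rewrite jacobi_diag normc_realB sub0r normrN normr_id.
by rewrite distrC.
Qed.

Lemma ess_spectrum_limits : ess_spectrum H =
  (\bigcup_(ab in right_limit J) spectrum (matrix_operator (jacobiZ ab.1 ab.2)))
  `|` (\bigcup_(S in strong_limit_of_tails J) spectrum S).
Proof.
have bH := schrodinger_bop htree QB; have sH := schrodinger_sym htree QB.
have [M hM] := jac_b_bounded htree d_gt2 hq QB.
apply/seteqP; split=> z.
  move=> /(ess_far_singular bH sH) hfar.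
  have nUB : ~ tails_bounded_below tail_a jac_b z.
    by move=> /(tails_far_bounded_below htree d_gt2 hq QB).
  have [[b [n [bM ninf hb sz]]]|[b [n [bM [n1 nmono] hS sz]]]] :=
    not_bounded_below_limit hM nUB.
    by left; exists ((fun=> tail_a), b) => //; apply/right_limitP; split=> //; exists n.
  right; exists (matrix_operator (jacN tail_a b)) => //; split.
    exact: (band_bop nbN_uniq size_nbN nbN_sym (jacN_banded tail_a bM)).
  exists n; first by split.
  move=> psi hpsi; rewrite (_ : (fun j => _) = (fun j => l2norm (fun i =>
      tailop tail_a jac_b (n j) psi i - matrix_operator (jacN tail_a b) psi i))).
    exact: hS.
  by apply/funext => j; rewrite tail_jacobi.
move=> hz; apply: (far_singular_ess bH sH).
apply: (tails_far_singular htree d_gt2 hq QB).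
case: hz => [[[a b] /right_limitP[/= -> [n ninf hb]] sz]|[S [bS [n [n1 nmono] hS]] sz]].
  apply: (right_limit_not_bounded_below hM _ ninf hb sz) => l.
  have /cvg_norm h := hb l; apply: (cvgr_to_le h).
  by apply: filterE => j; exact: hM.
apply: (strong_limit_not_bounded_below hM bS nmono _ sz) => psi hpsi.
rewrite (_ : (fun j => _) = (fun j => l2norm (fun i =>
    matrix_operator (tail J (n j)) psi i - S psi i))).
  exact: hS.
by apply/funext => j; rewrite tail_jacobi.
Qed.

End EssentialSpectrumOfTree.

Theorem theorem3p2 (R : realType) (V : choiceType) (adj : rel V) (d : nat)
    (hd : (2 < d)%N) (htree : regular_tree adj d)
    (v0 : V) (Q : V -> R)
    (hbounded : exists M : R, forall v : V, `|Q v| <= M)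
    (hspherical : exists q : nat -> R, forall v : V, Q v = q (gdist adj v v0).+1) :
  let H := schrodinger adj Q in
  let J := jacobi_of H v0 in
  ess_spectrum H =
    (\bigcup_(ab in right_limit J) spectrum (matrix_operator (jacobiZ ab.1 ab.2)))
    `|` (\bigcup_(S in strong_limit_of_tails J) spectrum S).
Proof.
by have [q hq] := hspherical; exact: (ess_spectrum_limits htree hd hq hbounded).
Qed.
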